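(* A valuated matroid $V$ is transversal (i.e. $L(V)$ is in the image of the tropical Stiefel map) if and only if every matroid whose polytope is a maximal cell of the regular subdivision of $P_{\underline V}$ induced by $V$ is transversal.
   Context: A valuated matroid $V$ of rank $d$ on $[n]$ is a point of $\mathbb{TP}^{\binom nd-1}$ ($\mathbb T=\mathbb R\cup\{\infty\}$, projectivized by adding common scalars), coordinates $V_B$ indexed by $d$-subsets, such that for every $(d-1)$-set $A$ and $(d+1)$-set $C$ the minimum of $V_{A\cup\{j\}}+V_{C\setminus\{j\}}$ over $j\in C\setminus A$ is attained at least twice; $\underline V$ is the matroid with bases $\{B:V_B<\infty\}$. The matroid polytope of a matroid $M$ is $P_M=\operatorname{conv}\{e_B:B\text{ basis}\}$. For $x\in\mathbb R^n$ the initial matroid $V^x$ has as bases the $B$ minimizing $V_B-\sum_{i\in B}x_i$; the regular subdivision of $P_{\underline V}$ induced by $V$ has cells the polytopes $P_{V^x}$, and its maximal cells are those of the same dimension as $P_{\underline V}$. Tropical Stiefel map: for $A\in\mathbb T^{d\times n}$, $\pi(A)_B=\min\{\sum_{i=1}^dA_{i,j_i}:\{j_1,\dots,j_d\}=B\}$; $V$ is transversal if $V=\pi(A)$ for some $A$. A matroid is transversal if it is $\pi(A)$ for a matrix $A$ (identifying a matroid with the valuated matroid taking value $0$ on bases and $\infty$ elsewhere), equivalently it has a classical set-system transversal presentation by $d$ sets. *)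

(* Defs.v *)
From HB Require Import structures.
From mathcomp Require Import all_boot all_order all_algebra.
From mathcomp Require Import mathcomp_extra boolp classical_sets.
From mathcomp Require Import reals constructive_ereal ereal convex.

Set Implicit Arguments.
Unset Strict Implicit.
Unset Printing Implicit Defensive.

Import Order.TTheory GRing.Theory Num.Theory.
Local Open Scope ring_scope.

(* The tropical numbers T = R + {oo} are the extended reals x : \bar R with   *)
(* x != -oo.  A vector with coordinates indexed by the d-subsets of [n] is a  *)
(* function {set 'I_n} -> \bar R of which only the values at sets of          *)
(* cardinality d are ever used.  A point of the tropical projective space is  *)
(* given by a representative; see [transversal_valuated] for the scalar.      *)

Definition min_attained_twice (R : realType) (n : nat) (D : {set 'I_n})
    (f : 'I_n -> \bar R) : Prop :=
  exists j k : 'I_n, [/\ j \in D, k \in D, j != k,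
    forall i, i \in D -> (f j <= f i)%E & forall i, i \in D -> (f k <= f i)%E].

Record valuated_matroid (R : realType) (n d : nat)
    (V : {set 'I_n} -> \bar R) : Prop := ValuatedMatroid {
  vm_tropical : forall B : {set 'I_n}, #|B| = d -> V B != -oo%E;
  vm_point : exists2 B : {set 'I_n}, #|B| = d & V B != +oo%E;
  vm_plucker : forall A C : {set 'I_n}, #|A|.+1 = d -> #|C| = d.+1 ->
    min_attained_twice (C :\: A) (fun j => (V (j |: A) + V (C :\ j))%E)
}.

(* Rank-d matroids on [n], as sets of bases. *)
Record matroid (n d : nat) (M : {set {set 'I_n}}) : Prop := Matroid {
  matroid_rank : forall B, B \in M -> #|B| = d;
  matroid_neq0 : M != finset.set0;
  matroid_exchange : forall B1 B2, B1 \in M -> B2 \in M ->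
    forall i, i \in B1 :\: B2 ->
    exists2 j, j \in B2 :\: B1 & j |: (B1 :\ i) \in M
}.

Definition underlying (R : realType) (n d : nat) (V : {set 'I_n} -> \bar R) :
    {set {set 'I_n}} :=
  [set B : {set 'I_n} | (#|B| == d) && (V B < +oo)%E]%SET.

Definition matroid_val (R : realType) (n : nat) (M : {set {set 'I_n}}) :
    {set 'I_n} -> \bar R :=
  fun B => if B \in M then 0%E else +oo%E.

Definition initial_matroid (R : realType) (n d : nat)
    (V : {set 'I_n} -> \bar R) (x : 'rV[R]_n) : {set {set 'I_n}} :=
  let w (B : {set 'I_n}) := (V B - (\sum_(i in B) x ord0 i)%:E)%E in
  [set B : {set 'I_n} | (#|B| == d) &&
    [forall C : {set 'I_n}, (#|C| == d) ==> (w B <= w C)%E]]%SET.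

Definition indicator_vec (R : realType) (n : nat) (B : {set 'I_n}) : 'rV[R]_n :=
  \row_j (j \in B)%:R.

Definition convex_hull (R : realType) (n : nat) (X : set 'rV[R]_n) :
    set 'rV[R]_n :=
  smallest (@convex_set R 'rV[R]_n) X.

Definition matroid_polytope (R : realType) (n : nat) (M : {set {set 'I_n}}) :
    set 'rV[R]_n :=
  convex_hull [set indicator_vec R B | B in [set B | B \in M]]%classic.

Arguments matroid_polytope R {n} M _.

(* The affine dimension of a nonempty set X: the largest k such that X        *)
(* contains k + 1 affinely independent points p, p + row 0 D, p + row 1 D ... *)
Definition affine_dim (R : realType) (n : nat) (X : set 'rV[R]_n) : nat :=
  \max_(k < n.+1 | `[< exists (p : 'rV[R]_n) (D : 'M[R]_(k, n)),
     [/\ X p, forall i, X (p + row i D) & row_free D] >]) k.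

Definition subdivision_cell (R : realType) (n d : nat)
    (V : {set 'I_n} -> \bar R) (P : set 'rV[R]_n) : Prop :=
  exists x : 'rV[R]_n, P = matroid_polytope R (initial_matroid d V x).

Definition maximal_cell (R : realType) (n d : nat)
    (V : {set 'I_n} -> \bar R) (P : set 'rV[R]_n) : Prop :=
  subdivision_cell d V P /\
  affine_dim P = affine_dim (matroid_polytope R (underlying d V)).

(* Only used at B with #|B| = d, where the maps j with image B are the        *)
(* bijections from the rows onto B.                                           *)
Definition stiefel (R : realType) (n d : nat) (A : 'M[\bar R]_(d, n))
    (B : {set 'I_n}) : \bar R :=
  \big[Order.min/+oo%E]_(j : {ffun 'I_d -> 'I_n} | (j @: 'I_d)%SET == B)
    (\sum_(i < d) A i (j i))%E.

(* The scalar c expresses equality with stiefel A in projective space. *)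
Definition transversal_valuated (R : realType) (n d : nat)
    (V : {set 'I_n} -> \bar R) : Prop :=
  exists (A : 'M[\bar R]_(d, n)) (c : R),
    (forall i j, A i j != -oo%E) /\
    (forall B : {set 'I_n}, #|B| = d -> V B = (c%:E + stiefel A B)%E).

Definition transversal_matroid (R : realType) (n d : nat)
    (M : {set {set 'I_n}}) : Prop :=
  transversal_valuated d (matroid_val R M).

(* Main.v *)
Require Import Defs.
From HB Require Import structures.
From mathcomp Require Import all_boot all_order all_algebra all_fingroup.
From mathcomp Require Import interval_inference reals constructive_ereal.
From mathcomp Require boolp classical_sets.
From mathcomp Require Import zify lra ring.

Set Implicit Arguments.
Unset Strict Implicit.
Unset Printing Implicit Defensive.

Import Order.TTheory GRing.Theory Num.Theory.

(* A presentation (P_i) of a coloop-free transversal matroid M may be enlarged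
   to one whose members are the complements of cyclic sets F_i, and the multiset
   of the F_i is then determined by the rank function of M.
   Let Omega be the set of the points x for which V^x is coloop-free; it is
   closed under coordinatewise maximum, and for a cyclic set G of V^x the cell at
   x + e 1_G (e small) is the face of V^x of the bases that meet G in as many
   elements as possible.  All cells at points of Omega are faces of maximal cells,
   hence transversal, and the multisets (F_i) at nearby points of Omega determine
   each other.  Moving x in the direction 1_F, for a member F of its multiset of
   least nullity, nothing changes any more; the limit is a tropical row.  An
   induction along the tropical segments max(x, z - s) shows that this row
   accounts for one member of the multiset at every point of Omega.  Removing it
   and repeating, one obtains d rows.  That their tight sets, and not only the
   closures of these, present every V^x follows from the same ray argument
   applied to a minimal violation.  Finally V and the image of the rows under the
   Stiefel map differ by a constant, because Omega is connected by tropical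
   segments, and because lowering the coordinates of the coloops of V^x leads
   from any x to a point of Omega without losing bases of V^x.
   For the converse, two matchings are recombined at one row: if V is given by a
   matrix, every column that is avoided by some optimal matching is tight in no
   row more cheaply than the entry used by an optimal matching. *)

(** The tight sets of a row cannot be read off from the cells, since a transversal matroid has many
    presentations. Their closures can: the number of members not containing a cyclic set is its
    rank, and Moebius inversion recovers the multiset. Rows are therefore traced through Omega by
    closures alone, and the return to tight sets needs its own argument. Coloops obstruct the
    tracing: a move in direction 1_G adds the complement of G to some members, and the result is
    cyclic because the whole ground set is. Hence the coloops shared by all bases of V are
    contracted beforehand and restored as rows with one finite entry. A face of a transversal
    matroid need not be transversal, but one without further coloops is: a presented maximal cell,
    with value 0, is itself given by a matrix, so the converse direction applies to its initial
    matroids. Near a point only finitely many affine inequalities matter, so limits are handled by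
    germs at 0 from the right. *)

Local Open Scope nat_scope.

(** * Recombining two matchings *)

Section Split.
Variables (I E : finType).
Implicit Types (D : {set I}) (p q : I -> E).

(** The rows are edges joining [p i] to [q i] in a multigraph on the columns; this is the degree, a
    loop counting twice. *)
Definition coldeg D p q (c : E) := \sum_(i in D) ((p i == c) + (q i == c)).

(** An orientation of all edges with distinct heads and distinct tails. Degrees at most 2 suffice,
    the components being paths and cycles. *)
Definition splits D p q (s : I -> bool) :=
  {in D &, injective (fun i => if s i then p i else q i)} /\
  {in D &, injective (fun i => if s i then q i else p i)}.

Lemma coldeg_split D p q (s : I -> bool) c :
  \sum_(i in D) ((if s i then p i else q i) == c)
  + \sum_(i in D) ((if s i then q i else p i) == c) = coldeg D p q c.
Proof.
rewrite -big_split; apply: eq_bigr => i _ /=.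
by case: (s i); rewrite // addnC.
Qed.

Lemma coldegD1 D p q c i : i \in D ->
  coldeg D p q c = ((p i == c) + (q i == c)) + coldeg (D :\ i) p q c.
Proof. by move=> iD; rewrite /coldeg (big_setD1 i). Qed.

Lemma coldeg0 D p q c i : i \in D -> coldeg D p q c = 0 ->
  forall b : bool, (if b then p i else q i) <> c.
Proof.
move=> iD; rewrite (coldegD1 _ _ _ iD) => z b /eqP e.
by case: b e z => ->; lia.
Qed.

(* A row through the first column of i0 is rerouted to its second column and
   i0 is dropped; a splitting of the rest determines one for all rows. *)
Lemma split_two D p q :
  (forall c, coldeg D p q c <= 2) -> exists s, splits D p q s.
Proof.
move En: #|D| => m; elim: m => [|m IH] in D p q En *.
  move=> _; exists xpredT; move/eqP: En; rewrite cards_eq0 => /eqP->.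
  by split=> i k; rewrite inE.
move=> deg; have [i0 i0D] : exists i, i \in D by apply/card_gt0P; rewrite En.
have Em : #|D :\ i0| = m by move: En; rewrite (cardsD1 i0) i0D; lia.
have deg' c : ((p i0 == c) + (q i0 == c)) + coldeg (D :\ i0) p q c <= 2.
  by rewrite -coldegD1.
have inD' i : i \in D -> i = i0 \/ i \in D :\ i0.
  by rewrite !inE => ->; case: eqP; [left | right].
(* A loop at [i0] saturates its column, so no other row uses it. *)
have [pq|pq] := eqVneq (p i0) (q i0).
  have [|s [s1 s2]] := IH _ p q Em.
    by move=> c; apply: leq_trans (deg' c); apply: leq_addl.
  have z : coldeg (D :\ i0) p q (p i0) = 0.
    by move: (deg' (p i0)); rewrite -pq eqxx; lia.
  have zz i : i \in D :\ i0 -> forall b : bool, (if b then p i else q i) <> p i0.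
    by move=> iD; apply: coldeg0 iD z.
  exists s; split=> i k /inD'[->|iD] /inD'[->|kD] //.
  - by rewrite -pq if_same => /esym/(zz _ kD).
  - by rewrite -pq if_same => /(zz _ iD).
  - exact: s1.
  - by rewrite -pq if_same -if_neg => /esym/(zz _ kD).
  - by rewrite -pq if_same -if_neg => /(zz _ iD).
  - exact: s2.
have [/existsP[k /andP[kD ka]]|/existsPn none] :=
    boolP [exists k, (k \in D :\ i0) && ((p k == p i0) || (q k == p i0))].
  (* Exchanging the two columns of [k] flips its orientation, hence the xor below. *)
  wlog pka : p q ka pq deg deg' / p k = p i0 => [WL|].
    have [e|e] := eqVneq (p k) (p i0); first exact: WL.
    have qk : q k = p i0 by move: ka; rewrite (negbTE e) => /eqP.
    have ki0 : (i0 == k) = false by move: kD; rewrite !inE eq_sym; case: eqP.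
    pose p1 i := if i == k then q i else p i.
    pose q1 i := if i == k then p i else q i.
    have cd D' c : coldeg D' p1 q1 c = coldeg D' p q c.
      apply: eq_bigr => i _; rewrite /p1 /q1.
      by case: (i == k); rewrite // addnC.
    have := WL p1 q1; rewrite /p1 /q1 eqxx ki0 qk eqxx => /(_ isT pq).
    case=> [c|c||s [s1 s2]]; rewrite ?cd //.
    exists (fun i => s i (+) (i == k)); split=> i j iD jD eij.
      apply: s1 => //; move: eij; case: (i == k); case: (j == k);
        by case: (s i); case: (s j).
    apply: s2 => //; move: eij; case: (i == k); case: (j == k);
      by case: (s i); case: (s j).
  (* The two edges meeting at [p i0] are merged into one from [q i0] to [q k]. *)
  pose p' i := if i == k then q i0 else p i.
  have dk c : coldeg (D :\ i0) p q c + (q i0 == c) =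
      coldeg (D :\ i0) p' q c + (p i0 == c).
    rewrite !(coldegD1 _ _ _ kD) /p' eqxx pka.
    suff -> : coldeg (D :\ i0 :\ k) p' q c = coldeg (D :\ i0 :\ k) p q c by lia.
    apply: eq_bigr => i; rewrite !inE /p' => /andP[/negbTE-> _] //.
  have [c|s [s1 s2]] := IH _ p' q Em.
    by have := deg' c; have := dk c; lia.
  have za : coldeg (D :\ i0) p' q (p i0) = 0.
    have := deg' (p i0); have := dk (p i0).
    by rewrite eqxx [q i0 == _]eq_sym (negbTE pq); lia.
  have zz i : i \in D :\ i0 -> forall b : bool, (if b then p' i else q i) <> p i0.
    by move=> iD; apply: coldeg0 iD za.
  have p'E i : i != k -> p' i = p i by rewrite /p' => /negbTE->.
  have p'k : p' k = q i0 by rewrite /p' eqxx.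
  have i0N : i0 \notin D :\ i0 by rewrite !inE eqxx.
  have key1 i : i \in D :\ i0 ->
      (if s i then p i else q i) <> (if s k then q i0 else p i0).
    move=> iD; have [->|ik] := eqVneq i k.
      case sk: (s k); first by rewrite pka; apply/eqP.
      by have := zz k kD false.
    rewrite -p'E //; case sk: (s k); last exact: zz.
    rewrite -p'k => e; case/eqP: ik; apply: s1 => //.
    by rewrite sk.
  have key2 i : i \in D :\ i0 ->
      (if s i then q i else p i) <> (if s k then p i0 else q i0).
    move=> iD; have [->|ik] := eqVneq i k.
      case sk: (s k); last by rewrite pka; apply/eqP.
      by have := zz k kD false.
    rewrite -p'E //; case sk: (s k); first by rewrite -if_neg; exact: zz.
    rewrite -p'k => e; case/eqP: ik; apply: s2 => //.
    by rewrite sk.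
  (* Undoing the merger: [i0] is oriented against [k], so [p i0] is used once on each side. *)
  exists (fun i => if i == i0 then ~~ s k else s i).
  have nD i : i \in D :\ i0 -> (i == i0) = false by rewrite !inE; case: eqP.
  split=> i j /inD'[->|iD] /inD'[->|jD] //; rewrite ?eqxx ?(nD _ iD) ?(nD _ jD).
  - by rewrite if_neg => /esym/(key1 _ jD).
  - by rewrite if_neg => /(key1 _ iD).
  - have [->|ik] := eqVneq i k; have [->|jk] := eqVneq j k => //.
    + case sk: (s k) => e; last by apply: s1 => //; rewrite sk e p'E.
      by case: (zz j jD (s j)); rewrite p'E // -pka e.
    + case sk: (s k) => e; last by apply: s1 => //; rewrite sk -e p'E.
      by case: (zz i iD (s i)); rewrite p'E // -pka e.
    + by move=> e; apply: s1 => //; rewrite !p'E.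
  - by rewrite if_neg => /esym/(key2 _ jD).
  - by rewrite if_neg => /(key2 _ iD).
  - have [->|ik] := eqVneq i k; have [->|jk] := eqVneq j k => //.
    + case sk: (s k) => e; first by apply: s2 => //; rewrite sk e p'E.
      by case: (zz j jD (~~ s j)); rewrite if_neg p'E // -pka e.
    + case sk: (s k) => e; first by apply: s2 => //; rewrite sk -e p'E.
      by case: (zz i iD (~~ s i)); rewrite if_neg p'E // -pka e.
    + by move=> e; apply: s2 => //; rewrite !p'E.
have [|s [s1 s2]] := IH _ p q Em.
  by move=> c; apply: leq_trans (deg' c); apply: leq_addl.
have zz i : i \in D :\ i0 -> forall b : bool, (if b then p i else q i) <> p i0.
  move=> iD; move: (none i); rewrite iD /= negb_or => /andP[/eqP pi /eqP qi].
  by case.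
have nD i : i \in D :\ i0 -> (i == i0) = false by rewrite !inE; case: eqP.
(* Now [p i0] is private to [i0], whose orientation only has to avoid the side that already uses
   [q i0]. *)
have [/existsP[k /andP[kD kb]]|/existsPn noq] :=
    boolP [exists k, (k \in D :\ i0) && ((if s k then p k else q k) == q i0)].
  have key i : i \in D :\ i0 -> (if s i then q i else p i) <> q i0.
    move=> iD /eqP ib; have := deg' (q i0).
    rewrite -(coldeg_split _ _ _ s) (big_setD1 k) //= kb.
    by rewrite (big_setD1 i iD) /= ib eqxx; lia.
  exists (fun i => (i == i0) || s i).
  split=> i j /inD'[->|iD] /inD'[->|jD] //; rewrite ?eqxx ?(nD _ iD) ?(nD _ jD) /=.
  - by move/esym/(zz _ jD).
  - by move/zz.
  - exact: s1.
  - by move/esym/key.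
  - by move/key.
  - exact: s2.
have key i : i \in D :\ i0 -> (if s i then p i else q i) <> q i0.
  by move=> iD; move: (noq i); rewrite iD => /eqP.
exists (fun i => (i != i0) && s i).
split=> i j /inD'[->|iD] /inD'[->|jD] //; rewrite ?eqxx ?(nD _ iD) ?(nD _ jD) /=.
- by move/esym/key.
- by move/key.
- exact: s1.
- by rewrite -if_neg => /esym/(zz _ jD).
- by rewrite -if_neg => /zz.
- exact: s2.
Qed.
End Split.

Lemma sum_inj_le1 (I E : finType) (p : I -> E) c :
  injective p -> \sum_i (p i == c) <= 1.
Proof.
move=> pI; have [/existsP[i /eqP pi]|/existsPn n] := boolP [exists i, p i == c].
  rewrite (bigD1 i) //= big1 => [|k ki]; first by rewrite pi eqxx.
  by rewrite -pi (inj_eq pI) (negbTE ki).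
by rewrite big1 // => i _; rewrite (negbTE (n i)).
Qed.

(** Column [c] is used at most once by [p], once by row [i] and never by [q], so degrees stay at
    most 2. The row-by-row conclusion keeps the total of any row-dependent weights. *)
Lemma reroute (I E : finType) (p q : I -> E) i c :
  injective p -> injective q -> (forall k, q k != c) ->
  let p1 := fun k => if k == i then c else p k in
  exists m1 m2 : I -> E, [/\ injective m1, injective m2 &
    forall k, (m1 k = p1 k /\ m2 k = q k) \/ (m1 k = q k /\ m2 k = p1 k)].
Proof.
move=> pI qI cq p1.
have [|s [s1 s2]] := @split_two I E setT p1 q.
  move=> c'; rewrite /coldeg big_split /=.
  under eq_bigl do rewrite inE; under [X in _ + X]eq_bigl do rewrite inE.
  have [<-|cc'] := eqVneq c c'.
    rewrite [X in _ + X]big1 ?addn0 => [|k _]; last by rewrite (negbTE (cq k)).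
    rewrite (bigD1 i) //= /p1 eqxx eqxx.
    apply: (@leq_add _ _ 1 1) => //.
    apply: leq_trans (sum_inj_le1 c pI); rewrite [leqRHS](bigD1 i) //=.
    apply: leq_trans (leq_addl _ _); apply: leq_sum => k.
    by move=> /negbTE->.
  apply: (@leq_add _ _ 1 1); last exact: sum_inj_le1.
  apply: leq_trans (sum_inj_le1 c' pI); apply: leq_sum => k _.
  by rewrite /p1; case: ifP; rewrite ?(negbTE cc').
exists (fun i => if s i then p1 i else q i), (fun i => if s i then q i else p1 i).
split; first by move=> x y; apply: s1; rewrite inE.
  by move=> x y; apply: s2; rewrite inE.
by move=> k; case: (s k); [left | right].
Qed.

(** * Matroids, rank and cyclic sets *)

(** Symmetric exchange is what cells of a valuated matroid inherit and what faces preserve. Every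
    matroid below arises in this way, so the one-sided axiom never has to be strengthened. *)
Record mat (E : finType) (d : nat) (M : {set {set E}}) : Prop := Mat {
  mat_card : forall B, B \in M -> #|B| = d;
  mat_ex : exists B, B \in M;
  mat_exch : forall B1 B2 i, B1 \in M -> B2 \in M -> i \in B1 :\: B2 ->
    exists j, [/\ j \in B2 :\: B1, j |: B1 :\ i \in M & i |: B2 :\ j \in M]
}.

Section Rank.
Variables (E : finType) (M : {set {set E}}).
Implicit Types (B X Y Z G H F T : {set E}).

Definition rk X := \max_(B in M) #|B :&: X|.

(** The union of the circuits inside [H]: the elements that are no coloops of the restriction to
    [H]. *)
Definition cyc H := [set j in H | rk (H :\ j) == rk H].

Definition cyclic G := cyc G == G.

Definition coloopfree := forall j, exists2 B, B \in M & j \notin B.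

(** As a matroid, the direct sum of the restriction to [G] and the contraction by [G]. *)
Definition face G := [set B in M | #|B :&: G| == rk G].

(* The effect on complements of closed rows of passing to the face. *)
Definition to_face G F := if G \subset F then F else cyc (F :&: G) :|: ~: G.

Lemma rk_ge B X : B \in M -> #|B :&: X| <= rk X.
Proof. by move=> BM; rewrite /rk (bigD1 B) //= leq_maxl. Qed.

Lemma rk_le X k : (forall B, B \in M -> #|B :&: X| <= k) -> rk X <= k.
Proof. by move=> h; apply/bigmax_leqP. Qed.

Variables (d : nat).
Hypothesis hM : mat d M.

Lemma rk_attained X : exists2 B, B \in M & #|B :&: X| = rk X.
Proof.
have [B0 B0M] := mat_ex hM.
have Mgt : 0 < #|M| by apply/card_gt0P; exists B0.
by case: (eq_bigmax_cond (fun B => #|B :&: X|) Mgt) => B BM e; exists B.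
Qed.

Lemma rk_card X : rk X <= #|X|.
Proof. by apply: rk_le => B _; rewrite subset_leq_card ?subsetIr. Qed.

Lemma rkT : rk setT = d.
Proof.
have [B BM <-] := rk_attained setT; by rewrite setIT (mat_card hM BM).
Qed.

Lemma rk_leD X Y : rk X <= rk Y + #|X :\: Y|.
Proof.
apply: rk_le => B BM; apply: leq_trans (leq_add (rk_ge Y BM) (leqnn _)).
apply: leq_trans (leq_card_setU _ _).1; apply/subset_leq_card/subsetP => j.
by rewrite !inE => /andP[-> ->]; rewrite andbT orbN.
Qed.

Lemma rkS X Y : X \subset Y -> rk X <= rk Y.
Proof.
rewrite -setD_eq0 => /eqP s; have := rk_leD X Y.
by rewrite s cards0 addn0.
Qed.

Lemma card_swapI B X i j : i \in B -> j \notin B ->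
  #|(j |: B :\ i) :&: X| + (i \in X) = #|B :&: X| + (j \in X).
Proof.
move=> iB jB; rewrite setIUl.
have -> : [set j] :&: X = if j \in X then [set j] else set0.
  by apply/setP => k; case: ifP => jX; rewrite !inE; case: eqP => // ->.
have -> : #|B :&: X| = (i \in X) + #|(B :\ i) :&: X|.
  rewrite (cardsD1 i) !inE iB /=; congr (_ + _); apply: eq_card => k.
  by rewrite !inE andbA.
case: ifP => jX; last by rewrite set0U addn0 addnC.
rewrite cardsU1 !inE jX (negbTE jB) !andbF /=; lia.
Qed.

(** An exchange with a basis meeting [X] in more elements either brings an element of [X] into [B],
    or moves that basis closer to [B] without changing its intersection with [X]. *)
Lemma rk_augment B X : B \in M -> #|B :&: X| < rk X ->
  exists i j, [/\ i \in B :\: X, j \in X :\: B & j |: B :\ i \in M].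
Proof.
move=> BM lt.
have [B2 [B2M lt2]] : exists B2, B2 \in M /\ #|B :&: X| < #|B2 :&: X|.
  by have [B2 B2M e] := rk_attained X; exists B2; rewrite e.
move En: #|B2 :\: B| => m; elim: m => [|m IH] in B2 B2M lt2 En *.
  move: En lt2 => /eqP; rewrite cards_eq0 setD_eq0 => s.
  by rewrite ltnNge subset_leq_card ?setSI.
have [i iX] : exists i, i \in (B :\: X) :\: B2.
  apply/set0Pn; rewrite setD_eq0; apply: contraL lt2 => s.
  have := cardsID X B; have := cardsID X B2.
  rewrite (mat_card hM BM) (mat_card hM B2M) => e1 e2.
  have /subset_leq_card : B :\: X \subset B2 :\: X.
    apply/subsetP => k kBX; rewrite inE (subsetP s) // andbT.
    by move: kBX; rewrite inE => /andP[].
  by rewrite -leqNgt; lia.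
have [|j [jB b1 b2]] := mat_exch (i := i) hM BM B2M.
  by move: iX; rewrite !inE => /and3P[-> _ ->].
have [jX|jX] := boolP (j \in X).
  exists i, j; split=> //; first by move: iX; rewrite !inE => /and3P[_ -> ->].
  by move: jB; rewrite !inE jX => /andP[-> _].
move: (iX) (jB); rewrite !inE => /and3P[iB2 iNX iB] /andP[jNB jB2].
apply: (IH _ b2).
  by have := card_swapI X jB2 iB2; rewrite (negbTE jX) (negbTE iNX) !addn0 => ->.
have -> : (i |: B2 :\ j) :\: B = (B2 :\: B) :\ j.
  apply/setP => k; rewrite !inE; case: (eqVneq k i) => [->|_] /=.
    by rewrite iB /= andbF.
  by rewrite andbCA.
by move: En; rewrite (cardsD1 j) !inE jNB jB2 => -[].
Qed.

(** A basis with the largest sum of the three intersections works: an augmentation at one member of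
    the chain decreases no other count, the members being nested. *)
Lemma rk_chain X Y Z : X \subset Y -> Y \subset Z ->
  exists B, [/\ B \in M, #|B :&: X| = rk X, #|B :&: Y| = rk Y & #|B :&: Z| = rk Z].
Proof.
move=> XY YZ; have XZ := subset_trans XY YZ.
have [B0 B0M] := mat_ex hM.
pose w B := #|B :&: X| + #|B :&: Y| + #|B :&: Z|.
case: (@arg_maxnP _ B0 (mem M) w B0M) => B BM wB.
exists B; suff key (W : {set E}) : (forall i j, i \notin W -> j \in W ->
    (i \in X) + (i \in Y) + (i \in Z) < (j \in X) + (j \in Y) + (j \in Z)) ->
    #|B :&: W| = rk W.
  split=> //; apply: key => i j iW jW.
  - have jY := subsetP XY _ jW; have jZ := subsetP YZ _ jY.
    by rewrite (negbTE iW) jW jY jZ; case: (i \in Y); case: (i \in Z).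
  - have jZ := subsetP YZ _ jW; have iX := contra (subsetP XY i) iW.
    by rewrite (negbTE iW) (negbTE iX) jW jZ; case: (j \in X); case: (i \in Z).
  - have iY := contra (subsetP YZ i) iW; have iX := contra (subsetP XY i) iY.
    by rewrite (negbTE iW) (negbTE iX) (negbTE iY) jW addn1.
move=> h; apply/eqP; rewrite eqn_leq rk_ge //= leqNgt; apply/negP => lt.
have [i [j [iBW jWB b]]] := rk_augment BM lt.
move: iBW jWB; rewrite !inE => /andP[iW iB] /andP[jB jW].
have := wB _ b; have := h i j iW jW; rewrite /w.
have := card_swapI X iB jB; have := card_swapI Y iB jB.
have := card_swapI Z iB jB; clear.
move: #|_ :&: X| #|_ :&: X| #|_ :&: Y| #|_ :&: Y| #|_ :&: Z| #|_ :&: Z|.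
by move=> a1 a2 b1 b2 c1 c2; lia.
Qed.

Lemma rk_submod X Y : rk (X :&: Y) + rk (X :|: Y) <= rk X + rk Y.
Proof.
have [B [BM e _ f]] := rk_chain (subsetIl X Y) (subsetUl X Y).
rewrite -e -f; have := cardsUI (B :&: X) (B :&: Y).
rewrite -setIUr setIACA setIid addnC => ->.
by rewrite leq_add ?rk_ge.
Qed.

Lemma rk_set0 : rk set0 = 0.
Proof. by apply/eqP; rewrite -leqn0; apply: leq_trans (rk_card _) _; rewrite cards0. Qed.

Lemma cyc_sub H : cyc H \subset H.
Proof. by apply/subsetP => j; rewrite inE => /andP[]. Qed.

(** A basis attaining the ranks of both sets contains all coloops of the restriction to [H]. *)
Lemma rk_cyc H : rk (cyc H) + #|H :\: cyc H| = rk H.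
Proof.
have [B [BM e _ f]] := rk_chain (cyc_sub H) (subxx H).
rewrite -e -f -(cardsID (cyc H) (B :&: H)); congr (_ + _).
  by rewrite -setIA (setIidPr (cyc_sub H)).
apply: eq_card => j; rewrite !inE.
case jH: (j \in H); rewrite ?andbF //= !andbT; case: eqP => //= n.
apply/esym; apply: contraT => jB; case: n; apply/eqP.
rewrite eqn_leq rkS ?subD1set //= -f.
apply: leq_trans (rk_ge (H :\ j) BM); apply/subset_leq_card/subsetP => k.
by rewrite !inE => /andP[kB ->]; rewrite kB !andbT; apply: contraNneq jB => <-.
Qed.

Lemma cyclicP G : reflect (forall j, j \in G -> rk (G :\ j) = rk G) (cyclic G).
Proof.
apply: (iffP eqP) => [e j|h]; first by rewrite -{1}e inE => /andP[_ /eqP].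
by apply/setP => j; rewrite inE; case jG: (j \in G); rewrite //= h ?eqxx.
Qed.

Lemma cyc_cyclic H : cyclic (cyc H).
Proof.
apply/cyclicP => j jc; apply/eqP; rewrite eqn_leq rkS ?subD1set //=.
have := rk_cyc H; move: (jc); rewrite inE => /andP[jH /eqP <-].
have := rk_leD (H :\ j) (cyc H :\ j).
have -> : (H :\ j) :\: (cyc H :\ j) = H :\: cyc H.
  apply/setP => k; rewrite !inE; case: (eqVneq k j) => [->|_] //=.
  by move: jc; rewrite inE => /andP[-> ->].
by lia.
Qed.

(** By submodularity, deleting [j] costs [H] no more rank than it costs [G]. *)
Lemma cyc_max G H : cyclic G -> G \subset H -> G \subset cyc H.
Proof.
move=> /cyclicP cG GH; apply/subsetP => j jG.
rewrite inE (subsetP GH) //= eqn_leq rkS ?subD1set //=.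
have := rk_submod (H :\ j) G.
have -> : (H :\ j) :&: G = G :\ j by rewrite setIDAC (setIidPr GH).
have -> : (H :\ j) :|: G = H.
  apply/setP => k; rewrite !inE; case: (eqVneq k j) => [->|_] /=.
    by rewrite jG (subsetP GH).
  by case kG: (k \in G); rewrite ?orbF // (subsetP GH) // orbT.
by rewrite (cG j jG); lia.
Qed.

Lemma cyc_mono G H : G \subset H -> cyc G \subset cyc H.
Proof.
by move=> GH; apply: cyc_max (cyc_cyclic G) _; apply: subset_trans (cyc_sub _) GH.
Qed.

Lemma cyc0_rk H : cyc H = set0 -> rk H = #|H|.
Proof. by move=> e; rewrite -(rk_cyc H) e rk_set0 setD0. Qed.

Lemma coloopfreeP : coloopfree <-> cyclic setT.
Proof.
split=> [h|/cyclicP h j].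
  apply/cyclicP => j _; apply/eqP; rewrite eqn_leq rkS ?subD1set //= rkT.
  have [B BM jB] := h j; apply: leq_trans (rk_ge _ BM).
  rewrite -(mat_card hM BM); apply/subset_leq_card/subsetP => k kB.
  by rewrite !inE kB andbT; apply: contraNneq jB => <-.
have [B BM e] := rk_attained (setT :\ j); exists B => //.
move: e; rewrite h ?inE // rkT -(mat_card hM BM) => e.
have := subset_leqif_cards (subsetIl B (setT :\ j)); rewrite e => -[_].
by rewrite eqxx => /esym/eqP E1; rewrite -E1 !inE eqxx andbF.
Qed.

Lemma swap_arith a1 a2 e x y :
  a1 + x = e + y -> a2 + y = e + x -> a1 <= e -> a2 <= e -> a1 = e /\ a2 = e.
Proof. lia. Qed.

(** The exchanged pair meets [G] in as many elements altogether as the original pair, which attains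
    the maximum twice. *)
Lemma mat_face G : mat d (face G).
Proof.
split=> [B|| B1 B2 i]; first by rewrite inE => /andP[/(mat_card hM)].
  by have [B BM e] := rk_attained G; exists B; rewrite inE BM e eqxx.
rewrite !inE => /andP[b1 /eqP e1] /andP[b2 /eqP e2] ib.
have [j [jb m1 m2]] : exists j, [/\ j \in B2 :\: B1, j |: B1 :\ i \in M & i |: B2 :\ j \in M].
  by apply: (mat_exch hM b1 b2); rewrite inE.
move: (jb) ib; rewrite !inE => /andP[jB1 jB2] /andP[iB2 iB1].
have s1 := card_swapI G iB1 jB1; have s2 := card_swapI G jB2 iB2.
rewrite e1 in s1; rewrite e2 in s2.
exists j; rewrite !inE jB1 jB2 m1 m2 /=.
by have [-> ->] := swap_arith s1 s2 (rk_ge G m1) (rk_ge G m2); rewrite eqxx.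
Qed.
End Rank.

Arguments rk_attained {E M d}.
Arguments cyc_cyclic {E M d}.

(** * Ranks, cyclic sets and closed rows in a face *)

Section Face.
Variables (E : finType) (d : nat) (M : {set {set E}}).
Hypothesis hM : mat d M.
Implicit Types (G H F T : {set E}).

(** A basis adapted to the chain [H :&: G], [H :|: G] and lying in the face attains the bound given
    by counting. The additive form avoids truncated subtraction. *)
Lemma rk_face G H :
  rk (face M G) H + rk M G = rk M (H :&: G) + rk M (H :|: G).
Proof.
have UI B : #|B :&: H| + #|B :&: G| = #|B :&: (H :&: G)| + #|B :&: (H :|: G)|.
  have := cardsUI (B :&: H) (B :&: G).
  by rewrite -setIUr setIACA setIid addnC => ->.
apply/eqP; rewrite eqn_leq; apply/andP; split.
  have [B + e] := rk_attained (mat_face hM G) H.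
  rewrite inE => /andP[BM /eqP f].
  by rewrite -e -f UI leq_add ?rk_ge.
have [B [BM e f g]] := rk_chain hM (subsetIr H G) (subsetUr H G).
have BF : B \in face M G by rewrite inE BM f eqxx.
by rewrite -e -g -UI f leq_add2r rk_ge.
Qed.

(** By [rk_face], deleting an element of [G] affects only the rank of [H :&: G], deleting another
    one only that of [H :|: G]. Elements of [G] in [H :|: G] are covered by the cyclicity of [G]. *)
Lemma cyclic_face G H : cyclic M G ->
  cyclic (face M G) H = cyclic M (H :&: G) && cyclic M (H :|: G).
Proof.
move=> cG; have hF := mat_face hM G.
apply/idP/andP => [/cyclicP h|[/cyclicP h1 /cyclicP h2]]; last first.
  apply/cyclicP => j jH.
  have := rk_face G H; have := rk_face G (H :\ j).
  have [jG|jG] := boolP (j \in G).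
    have -> : (H :\ j) :&: G = (H :&: G) :\ j by rewrite setIDAC.
    have -> : (H :\ j) :|: G = H :|: G.
      by apply/setP => k; rewrite !inE; case: eqP => [->|]; rewrite ?jG ?orbT.
    by rewrite h1 ?inE ?jH //; lia.
  have -> : (H :\ j) :&: G = H :&: G.
    by apply/setP => l; rewrite !inE; case: eqP => [->|]; rewrite ?(negbTE jG) ?andbF.
  have -> : (H :\ j) :|: G = (H :|: G) :\ j.
    by apply/setP => l; rewrite !inE; case: eqP => [->|] //=; rewrite (negbTE jG).
  by rewrite h2 ?inE ?jH //; lia.
split; first apply/cyclicP => j.
    rewrite inE => /andP[jH jG]; have := h j jH.
    have := rk_face G H; have := rk_face G (H :\ j).
    have -> : (H :\ j) :&: G = (H :&: G) :\ j by rewrite setIDAC.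
    have -> : (H :\ j) :|: G = H :|: G.
      by apply/setP => k; rewrite !inE; case: eqP => [->|]; rewrite ?jG ?orbT.
    by lia.
apply/eqP/setP => k; rewrite inE; case kU: (_ \in _) => //=.
  apply/eqP; have [kG|kG] := boolP (k \in G).
    have kc : k \in cyc M (H :|: G).
      by apply: (subsetP (cyc_max hM cG _)) kG; apply: subsetUr.
    by move: kc; rewrite inE => /andP[_ /eqP].
  have kH : k \in H by move: kU; rewrite inE (negbTE kG) orbF.
  have := h k kH; have := rk_face G H; have := rk_face G (H :\ k).
  have -> : (H :\ k) :&: G = H :&: G.
    by apply/setP => l; rewrite !inE; case: eqP => [->|]; rewrite ?(negbTE kG) ?andbF.
  have -> : (H :\ k) :|: G = (H :|: G) :\ k.
    apply/setP => l; rewrite !inE; case: eqP => [->|] //=.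
    by rewrite (negbTE kG).
  by lia.
Qed.

Lemma coloopfree_face G : coloopfree M -> cyclic M G -> coloopfree (face M G).
Proof.
move=> /(coloopfreeP hM) cT cG; apply/(coloopfreeP (mat_face hM G)).
by rewrite cyclic_face // setTI setTU cG.
Qed.

Lemma face_coloopfree_cyclic G : coloopfree (face M G) -> cyclic M G.
Proof.
move=> /(coloopfreeP (mat_face hM G))/cyclicP h.
apply/cyclicP => j jG; have := h j (in_setT j).
have := rk_face G setT; have := rk_face G (setT :\ j).
rewrite setTI setTU.
have -> : (setT :\ j) :&: G = G :\ j.
  by apply/setP => k; rewrite !inE andbT.
have -> : (setT :\ j) :|: G = setT.
  by apply/setP => k; rewrite !inE; case: eqP => [->|] //=; rewrite jG.
by lia.
Qed.

(** The tight set of a row after a small move in direction 1_G, which breaks ties in favour of [G]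
    where possible. *)
Definition restr T G := if T :&: G == set0 then T else T :&: G.

Lemma cyclic_to_face G F : coloopfree M -> cyclic M G -> cyclic M F ->
  cyclic (face M G) (to_face M G F).
Proof.
move=> /(coloopfreeP hM) cT cG cF; rewrite cyclic_face // /to_face.
case: ifP => [s|_].
  by rewrite (setIidPr s) (setUidPl s) cG cF.
have s : cyc M (F :&: G) \subset G.
  by apply: subset_trans (cyc_sub _ _) (subsetIr _ _).
rewrite setIUl setIC [~: G :&: G]setIC setICr setU0 (setIidPr s) (cyc_cyclic hM) //=.
by rewrite -setUA [~: G :|: G]setUC setUCr setUT.
Qed.

(** Translates containment in a member of the face back to containment in [F], as needed for
    counting members. *)
Lemma sub_to_face G F H : cyclic (face M G) H -> cyclic M G -> cyclic M F ->
  (H \subset to_face M G F) =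
  if G \subset F then H :|: G \subset F else H :&: G \subset F.
Proof.
move=> cH cG cF; rewrite /to_face; case: ifP => s.
  by rewrite subUset s andbT.
move: cH; rewrite cyclic_face // => /andP[c1 _].
apply/idP/idP => [h|h].
  apply/subsetP => k; rewrite inE => /andP[kH kG].
  move: (subsetP h _ kH); rewrite !inE kG orbF => /andP[/andP[kF _] _].
  exact: kF.
have h' : H :&: G \subset cyc M (F :&: G).
  by apply: (cyc_max hM) => //; rewrite subsetI h subsetIr.
by rewrite -(setID H G) setUSS // setDE subsetIr.
Qed.

(** Passing to the face commutes with closing a row. Both sides are largest cyclic sets of the face,
    compared by [cyc_max]. *)
Lemma cyc_face G T : coloopfree M -> cyclic M G ->
  cyc (face M G) (~: restr T G) = to_face M G (cyc M (~: T)).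
Proof.
move=> hN cG; have hF := mat_face hM G.
have cF := cyc_cyclic hM (~: T); have ctf := cyclic_to_face hN cG cF.
have GF : (G \subset cyc M (~: T)) = (T :&: G == set0).
  apply/idP/idP => h.
    rewrite setI_eq0 disjoint_sym disjoints_subset.
    exact: subset_trans h (cyc_sub _ _).
  by apply: (cyc_max hM) => //; rewrite -disjoints_subset disjoint_sym -setI_eq0.
apply/eqP; rewrite eqEsubset; apply/andP; split.
  rewrite (sub_to_face (cyc_cyclic hF _)) // GF /restr; case h: (T :&: G == set0).
    have := cyc_cyclic hF (~: T); rewrite cyclic_face // => /andP[_ c2].
    apply: (cyc_max hM) => //; rewrite subUset cyc_sub -disjoints_subset disjoint_sym.
    by rewrite -setI_eq0.
  have := cyc_cyclic hF (~: (T :&: G)); rewrite cyclic_face // => /andP[c1 _].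
  apply: (cyc_max hM) => //; apply/subsetP => k; rewrite inE => /andP[kc kG].
  have := subsetP (cyc_sub _ _) _ kc.
  by rewrite !inE kG andbT.
apply: (cyc_max hF) => //; rewrite /to_face GF /restr; case h: (T :&: G == set0).
  exact: cyc_sub.
rewrite subUset; apply/andP; split.
  apply: subset_trans (cyc_sub _ _) _; apply/subsetP => k; rewrite !inE.
  by move=> /andP[/andP[kT _] _]; rewrite (negbTE kT).
by apply/subsetP => k; rewrite !inE => /negbTE->; rewrite andbF.
Qed.

(* The nullity of F is at most that of ~: K in the face; the terms are moved so
   that no truncated subtraction occurs. *)
Lemma to_face_nullity K F : cyclic M K -> K != set0 ->
  to_face M K F = ~: K -> coloopfree M ->
  #|F| + d <= #|~: K| + rk M K + rk M F /\
  (#|F| + d = #|~: K| + rk M K + rk M F -> ~: K \subset F).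
Proof.
move=> cK K0 e hN.
have KF : (K \subset F) = false.
  apply/negP => s; move: e; rewrite /to_face s => e.
  by move: s; rewrite e -setD_eq0 setDE setCK setIid (negbTE K0).
(* No circuit lies in [F :&: K], so its rank is its size and submodularity bounds the rank of [F]
   from below. *)
have c0 : cyc M (F :&: K) = set0.
  move: e; rewrite /to_face KF => e; apply/eqP; rewrite -subset0 -(setICr K).
  have s : cyc M (F :&: K) \subset ~: K by apply/setUidPr.
  rewrite subsetI s andbT.
  by apply: subset_trans (cyc_sub _ _) (subsetIr _ _).
have r1 := cyc0_rk hM c0.
have r2 := rk_submod hM F K; rewrite r1 in r2.
have r3 := rk_leD M setT (F :|: K); rewrite (rkT hM) setTD in r3.
have k2 := cardsID F (~: K).
have k3 : ~: K :&: F = F :\: K by rewrite setDE setIC.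
have k4 : ~: K :\: F = ~: (F :|: K) by rewrite setDE setCU setIC.
rewrite k3 k4 in k2; have k5 := cardsID K F.
split; first by clear -r2 r3 k2 k5; lia.
(* Equality would make every element outside [F :|: K] a coloop, and there is none. *)
move=> q; have tight : d = rk M (F :|: K) + #|~: (F :|: K)|.
  by clear -r2 r3 k2 k5 q; lia.
rewrite -setD_eq0 k4 -subset0; apply/subsetP => j jC.
have [B BM jB] := hN j.
have := rk_ge (F :|: K) BM; have := cardsID (F :|: K) B.
rewrite (mat_card hM BM) => w1 w2.
have : #|B :\: (F :|: K)| < #|~: (F :|: K)|.
  apply/proper_card/properP; split; first by rewrite setDE subsetIr.
  by exists j => //; rewrite !inE (negbTE jB) andbF.
by clear -tight w1 w2; lia.
Qed.
End Face.

(** * Presentations *)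

Section Presentation.
Variables (E I : finType).
Implicit Types (P : I -> {set E}) (m : I -> E) (B F G : {set E}).

Definition is_match P m B :=
  [/\ injective m, forall i, m i \in P i & B = [set m i | i : I]].

Definition presents (M : {set {set E}}) P :=
  forall B, B \in M <-> exists m, is_match P m B.

Lemma card_matchI P m B F : is_match P m B ->
  #|[set i | m i \in F]| = #|B :&: F|.
Proof.
case=> mI _ ->; rewrite -(card_imset _ mI); apply: eq_card => j; rewrite inE.
apply/imsetP/andP => [[i]|[/imsetP[i _ ->] iF]]; last by exists i; rewrite ?inE.
by rewrite inE => iF ->; rewrite imset_f.
Qed.

Lemma match_mono P P' m B : (forall i, P i \subset P' i) ->
  is_match P m B -> is_match P' m B.
Proof. by move=> s [mI mP ->]; split=> // i; apply: (subsetP (s i)). Qed.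

Variables (d : nat) (M : {set {set E}}).
Hypothesis hM : mat d M.

Lemma presents_match P m : presents M P -> injective m ->
  (forall i, m i \in P i) -> [set m i | i : I] \in M.
Proof. by move=> hP mI mP; apply/hP; exists m. Qed.

(* Rerouting a row that meets F but is matched outside F would yield two bases
   containing too many elements of F in total. *)
Lemma presents_meet P F m B : presents M P -> cyclic M F ->
  B \in M -> #|B :&: F| = rk M F -> is_match P m B ->
  forall i, (P i :&: F != set0) = (m i \in F).
Proof.
move=> hP /cyclicP cF BM e mB i; have [mI mP _] := mB.
apply/set0Pn/idP => [[c]|miF]; last by exists (m i); rewrite inE mP.
rewrite inE => /andP[cP cFc]; apply: contraT => miF.
(* As [F] is cyclic, some basis avoids [c] and still has full rank on [F]; this permits rerouting
   row [i] to [c]. *)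
have [B' B'M e'] := rk_attained hM (F :\ c); rewrite cF // in e'.
have [B'F cB'] : #|B' :&: F| = rk M F /\ c \notin B'.
  have s : B' :&: (F :\ c) \subset B' :&: F by rewrite setIS ?subD1set.
  have q : #|B' :&: (F :\ c)| = #|B' :&: F|.
    by apply/eqP; rewrite eqn_leq subset_leq_card //= e' rk_ge.
  split; first by rewrite -q.
  have /(subset_cardP q) h := s; apply/negP => cB'; have := h c.
  by rewrite !inE cB' cFc eqxx.
have [q qB'] : exists m', is_match P m' B' by apply/hP.
have [qI qP qE] := qB'.
have [k|m1 [m2 [m1I m2I mm]]] := @reroute _ _ m q i c mI qI.
  by apply: contraNneq cB' => <-; rewrite qE imset_f.
have P1 k : (if k == i then c else m k) \in P k by case: eqP => [->|].
have m1P k : m1 k \in P k by case: (mm k) => -[-> _].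
have m2P k : m2 k \in P k by case: (mm k) => -[_ ->].
have c1 := rk_ge F (presents_match hP m1I m1P).
have c2 := rk_ge F (presents_match hP m2I m2P).
have M1 : is_match P m1 [set m1 i | i : I] by [].
have M2 : is_match P m2 [set m2 i | i : I] by [].
rewrite -(card_matchI F M1) -sum1dep_card big_mkcond /= in c1.
rewrite -(card_matchI F M2) -sum1dep_card big_mkcond /= in c2.
rewrite -(card_matchI F mB) -sum1dep_card big_mkcond /= in e.
rewrite -(card_matchI F qB') -sum1dep_card big_mkcond /= in B'F.
suff : \sum_k (if m1 k \in F then 1 else 0) + \sum_k (if m2 k \in F then 1 else 0) =
   (\sum_k (if m k \in F then 1 else 0) + \sum_k (if q k \in F then 1 else 0)).+1.
  by rewrite e B'F; lia.
rewrite -!big_split /= (bigD1 i) // [in RHS](bigD1 i) //=.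
rewrite (negbTE miF) add0n -addSn; congr (_ + _).
  by case: (mm i) => -[-> ->]; rewrite eqxx cFc ?addn1.
apply: eq_bigr => k /negbTE ki.
by case: (mm k) => -[-> ->]; rewrite ki // addnC.
Qed.

Lemma presents_card P F : presents M P -> cyclic M F ->
  #|[set i | P i :&: F != set0]| = rk M F.
Proof.
move=> hP cF; have [B BM e] := rk_attained hM F.
have [m mB] : exists m, is_match P m B by apply/hP.
rewrite -e -(card_matchI F mB); apply: eq_card => i.
by rewrite !inE (presents_meet hP cF BM e mB).
Qed.

(** If [B] were dependent, its cyclic part would exceed its own rank, although its elements are
    matched to distinct rows meeting it. *)
Lemma match_basis P m B :
  (forall F, cyclic M F -> #|[set i | P i :&: F != set0]| <= rk M F) ->
  #|I| = d -> is_match P m B -> B \in M.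
Proof.
move=> h Id mB; have [mI mP BE] := mB.
have cB : #|B| = d by rewrite BE card_imset.
pose F := cyc M B; have FB : F \subset B := cyc_sub M B.
have cF : cyclic M F := cyc_cyclic hM B.
have e2 := rk_cyc hM B; rewrite -/F in e2; clearbody F.
have : #|F| <= rk M F.
  apply: leq_trans (h _ cF); rewrite -{1}(setIidPr FB) -(card_matchI F mB).
  apply/subset_leq_card/subsetP => i; rewrite !inE => iF.
  by apply/set0Pn; exists (m i); rewrite inE mP.
have := cardsID F B; rewrite (setIidPr FB) cB => e1 e3.
have {}e3 : d <= rk M B by clear -e1 e2 e3; lia.
have [B' B'M e] := rk_attained hM B.
suff -> : B = B' by [].
have B'd := mat_card hM B'M.
have s : B' \subset B.
  have := subset_leqif_cards (subsetIl B' B) => -[_].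
  rewrite e B'd eqn_leq -{1}B'd -e subset_leq_card ?subsetIl // e e3.
  by move/esym/eqP => <-; rewrite subsetIr.
by apply/esym/eqP; rewrite eqEcard s cB B'd leqnn.
Qed.

(** A cyclic set lies in [F i] exactly if it misses [P i], so enlarging the rows changes none of the
    counts that bound matchings. *)
Lemma closed_rows P : #|I| = d -> presents M P ->
  let F i := cyc M (~: P i) in
  [/\ forall i, cyclic M (F i),
      forall G, cyclic M G -> #|[set i | ~~ (G \subset F i)]| = rk M G &
      presents M (fun i => ~: F i)].
Proof.
move=> Id hP F; have cF i : cyclic M (F i) := cyc_cyclic hM _.
have GF G i : cyclic M G -> (G \subset F i) = (P i :&: G == set0).
  move=> cG; rewrite setI_eq0 disjoint_sym disjoints_subset.
  apply/idP/idP => s; last exact: (cyc_max hM).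
  exact: subset_trans s (cyc_sub _ _).
have cnt G : cyclic M G -> #|[set i | ~~ (G \subset F i)]| = rk M G.
  move=> cG; rewrite -(presents_card hP cG); apply: eq_card => i.
  by rewrite !inE GF.
split=> // B; split=> [/hP[m mB]|[m mB]].
  exists m; apply: match_mono mB => i; rewrite subsetC; exact: cyc_sub.
apply: match_basis mB => // G cG; rewrite -cnt //.
apply/subset_leq_card/subsetP => i; rewrite !inE; apply: contra => s.
by rewrite setI_eq0 disjoint_sym disjoints_subset setCK.
Qed.

End Presentation.

(** * Uniqueness of the multiset of closed rows *)

Section Good.
Variables (E : finType) (d : nat) (M : {set {set E}}).
Hypothesis hM : mat d M.
Implicit Types (F G H : {set E}) (s : seq {set E}).

Definition good s := all (cyclic M) s /\
  forall G, cyclic M G -> count (fun F => ~~ (G \subset F)) s = rk M G.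

Lemma count_sum (T : finType) (a : pred T) (s : seq T) :
  count a s = \sum_(x | a x) count_mem x s.
Proof.
elim: s => [|y s IH] /=; first by rewrite big1.
rewrite IH big_split /=; congr (_ + _).
case ay: (a y); last by rewrite big1 // => x ax; case: eqP ay ax => // ->->.
rewrite (bigD1 y) //= eqxx big1 // => x /andP[_ /negbTE xy].
by rewrite eq_sym xy.
Qed.

(** Moebius inversion: the number of members containing [F] is fixed by the rank, and multiplicities
    follow from larger sets to smaller ones. *)
Lemma good_uniq s1 s2 : size s1 = size s2 -> good s1 -> good s2 -> perm_eq s1 s2.
Proof.
move=> sz [a1 c1] [a2 c2].
suff h m F : #|~: F| < m -> count_mem F s1 = count_mem F s2.
  by apply/allP => F _; apply/eqP; apply: (h #|~: F|.+1).
elim: m F => // m IH F lt.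
have z s : all (cyclic M) s -> ~~ cyclic M F -> count_mem F s = 0.
  move=> as_ nF; apply/count_memPn; apply: contra nF => Fs.
  exact: (allP as_).
have [cF|nF] := boolP (cyclic M F); last by rewrite !z.
have sp s : count (fun F' => F \subset F') s = count_mem F s +
     \sum_(F' : {set E} | F \proper F') count_mem F' s.
  rewrite -count_sum; elim: s => //= x s ->.
  rewrite properEneq (eq_sym F x); move: (count _ s) (count _ s) => k l.
  have [->|_] := eqVneq x F; first by rewrite subxx /= !add0n addnA.
  by rewrite /= add0n addnCA.
have pc s : count (fun F' => F \subset F') s +
  count (fun F' => ~~ (F \subset F')) s = size s by apply: count_predC.
have e1 := pc s1; have e2 := pc s2; rewrite c1 // in e1; rewrite c2 // in e2.
have := sp s1; have := sp s2.
have -> : \sum_(F' : {set E} | F \proper F') count_mem F' s1 =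
    \sum_(F' : {set E} | F \proper F') count_mem F' s2.
  apply: eq_bigr => F' pF; apply: IH; rewrite -ltnS; apply: leq_trans lt; rewrite ltnS.
  have := proper_card pF; have := cardsC F; have := cardsC F'.
  by move: #|F| #|F'| #|~: F| #|~: F'| => *; lia.
move=> q2 q1; apply: (@addIn (\sum_(F' : {set E} | F \proper F') count_mem F' s2)).
rewrite -q1 -q2; apply: (@addIn (rk M F)).
by rewrite e1 e2 sz.
Qed.

(** [rk_face] holds member by member: for each [F], the indicators of non-containment satisfy the
    same additive identity. *)
Lemma good_face s G : coloopfree M -> cyclic M G -> good s ->
  all (cyclic (face M G)) (map (to_face M G) s) /\
  (forall H, cyclic (face M G) H ->
    count (fun F => ~~ (H \subset F)) (map (to_face M G) s) = rk (face M G) H).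
Proof.
move=> hN cG [as_ cs]; split.
  rewrite all_map; apply/allP => F /(allP as_) cF /=.
  exact: (cyclic_to_face hM).
move=> H cH; have := rk_face hM G H.
move: (cH); rewrite (cyclic_face hM) // => /andP[c1 c2].
rewrite -!cs //; set x := rk _ _; rewrite count_map => e.
apply: (@addIn (count (fun F => ~~ (G \subset F)) s)); rewrite e {e x}.
elim: s as_ {cs} => //= F s IH /andP[cF /IH].
rewrite (sub_to_face hM cH) //=; case: ifP => s1 /=.
  have -> : H :&: G \subset F by apply: subset_trans (subsetIr _ _) s1.
  by case: (H :|: G \subset F) => /=; lia.
have -> : H :|: G \subset F = false by rewrite subUset s1 andbF.
by case: (H :&: G \subset F) => /=; lia.
Qed.
End Good.

Local Open Scope ring_scope.

(** * Induction on a real interval *)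

Section Small.
Variable R : realType.
Implicit Types (P Q : R -> Prop).

Definition small P := exists2 e, 0 < e & forall t, 0 < t -> t < e -> P t.

Lemma small_all P : (forall t, 0 < t -> P t) -> small P.
Proof. by move=> h; exists 1 => // t t0 _; apply: h. Qed.

Lemma small_imp P Q : (forall t, 0 < t -> P t -> Q t) -> small P -> small Q.
Proof.
by move=> PQ [e e0 h]; exists e => // t t0 te; apply: PQ => //; apply: h.
Qed.

Lemma small_and P Q : small P -> small Q -> small (fun t => P t /\ Q t).
Proof.
move=> [e e0 h] [f f0 k]; exists (Num.min e f); first by rewrite lt_min e0.
by move=> t t0; rewrite lt_min => /andP[te tf]; split; [apply: h | apply: k].
Qed.

Lemma small_forall (T : finType) (P : T -> R -> Prop) :
  (forall i, small (P i)) -> small (fun t => forall i, P i t).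
Proof.
move=> h; suff [e e0 he] : small (fun t => forall i, i \in enum T -> P i t).
  by exists e => // t t0 te i; apply: he => //; rewrite mem_enum.
elim: (enum T) => [|i s IH]; first by apply: small_all => t _ i; rewrite in_nil.
apply: small_imp (small_and (h i) IH) => t _ [hi hs] k.
by rewrite inE => /orP[/eqP->|] //; apply: hs.
Qed.

Lemma small_ex P : small P -> exists2 t, 0 < t & P t.
Proof. by case=> e e0 h; exists (e / 2); [lra | apply: h; lra]. Qed.

Lemma small_lt (a c b : R) : a < b -> small (fun t => a + t * c < b).
Proof.
move=> ab; have c0 : 0 < `|c| + 1 by have := normr_ge0 c; lra.
exists ((b - a) / (`|c| + 1)); first by rewrite divr_gt0 //; lra.
move=> t t0; rewrite ltr_pdivlMr // => lt.
have := ler_norm (t * c); rewrite normrM (gtr0_norm t0); nra.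
Qed.

Lemma small_lt0 (b : R) : 0 < b -> small (fun t => t < b).
Proof. by move=> b0; exists b. Qed.

(** The supremum of the segments on which [P] holds is reached by the limit hypothesis and, unless
    it is [b], passed by the other one. *)
Lemma real_induction P (a b : R) : a <= b -> P a ->
  (forall t, a <= t -> t < b -> P t -> small (fun e => P (t + e))) ->
  (forall t, a < t -> t <= b -> small (fun e => P (t - e)) -> P t) ->
  P b.
Proof.
move=> ab Pa right left.
pose S := fun t => a <= t <= b /\ forall s, a <= s <= t -> P s.
have Sa : S a.
  split; first by rewrite lexx.
  by move=> s /andP[s1 s2]; have -> : s = a by apply/eqP; rewrite eq_le s1 s2.
have hS : classical_sets.has_sup S.
  by split; [exists a | exists b => t [] /andP[]].
set c := sup S.
have ac : a <= c by apply: ub_le_sup => //; case: hS.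
have cb : c <= b by apply: ge_sup; [exists a | move=> t [] /andP[]].
have below s : a <= s -> s < c -> P s.
  move=> as_ sc; have e0 : 0 < c - s by rewrite subr_gt0.
  have [t St] := sup_adherent e0 hS; rewrite -/c subKr => st.
  by case: St => _; apply; rewrite as_ ltW.
have Pc : P c.
  have [<- //|nac] := eqVneq a c.
  have lac : a < c by rewrite lt_neqAle nac.
  apply: left => //; exists (c - a); first by rewrite subr_gt0.
  by move=> t t0 tc; apply: below; lra.
have [-> //|ncb] := eqVneq b c.
have lcb : c < b by rewrite lt_neqAle eq_sym ncb.
have [e e0 he] := right c ac lcb Pc.
pose t := Num.min (e / 2) (b - c).
have t0 : 0 < t by rewrite lt_min subr_gt0 lcb andbT; lra.
have te : t < e by rewrite gt_min; apply/orP; left; lra.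
have tb : c + t <= b by rewrite -lerBrDl ge_min lexx orbT.
have : c + t <= c.
  apply: ub_le_sup; first by case: hS.
  split; first by apply/andP; split; lra.
  move=> s /andP[as_ st]; have [sc|cs|->//] := ltgtP s c.
    exact: below.
  by rewrite -[s](subrKC c); apply: he; lra.
by lra.
Qed.
End Small.

(** * Valuated matroids and their cells *)

(** The bases are listed in [BB], so that no value is infinite. The exchange inequality comes from
    the tropical Pluecker relation for [B1] minus [i] and [B2] plus [i]. *)
Record vmat (R : realType) (E : finType) (d : nat) (BB : {set {set E}})
    (v : {set E} -> R) : Prop := Vmat {
  vmat_card : forall B, B \in BB -> #|B| = d;
  vmat_ex : exists B, B \in BB;
  vmat_exch : forall B1 B2 i, B1 \in BB -> B2 \in BB -> i \in B1 :\: B2 ->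
    exists j, [/\ j \in B2 :\: B1, j |: B1 :\ i \in BB, i |: B2 :\ j \in BB &
      v (j |: B1 :\ i) + v (i |: B2 :\ j) <= v B1 + v B2]
}.

Section Valuated.
Variables (R : realType) (E : finType).
Implicit Types (x y z : E -> R) (B C G H F T : {set E}) (e s t : R).

Definition up x e G : E -> R := fun j => x j + (if j \in G then e else 0).

Lemma sum_swap x B i j : i \in B -> j \notin B ->
  \sum_(k in j |: B :\ i) x k = \sum_(k in B) x k - x i + x j.
Proof.
move=> iB jB; rewrite big_setU1 /=; last by rewrite !inE (negbTE jB) andbF.
by rewrite (big_setD1 i iB) /=; lra.
Qed.

Variables (d : nat) (BB : {set {set E}}) (v : {set E} -> R).

Definition red x B := v B - \sum_(j in B) x j.

Definition ini x := [set B in BB | [forall C in BB, red x B <= red x C]].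

Definition Omega x := coloopfree (ini x).

Lemma sum_up x e G B :
  \sum_(j in B) up x e G j = \sum_(j in B) x j + e * #|B :&: G|%:R.
Proof.
rewrite big_split /=; congr (_ + _); rewrite -big_mkcondr /=.
rewrite (eq_bigl (mem (B :&: G))) => [|j]; last by rewrite !inE.
by rewrite sumr_const mulr_natr.
Qed.

Lemma red_up x e G B : red (up x e G) B = red x B - e * #|B :&: G|%:R.
Proof. by rewrite /red sum_up; lra. Qed.

Hypothesis hV : vmat d BB v.

Lemma iniP x B :
  reflect (B \in BB /\ forall C, C \in BB -> red x B <= red x C) (B \in ini x).
Proof.
rewrite inE; apply: (iffP andP) => -[BB_ h]; split=> //.
  by move=> C CB; have /forallP/(_ C) := h; rewrite CB.
by apply/forallP => C; apply/implyP; apply: h.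
Qed.

Lemma ini_le x B C : B \in ini x -> C \in BB -> red x B <= red x C.
Proof. by case/iniP => _; apply. Qed.

Lemma ini_sub x B : B \in ini x -> B \in BB.
Proof. by case/iniP. Qed.

Lemma ini_red x B C : B \in ini x -> C \in ini x -> red x B = red x C.
Proof.
by move=> b c; apply/eqP; rewrite eq_le !ini_le // (ini_sub b, ini_sub c).
Qed.

Lemma ini_of_red x B C : B \in ini x -> C \in BB -> red x C <= red x B -> C \in ini x.
Proof.
move=> b cB le; apply/iniP; split=> // D DB.
exact: le_trans le (ini_le b DB).
Qed.

Lemma mat_ini x : mat d (ini x).
Proof.
split=> [B /ini_sub/(vmat_card hV)//||B1 B2 i b1 b2 iB].
  have [B0 B0B] := vmat_ex hV.
  case: (@arg_minP _ _ _ B0 (mem BB) (red x) B0B) => B BB_ h.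
  by exists B; apply/iniP.
have [j [jB m1 m2 le]] := vmat_exch hV (ini_sub b1) (ini_sub b2) iB.
move: (iB) (jB); rewrite !inE => /andP[iB2 iB1] /andP[jB1 jB2].
have s1 := sum_swap x iB1 jB1; have s2 := sum_swap x jB2 iB2.
have q1 := ini_le b1 m1; have q2 := ini_le b2 m2.
exists j; split=> //; [apply: ini_of_red b1 m1 _|apply: ini_of_red b2 m2 _];
  by move: q1 q2; rewrite /red s1 s2; lra.
Qed.

(** Bases outside the cell are behind by a positive gap and stay behind for small e; inside, only
    the size of the intersection with [G] counts. *)
Lemma ini_up x G : small (fun e => ini (up x e G) = face (ini x) G).
Proof.
have [B0 b0] := mat_ex (mat_ini x).
have : small (fun e => forall C, C \in BB -> C \notin ini x ->
    red (up x e G) B0 < red (up x e G) C).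
  apply: small_forall => C; case: (boolP (C \in BB)) => [CB|]; last first.
    by move=> _; apply: small_all.
  case: (boolP (C \in ini x)) => [_|nC]; first by apply: small_all.
  have lt : red x B0 < red x C.
    by rewrite ltNge; apply: contra nC; apply: ini_of_red.
  apply: small_imp (small_lt (#|C :&: G|%:R - #|B0 :&: G|%:R) lt) => t _ h _ _.
  by rewrite !red_up; lra.
apply: small_imp => e e0 h; apply/setP => B; rewrite [RHS]inE.
apply/idP/andP => [b|[b /eqP f]].
  have bx : B \in ini x.
    apply: contraT => nb; have := h B (ini_sub b) nb.
    by rewrite ltNge (ini_le b) // (ini_sub b0).
  split=> //; rewrite eqn_leq rk_ge //=.
  have [B' b' <-] := rk_attained (mat_ini x) G.
  have := ini_le b (ini_sub b'); rewrite !red_up (ini_red b' bx).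
  by rewrite lerD2l lerN2 ler_pM2l // ler_nat.
apply/iniP; split; first exact: ini_sub b.
have le C : C \in ini x -> red (up x e G) B <= red (up x e G) C.
  move=> c; rewrite !red_up (ini_red b c) lerD2l lerN2 ler_pM2l // ler_nat f.
  exact: rk_ge.
move=> C CB; have [c|nc] := boolP (C \in ini x); first exact: le.
by apply: le_trans (le _ b0) _; apply: ltW; apply: h.
Qed.

Lemma ini_shift x s : ini (fun j => x j + s) = ini x.
Proof.
have q B : B \in BB -> red (fun j => x j + s) B = red x B - s *+ d.
  move=> BB_; rewrite /red big_split /= sumr_const (vmat_card hV BB_); lra.
apply/setP => B; apply/iniP/iniP => -[b h]; split=> // C c; have := h C c;
  by rewrite !q // lerD2r.
Qed.

(** All bases have size [d], so a common shift is invisible and lowering on [G] amounts to raising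
    on its complement. *)
Lemma upC x e G j : up x (- e) G j = up x e (~: G) j - e.
Proof. by rewrite /up inE; case: (j \in G) => /=; lra. Qed.

Lemma ini_upN x e G : ini (up x (- e) G) = ini (up x e (~: G)).
Proof. by rewrite -[RHS](ini_shift _ (- e)); congr ini; apply: boolp.funext => j; apply: upC. Qed.

Lemma ini_dn x G : small (fun e => ini (up x (- e) G) = face (ini x) (~: G)).
Proof. by apply: small_imp (ini_up x (~: G)) => e _; rewrite ini_upN. Qed.

(** If [z] agrees with [w] at [j], exchange [j] out of a basis of [z] against a basis of [w]
    avoiding [j]: since [w] is below [z] elsewhere, the reduced value at [z] does not grow. *)
Lemma Omega_max x y : Omega x -> Omega y -> Omega (fun j => Num.max (x j) (y j)).
Proof.
move=> ox oy; set z := fun j => _.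
suff key w j : Omega w -> (forall k, w k <= z k) -> z j = w j ->
    exists2 B, B \in ini z & j \notin B.
  move=> j; have [le|lt] := leP (x j) (y j).
    by apply: (key y) => // [k|]; rewrite /z ?le_max ?lexx ?orbT // max_r.
  by apply: (key x) => // [k|]; rewrite /z ?le_max ?lexx // max_l // ltW.
move=> ow wz zj; have [B b] := mat_ex (mat_ini z).
have [jB|jB] := boolP (j \in B); last by exists B.
have [B1 b1 jB1] := ow j.
have jBB : j \in B :\: B1 by rewrite inE jB1.
have [k [kB m1 m2 le]] := vmat_exch hV (ini_sub b) (ini_sub b1) jBB.
move: kB; rewrite inE => /andP[kB kB1].
have jk : j != k by apply: contraNneq kB => <-.
exists (k |: B :\ j); last by rewrite !inE eqxx orbF.
apply: ini_of_red b m1 _; have := ini_le b1 m2.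
rewrite /red !sum_swap //; have := wz k; rewrite zj; lra.
Qed.

Lemma Omega_up_cyclic x G : small (fun e => Omega (up x e G)) -> cyclic (ini x) G.
Proof.
move=> /(fun h => small_and h (ini_up x G))/small_ex[e _ [oe ie]].
by apply: (face_coloopfree_cyclic (mat_ini x)); rewrite -ie.
Qed.

Lemma cyclic_up_Omega x G : Omega x -> cyclic (ini x) G ->
  small (fun e => Omega (up x e G)).
Proof.
move=> ox cG; apply: small_imp (ini_up x G) => e _ ie; rewrite /Omega ie.
exact: (coloopfree_face (mat_ini x)).
Qed.

Lemma Omega_closed x G : small (fun e => Omega (up x (- e) G)) -> Omega x.
Proof.
move=> /(fun h => small_and h (ini_dn x G))/small_ex[e _ [oe ie]] j.
have [B + jB] := oe j; rewrite ie => /setIdP[b _].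
by exists B.
Qed.

Definition argmax x := [set j | [forall k, x k <= x j]].

Lemma argmaxP x j : reflect (forall k, x k <= x j) (j \in argmax x).
Proof. by rewrite inE; apply: forallP. Qed.

Lemma argmax_ex x : E -> exists j, j \in argmax x.
Proof.
move=> j0; case: (@arg_maxP _ _ _ j0 predT x isT) => j _ h.
by exists j; apply/argmaxP => k; apply: h.
Qed.

(** For small e, raising [x] by e on the argmax is the maximum of [x] and a translate of [z], hence
    stays in Omega. *)
Lemma argmax_cyclic x z : Omega x -> Omega z ->
  cyclic (ini x) (argmax (fun j => z j - x j)).
Proof.
move=> ox oz; set G := argmax _.
have [G0|[j jG]] := set_0Vmem G.
  by rewrite G0; apply/cyclicP => j; rewrite inE.
have [s sG sN] : exists2 s, forall k, k \in G -> z k - x k = s &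
    forall k, k \notin G -> z k - x k < s.
  exists (z j - x j) => k kG.
    by apply/eqP; rewrite eq_le (argmaxP _ _ jG) (argmaxP _ _ kG).
  rewrite lt_neqAle (argmaxP _ _ jG) andbT.
  apply: contra kG => /eqP e; apply/argmaxP => l; rewrite e.
  exact: (argmaxP _ _ jG).
apply: Omega_up_cyclic.
have : small (fun e => forall k, k \notin G -> z k - x k < s - e).
  apply: small_forall => k; have [kG|kG] := boolP (k \in G).
    exact: small_all.
  by apply: small_imp (small_lt 1 (sN k kG)) => t _ h _; lra.
apply: small_imp => e e0 h.
have -> : up x e G = fun k => Num.max (x k) (z k + (e - s)).
  apply: boolp.funext => k; rewrite /up; case: ifP => kG.
    by have := sG k kG => q; rewrite max_r; lra.
  by have := h k (negbT kG) => q; rewrite max_l; lra.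
apply: Omega_max => //; by rewrite /Omega ini_shift.
Qed.

End Valuated.

(** * Tropical segments *)

Section Paths.
Variables (R : realType) (E : finType).
Implicit Types (x y z : E -> R) (B C G H F T : {set E}) (e s t : R).

(** As s grows this runs from a translate of [z] to [x], lowering the coordinates where [z - s] is
    still above [x]. *)
Definition tseg x z s : E -> R := fun j => Num.max (x j) (z j - s).

Lemma tseg_add x z s : small (fun e =>
  tseg x z (s + e) = up (tseg x z s) (- e) [set j | s < z j - x j]).
Proof.
have : small (fun e => forall j, s < z j - x j -> e < z j - x j - s).
  apply: small_forall => j; case: (ltP s (z j - x j)) => h.
    by have h' : 0 < z j - x j - s; [lra | apply: small_imp (small_lt0 h') => e _ ? _].
  exact: small_all.
apply: small_imp => e e0 h; apply: boolp.funext => j.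
rewrite /up /tseg inE; case: (ltP s (z j - x j)) => q.
  by have := h j q => q'; rewrite !max_r; lra.
by rewrite !max_l; lra.
Qed.

Lemma tseg_sub x z s : small (fun e =>
  tseg x z (s - e) = up (tseg x z s) e [set j | s <= z j - x j]).
Proof.
have : small (fun e => forall j, z j - x j < s -> e < s - (z j - x j)).
  apply: small_forall => j; case: (ltP (z j - x j) s) => h.
    by have h' : 0 < s - (z j - x j); [lra | apply: small_imp (small_lt0 h') => e _ ? _].
  exact: small_all.
apply: small_imp => e e0 h; apply: boolp.funext => j.
rewrite /up /tseg inE; case: (leP s (z j - x j)) => q.
  by rewrite !max_r; lra.
by have := h j q => q'; rewrite !max_l; lra.
Qed.

Lemma up_add x s e G : up (up x s G) e G = up x (s + e) G.
Proof. by apply: boolp.funext => j; rewrite /up; case: (j \in G); lra. Qed.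

Lemma up0 x G : up x 0 G = x.
Proof. by apply: boolp.funext => j; rewrite /up; case: (j \in G); lra. Qed.

Definition shift_inv (Q : (E -> R) -> Prop) :=
  forall x s, Q x -> Q (fun j => x j + s).

Lemma shift_upN Q x e G : shift_inv Q -> Q (up x (- e) G) <-> Q (up x e (~: G)).
Proof.
move=> Qs; split=> [/Qs-/(_ e)|/Qs-/(_ (- e))]; congr Q;
  by apply: boolp.funext => j; rewrite upC; lra.
Qed.

(** Lowering some coordinates is raising the others up to a shift, so both steps are moves in
    directions 1_K; at s1 the segment has reached [x]. *)
Lemma tseg_induction Q x z s0 s1 : shift_inv Q -> s0 <= s1 ->
  (forall j, z j - x j <= s1) -> Q (tseg x z s0) ->
  (forall s, s0 <= s -> s < s1 -> Q (tseg x z s) ->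
     small (fun e => Q (up (tseg x z s) e [set j | z j - x j <= s]))) ->
  (forall s, s0 < s -> s <= s1 ->
     small (fun e => Q (up (tseg x z s) e [set j | s <= z j - x j])) ->
     Q (tseg x z s)) ->
  Q x.
Proof.
move=> Qs s01 hs1 q0 right left.
have -> : x = tseg x z s1.
  by apply: boolp.funext => j; rewrite /tseg max_l //; have := hs1 j; lra.
apply: (real_induction (P := fun s => Q (tseg x z s)) s01 q0) => [s le lt q|s lt le q].
  apply: small_imp (small_and (tseg_add x z s) (right s le lt q)) => e _ [-> {}q].
  apply/(shift_upN _ _ _ Qs); congr Q: q; congr up.
  by apply/setP => j; rewrite !inE leNgt.
apply: left => //; apply: small_imp (small_and (tseg_sub x z s) q) => e _ [<-].
by [].
Qed.
End Paths.

(** * Rays along which a cyclic set persists *)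

Lemma lex_arith (n p q u w : nat) : (q <= p -> p * n.+1 + u <= q * n.+1 + w ->
  w <= n -> p = q /\ u <= w)%N.
Proof.
move=> qp le wn; have [lt|lt|e] := ltngtP p q; [by lia | | by subst p; lia].
have : (q.+1 * n.+1 <= p * n.+1)%N by rewrite leq_mul2r lt orbT.
by rewrite mulSn; move: (q * n.+1)%N (p * n.+1)%N le => a b; lia.
Qed.

Section Flow.
Variables (R : realType) (E : finType) (d : nat) (BB : {set {set E}})
  (v : {set E} -> R).
Hypothesis hV : vmat d BB v.
Implicit Types (x y z : E -> R) (B C G H F T : {set E}) (e s t : R).
Local Notation ini := (ini BB v).
Local Notation Omega := (Omega BB v).

Lemma Omega_tseg x z s : Omega x -> Omega z -> Omega (tseg x z s).
Proof. by move=> ox oz; apply: (Omega_max hV) => //; rewrite /Omega (ini_shift hV). Qed.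

(** Instantiated by residual members and by minimal violations. [Gr] lets [F] survive in its own
    direction; [Gl] lifts an [F] valid just before a limit to a set valid at it. *)
Variable Good : (E -> R) -> {set E} -> Prop.
Hypothesis G0 : forall x F, Good x F ->
  [/\ Omega x, cyclic (ini x) F & F != setT].
Hypothesis Gs : forall F, shift_inv (Good^~ F).
Hypothesis Gr : forall x F, Good x F -> small (fun e => Good (up x e F) F).
Hypothesis Gl : forall x F, Omega x -> cyclic (ini x) (~: F) ->
  small (fun e => Good (up x e (~: F)) F) ->
  exists2 F1, Good x F1 & to_face (ini x) (~: F) F1 = F.

(* Start from a pair of least nullity and, among these, with the largest F; by
   to_face_nullity a change of the cell along the ray would yield a smaller one. *)
Lemma flow_ray : (exists x F, Good x F) ->
  exists x F, forall t, 0 <= t -> Good (up x t F) F.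
Proof.
(* Lexicographic order as one number: nullity first, then the size of the complement, which is less
   than the factor. *)
pose mu x F := ((#|F| - rk (ini x) F) * #|E|.+1 + (#|E| - #|F|))%N.
move=> ex.
have exn : exists n, boolp.asbool (exists x F, Good x F /\ mu x F = n).
  by case: ex => x [F g]; exists (mu x F); apply/boolp.asboolP; exists x, F.
case: (ex_minnP exn) => n /boolp.asboolP[x [F [g en]]] minn.
have {}minn y F1 : Good y F1 -> (mu x F <= mu y F1)%N.
  by move=> g1; rewrite en; apply: minn; apply/boolp.asboolP; exists y, F1.
exists x, F => t t0; have [ox cF FT] := G0 g.
have FE : (#|F| <= #|E|)%N by apply: max_card.
(* The rank is carried along so that the nullity of [F] near the limit is that at [x]. *)
pose P s := Good (up x s F) F /\ rk (ini (up x s F)) F = rk (ini x) F.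
suff : P t by case.
have K0 : ~: F != set0.
  by apply: contraNneq FT => h; rewrite -(setCK F) h setC0.
apply: (real_induction (P := P) t0); first by rewrite /P up0.
  move=> s s0 st [gs rs]; apply: small_imp (small_and (Gr gs) (ini_up hV (up x s F) F)).
  move=> e e0; rewrite up_add => -[ge ie]; split=> //; rewrite ie -rs.
  have := rk_face (mat_ini hV (up x s F)) F F.
  by rewrite setIid setUid => /addIn.
move=> s s0 st q; set y := up x s F.
have {}q : small (fun e => Good (up y e (~: F)) F /\
    rk (ini (up y e (~: F))) F = rk (ini x) F).
  apply: small_imp q => e e0; rewrite /P -up_add -/y => -[ge re].
  split; first exact/(shift_upN _ _ _ (Gs (F := F))).
  by rewrite -(ini_upN hV).
have qg : small (fun e => Good (up y e (~: F)) F) by apply: small_imp q => ? _ [].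
have qo : small (fun e => Omega (up y e (~: F))).
  by apply: small_imp qg => e _ /G0[].
have cK : cyclic (ini y) (~: F) := Omega_up_cyclic hV qo.
have oy : Omega y.
  apply: (@Omega_closed _ _ _ _ _ hV y F); apply: small_imp qo => e _.
  by rewrite /Omega (ini_upN hV).
have [F1 g1 F1F] := Gl oy cK qg.
have F1E : (#|F1| <= #|E|)%N by apply: max_card.
have My := mat_ini hV y.
have K1 : to_face (ini y) (~: F) F1 = ~: ~: F by rewrite setCK.
have [le imp] := to_face_nullity My cK K0 K1 oy.
rewrite setCK in le imp.
have [e _ [[_ re] ie]] := small_ex (small_and q (ini_up hV y (~: F))).
have rF := rk_face My (~: F) F.
rewrite -ie re setICr (rk_set0 (ini y)) setUCr (rkT My) add0n in rF.
have m1 := minn _ _ g1; rewrite /mu in m1.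
have r1 := rk_card (ini y) F1; have r2 := rk_card (ini x) F.
(* [to_face_nullity] bounds the nullity of [F1] by that of [F]; minimality then forces equality in
   both components of [mu]. *)
have nu_le : (#|F1| - rk (ini y) F1 <= #|F| - rk (ini x) F)%N.
  by clear -le rF r1 r2; lia.
have [nuE cE] := lex_arith nu_le m1 (leq_subr _ _).
have {}imp : F \subset F1 by apply: imp; clear -nuE rF r1 r2; lia.
have F1_F : F1 = F.
  by apply/esym/eqP; rewrite eqEcard imp; clear -cE F1E FE; lia.
rewrite F1_F in g1 nuE r1; split; rewrite -/y //.
by clear -nuE r1 r2; lia.
Qed.
End Flow.

(** * Tropical rows *)

Section Rows.
Variables (R : realType) (E : finType).
Implicit Types (x y z : E -> R) (B C G H F T : {set E}) (e s t : R).

(* The support and the entries of a tropical row; off the support the entries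
   stand for +oo. *)
Definition trow := ({set E} * (E -> R))%type.
Implicit Types (a : trow) (l : seq trow).

Definition tight a x :=
  [set j in a.1 | [forall k in a.1, a.2 j - x j <= a.2 k - x k]].

Lemma tightP a x j :
  reflect (j \in a.1 /\ forall k, k \in a.1 -> a.2 j - x j <= a.2 k - x k)
    (j \in tight a x).
Proof.
rewrite inE; apply: (iffP andP) => -[ja h]; split=> //.
  by move=> k ka; have /forallP/(_ k) := h; rewrite ka.
by apply/forallP => k; apply/implyP; apply: h.
Qed.

Lemma tight_ex a x : a.1 != set0 -> exists j, j \in tight a x.
Proof.
case/set0Pn => j0 ja; case: (@arg_minP _ _ _ j0 (mem a.1) (fun j => a.2 j - x j) ja).
by move=> j jB h; exists j; apply/tightP.
Qed.

Lemma tight_shift a x s : tight a (fun j => x j + s) = tight a x.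
Proof.
apply/setP => j; apply/tightP/tightP => -[ja h]; split=> // k ka;
  by have := h k ka; lra.
Qed.

Lemma tight_up a x G : small (fun e => tight a (up x e G) = restr (tight a x) G).
Proof.
have : small (fun e => forall j k, j \in tight a x -> k \in a.1 ->
    k \notin tight a x -> e < (a.2 k - x k) - (a.2 j - x j)).
  apply: small_forall => j; apply: small_forall => k.
  have [jT|jT] := boolP (j \in tight a x); last exact: small_all.
  have [ka|ka] := boolP (k \in a.1); last exact: small_all.
  have [kT|kT] := boolP (k \in tight a x); first exact: small_all.
  have h : 0 < (a.2 k - x k) - (a.2 j - x j).
    rewrite subr_gt0 ltNge; apply: contra kT => le; apply/tightP; split=> // l la.
    by apply: le_trans le _; case/tightP: jT => _; apply.
  by apply: small_imp (small_lt0 h) => e _ ? _ _ _.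
apply: small_imp => e e0 h; apply/setP => j.
have [a0|a0] := eqVneq a.1 set0.
  have t0 y : tight a y = set0 by apply/setP => k; rewrite !inE a0 inE.
  by rewrite /restr !t0 set0I eqxx inE.
have [j0 j0T] := tight_ex x a0; have [j0a j0min] := tightP _ _ _ j0T.
have TT k : k \in tight a x -> a.2 k - x k = a.2 j0 - x j0.
  case/tightP => ka kmin; apply/eqP; rewrite eq_le kmin //=.
  exact: j0min.
rewrite /restr; case: ifP => [/eqP TG|/set0Pn[g]].
  have nG k : k \in tight a x -> (k \in G) = false.
    by move=> kT; apply/negP => kG; have := in_set0 k; rewrite -TG inE kT kG.
  apply/tightP/idP => [[ja jm]|jT].
    apply: contraT => jT; have := h _ _ j0T ja jT; have := jm j0 j0a.
    by rewrite /up (nG _ j0T); case: (j \in G); lra.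
  split; first by case/tightP: jT.
  move=> k ka; rewrite /up (nG _ jT); have [kT|kT] := boolP (k \in tight a x).
    by have := TT _ jT; have := TT _ kT; rewrite (nG _ kT); lra.
  by have := h _ _ jT ka kT; case: (k \in G); lra.
rewrite inE => /andP[gT gG]; have [ga gmin] := tightP _ _ _ gT.
apply/tightP/setIP => [[ja jm]|[jT jG]].
  have := jm g ga; rewrite /up gG.
  have [jT|jT] := boolP (j \in tight a x).
    by have := TT _ jT; have := TT _ gT; case: (j \in G) => //; lra.
  by have := h _ _ gT ja jT; case: (j \in G); lra.
split; first by case/tightP: jT.
move=> k ka; have := TT _ jT; have := j0min k ka; rewrite /up jG.
by case: (k \in G); lra.
Qed.

Lemma ub_ex (f : E -> R) : exists b, forall j, f j <= b.
Proof.
exists (\sum_j `|f j|) => j; apply: le_trans (ler_norm _) _.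
by rewrite (bigD1 j) //= lerDl sumr_ge0.
Qed.

Variables (d : nat) (BB : {set {set E}}) (v : {set E} -> R).
Hypothesis hV : vmat d BB v.
Local Notation ini := (ini BB v).
Local Notation Omega := (Omega BB v).

(** The member that the row accounts for at [x]; its complement is the enlarged row. *)
Definition corow a x := cyc (ini x) (~: tight a x).

Lemma corow_shift a x s : corow a (fun j => x j + s) = corow a x.
Proof. by rewrite /corow (ini_shift hV) tight_shift. Qed.

Lemma corow_cyclic a x : cyclic (ini x) (corow a x).
Proof. exact: (cyc_cyclic (mat_ini hV x)). Qed.

Lemma corow_up a x G : Omega x -> cyclic (ini x) G ->
  small (fun e => corow a (up x e G) = to_face (ini x) G (corow a x)).
Proof.
move=> ox cG; apply: small_imp (small_and (ini_up hV x G) (tight_up a x G)).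
by move=> e _ [ie te]; rewrite /corow ie te (cyc_face (mat_ini hV x)).
Qed.

(** Indexed by the matroid and not by the point, so that points with equal cells share the
    family. *)
Variable Fm : {set {set E}} -> 'I_d -> {set E}.
Definition fam M := [seq Fm M i | i <- enum 'I_d].
Hypothesis hFm : forall x, Omega x -> good (ini x) (fam (ini x)).

Lemma size_fam M : size (fam M) = d.
Proof. by rewrite size_map -cardE card_ord. Qed.

Lemma fam_up x G : Omega x -> cyclic (ini x) G -> small (fun e =>
  perm_eq (fam (ini (up x e G))) [seq to_face (ini x) G F | F <- fam (ini x)]).
Proof.
move=> ox cG.
apply: small_imp (small_and (ini_up hV x G) (cyclic_up_Omega hV ox cG)).
move=> e _ [ie oe]; have Mx := mat_ini hV x.
apply: (good_uniq (M := ini (up x e G))); first by rewrite size_map !size_fam.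
  exact: hFm.
by rewrite ie; apply: (good_face Mx) => //; apply: hFm.
Qed.

(** Here [r] collects the members not yet accounted for by [l], multiplicities included. *)
Definition packing l := forall x, Omega x ->
  exists r, perm_eq (fam (ini x)) ([seq corow a x | a <- l] ++ r).

Definition residual l x F := Omega x /\
  exists r, perm_eq (fam (ini x)) ([seq corow a x | a <- l] ++ r) /\ F \in r.

Lemma residual_shift l F : shift_inv ((residual l)^~ F).
Proof.
move=> x s [ox [r [rp Fr]]]; split; first by rewrite /Omega (ini_shift hV).
exists r; split=> //; rewrite (ini_shift hV).
by under eq_map do rewrite corow_shift.
Qed.

Lemma small_seq (T : Type) (P : T -> R -> Prop) (s : seq T) :
  (forall i, small (P i)) -> small (fun t => all (fun i => boolp.asbool (P i t)) s).
Proof.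
move=> h; elim: s => [|i s IH]; first exact: small_all.
by apply: small_imp (small_and (h i) IH) => t _ [/boolp.asboolP /= -> ->].
Qed.

(** Members and closed rows both change by [to_face], hence so does what is left over. The second
    half, lifting back to [x], serves limits. *)
Lemma residual_up l x G : packing l -> Omega x -> cyclic (ini x) G ->
  small (fun e =>
    (forall F, residual l x F -> residual l (up x e G) (to_face (ini x) G F)) /\
    (forall F', residual l (up x e G) F' ->
       exists2 F, residual l x F & to_face (ini x) G F = F')).
Proof.
move=> pl ox cG; have [r0 r0p] := pl x ox.
have hc := small_seq l (fun a => corow_up a ox cG).
have := small_and (small_and (fam_up ox cG) (cyclic_up_Omega hV ox cG)) hc.
apply: small_imp => e _ [[fe oe] ce].
have {}ce : [seq corow a (up x e G) | a <- l] =
    [seq to_face (ini x) G F | F <- [seq corow a x | a <- l]].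
  rewrite -map_comp; elim: (l) ce => //= a l' IH /andP[/boolp.asboolP -> /IH ->] //.
have pe r : perm_eq (fam (ini x)) ([seq corow a x | a <- l] ++ r) ->
    perm_eq (fam (ini (up x e G)))
      ([seq corow a (up x e G) | a <- l] ++ [seq to_face (ini x) G F | F <- r]).
  move=> rp; rewrite ce -map_cat; apply: perm_trans fe _.
  exact: perm_map.
split=> [F [_ [r [rp Fr]]]|F' [_ [r' [rp' F'r]]]].
  split=> //; exists [seq to_face (ini x) G F | F <- r]; split; first exact: pe.
  exact: map_f.
have : perm_eq r' [seq to_face (ini x) G F | F <- r0].
  rewrite -(perm_cat2l [seq corow a (up x e G) | a <- l]).
  by rewrite -(permPl rp') pe.
move=> /perm_mem/(_ F'); rewrite F'r => /esym/mapP[F Fr0 ->].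
by exists F => //; split=> //; exists r0.
Qed.

(** The whole ground set is cyclic on Omega and of rank [d], the number of members, so no member
    contains it. *)
Lemma residual_cyclic l x F : residual l x F -> cyclic (ini x) F /\ F != setT.
Proof.
move=> [ox [r [rp Fr]]]; have [ac cc] := hFm ox.
have Ff : F \in fam (ini x) by rewrite (perm_mem rp) mem_cat Fr orbT.
split; first exact: (allP ac).
apply/eqP => FT; have Mx := mat_ini hV x.
have /(coloopfreeP Mx) cT := ox; have := cc _ cT.
rewrite (rkT Mx) -(size_fam (ini x)) => /eqP; rewrite -all_count.
by move/allP/(_ _ Ff); rewrite FT subxx.
Qed.

Lemma residual_ray l : packing l -> (exists x F, residual l x F) ->
  exists x F, forall t, 0 <= t -> residual l (up x t F) F.
Proof.
move=> pl; apply: (flow_ray hV) => [x F rF|F|x F rF|x F ox cK q].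
- by have [cF FT] := residual_cyclic rF; case: rF.
- exact: residual_shift.
- have [cF _] := residual_cyclic rF; have [ox _] := rF.
  apply: small_imp (residual_up pl ox cF) => e _ [/(_ _ rF) + _].
  by rewrite /to_face subxx.
- by have [e _ [[_ h] /h]] := small_ex (small_and (residual_up pl ox cK) q).
Qed.

(* Along the tropical segment from a point far out on the ray to x, the closure
   of the tight set T of the new row at x remains a residual member. *)
Lemma ray_corow l y F : packing l ->
  (forall t, 0 <= t -> residual l (up y t F) F) ->
  forall x, Omega x -> residual l x (corow (~: F, y) x).
Proof.
move=> pl ray x ox; set T := tight (~: F, y) x.
have y0 : residual l y F by rewrite -(up0 y F); apply: ray.
have [_ FT] := residual_cyclic y0.
have S0 : (~: F, y).1 != set0.
  by rewrite /=; apply: contraNneq FT => h; rewrite -(setCK F) h setC0.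
have [j0 j0T] := tight_ex x S0; rewrite -/T in j0T.
have T0 : T != set0 by apply/set0Pn; exists j0.
have TF : T \subset ~: F by apply/subsetP => j /tightP[].
pose s0 := y j0 - x j0.
have sT j : j \in T -> y j - x j = s0.
  move=> jT; have [ja jm] := tightP _ _ _ jT; have [j0a j0m] := tightP _ _ _ j0T.
  by apply/eqP; rewrite eq_le jm ?j0m.
have sNT j : j \notin T -> j \notin F -> s0 < y j - x j.
  move=> jT jF; rewrite ltNge; apply: contra jT => le; apply/tightP.
  split=> /=; first by rewrite inE.
  move=> k ka; apply: le_trans le _; have [_] := tightP _ _ _ j0T; exact.
(* Far enough along the ray the coordinates in [F] exceed s0, so [z - x] attains its minimum exactly
   on [T]. *)
have [t [t0 tF]] : exists t, 0 <= t /\ forall j, s0 < y j + t - x j.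
  have [b hb] := ub_ex (fun j => s0 - (y j - x j)).
  exists (`|b| + 1); split; first by rewrite addr_ge0.
  by move=> j; have := hb j; have := ler_norm b; lra.
set z := up y t F; have rz : residual l z F := ray t t0.
have [oz _] := rz.
have zT j : j \in T -> z j - x j = s0.
  by move=> jT; rewrite /z /up; have := subsetP TF j jT; rewrite inE => /negbTE->;
     rewrite addr0 sT.
have zNT j : j \notin T -> s0 < z j - x j.
  move=> jT; rewrite /z /up; case: (boolP (j \in F)) => jF; first exact: tF.
  by rewrite addr0; apply: sNT.
clearbody z s0; clear sT sNT tF t0 t.
have zs j : s0 <= z j - x j.
  by have [/zT->//|/zNT/ltW] := boolP (j \in T).
have [b hb] := ub_ex (fun j => z j - x j).
pose Q w := residual l w (cyc (ini w) (~: T)).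
have Qs : shift_inv Q.
  move=> w s /residual_shift-/(_ s); rewrite /Q.
  by rewrite (ini_shift hV).
(* At s0 the segment is a translate of [z], where [F] is known to be residual, but not yet
   [cyc (ini w) (~: T)]. One move in direction 1_T turns both into the complement of [T]. *)
have [e0 e0p [e01 Qe0]] : exists2 e : R, 0 < e & e < 1 /\ Q (tseg x z (s0 + e)).
  pose w := tseg x z s0.
  have wz : w = fun j => z j + (- s0).
    by apply: boolp.funext => j; rewrite /w /tseg max_r //; have := zs j; lra.
  have rw : residual l w F by rewrite wz; apply: residual_shift.
  have [ow _] := rw.
  have TE : T = [set j | z j - x j <= s0].
    apply/setP => j; rewrite inE.
    by have [/zT->|/zNT] := boolP (j \in T); rewrite ?lexx // ltNge => /negbTE->.
  have TC : ~: [set j | s0 < z j - x j] = T.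
    by rewrite TE; apply/setP => j; rewrite !inE leNgt.
  have oT : small (fun e => Omega (up w e T)).
    apply: small_imp (tseg_add x z s0) => e _.
    have := Omega_tseg hV (s0 + e) ox oz; rewrite /Omega => + pe.
    by rewrite pe (ini_upN hV) TC.
  have cT := Omega_up_cyclic hV oT.
  have := small_and (small_and (tseg_add x z s0) (residual_up pl ow cT))
    (small_and (ini_up hV w T) (small_lt0 (@ltr01 R))).
  case/small_ex => e e0 [[pe [/(_ _ rw) re _]] [ie e1]].
  exists e => //; split=> //; rewrite pe; apply/(shift_upN _ _ _ Qs); rewrite TC -/w.
  rewrite /Q ie.
  have rT : restr T T = T by rewrite /restr setIid (negbTE T0).
  have Mw := mat_ini hV w.
  rewrite -[X in ~: X]rT (cyc_face Mw) //.
  have nT H : H \subset ~: T -> (T \subset H) = false.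
    move=> HT; apply/negP => TH; have := subset_trans TH HT.
    by rewrite -disjoints_subset -setI_eq0 setIid (negbTE T0).
  move: re; rewrite /to_face !nT ?cyc_sub //; last by rewrite subsetC.
  have c0 H : H \subset ~: T -> cyc (ini w) (H :&: T) = set0.
    move=> HT; have -> : H :&: T = set0.
      by apply/eqP; rewrite setI_eq0 disjoints_subset.
    by apply/eqP; rewrite -subset0 cyc_sub.
  by rewrite !c0 ?cyc_sub // subsetC.
have b1 : s0 + e0 <= Num.max b (s0 + 1) by rewrite le_max; apply/orP; right; lra.
suff : Q x by [].
apply: (tseg_induction Qs b1 _ Qe0) => [j|s sl sr q|s sl sr q].
- by rewrite le_max hb.
(* [T] lies inside [K], so restricting it to [K] leaves it unchanged. *)
- have [ow _] := q; set w := tseg x z s in q ow *; set K := [set j | z j - x j <= s].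
  have KE : ~: [set j | s < z j - x j] = K.
    by apply/setP => j; rewrite !inE leNgt.
  have oK : small (fun e => Omega (up w e K)).
    apply: small_imp (tseg_add x z s) => e _.
    have := Omega_tseg hV (s + e) ox oz; rewrite /Omega => + pe.
    by rewrite pe (ini_upN hV) KE.
  have cK := Omega_up_cyclic hV oK.
  apply: small_imp (small_and (ini_up hV w K) (residual_up pl ow cK)).
  move=> e _ [ie [/(_ _ q) + _]]; rewrite /Q ie -(cyc_face (mat_ini hV w)) //.
  rewrite /restr (setIidPl _) ?(negbTE T0) //.
  by apply/subsetP => j jT; rewrite inE zT //; lra.
(* [K] misses [T] and so lies in [cyc (ini w) (~: T)]. A lift whose [to_face] contains [K] contains
   [K] itself, and is then unchanged. *)
- set w := tseg x z s in q *; set K := [set j | s <= z j - x j] in q.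
  have ow : Omega w by apply: (Omega_tseg hV).
  have oK : small (fun e => Omega (up w e K)) by apply: small_imp q => e _ [].
  have cK := Omega_up_cyclic hV oK; have Mw := mat_ini hV w.
  have TK : T :&: K = set0.
    apply/setP => j; rewrite in_setI in_set0 [j \in K]inE; apply/negP => /andP[jT].
    by rewrite zT // => h; lra.
  have KT : K \subset cyc (ini w) (~: T).
    apply: (cyc_max Mw) => //; rewrite -disjoints_subset -setI_eq0 setIC.
    exact/eqP.
  have [e _ [[ie qe] [_ re]]] :=
    small_ex (small_and (small_and (ini_up hV w K) q) (residual_up pl ow cK)).
  move: qe; rewrite /Q ie.
  have rT : restr T K = T by rewrite /restr TK eqxx.
  rewrite -[X in ~: X]rT (cyc_face Mw) // /to_face KT => /re[F1 rF1].
  rewrite rT /to_face; case: ifP => [_ <- //|KF1 F1E].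
  suff : K \subset F1 by rewrite KF1.
  apply/subsetP => j jK; have := subsetP KT j jK; rewrite -F1E in_setU in_setC jK orbF.
  by move/(subsetP (cyc_sub _ _)); rewrite in_setI => /andP[].
Qed.

(** What infinite entries off the support mean at finite points: these coordinates may be raised at
    will within Omega. *)
Definition unbounded a := a.1 != set0 /\
  forall t, 0 <= t -> Omega (up a.2 t (~: a.1)).

Lemma packing_step l : packing l -> (exists x, Omega x) -> (size l < d)%N ->
  exists a, unbounded a /\ packing (rcons l a).
Proof.
move=> pl [x ox] sl; have [r rp] := pl x ox.
have : r != [::].
  apply/eqP => r0; move: (perm_size rp).
  by rewrite r0 cats0 size_fam size_map => e; rewrite e ltnn in sl.
case: r rp => // F r rp _.
have [|y [G ray]] := residual_ray pl.
  by exists x, F; split=> //; exists (F :: r); rewrite mem_head.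
have y0 : residual l y G by rewrite -(up0 y G); apply: ray.
have [_ GT] := residual_cyclic y0.
exists (~: G, y); split.
  split=> /=; first by apply: contraNneq GT => h; rewrite -(setCK G) h setC0.
  by move=> t /ray[]; rewrite setCK.
move=> w ow; have [_ [r' [rp' Fr']]] := ray_corow pl ray ow.
exists (rem (corow (~: G, y) w) r'); apply: perm_trans rp' _.
by rewrite map_rcons cat_rcons perm_cat2l perm_to_rem.
Qed.

Lemma packing_full : (exists x, Omega x) ->
  exists l, [/\ size l = d, packing l & forall a0 i, (i < size l)%N -> unbounded (nth a0 l i)].
Proof.
move=> ex; suff h k : (k <= d)%N ->
    exists l, [/\ size l = k, packing l & forall a0 i, (i < size l)%N -> unbounded (nth a0 l i)].
  exact: h.
elim: k => [_|k IH kd].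
  by exists [::]; split=> // x ox; exists (fam (ini x)).
have [l [sl pl ul]] := IH (ltnW kd).
have [|a [ua pa]] := packing_step pl ex; first by rewrite sl.
exists (rcons l a); split=> //; first by rewrite size_rcons sl.
move=> a0 i; rewrite size_rcons nth_rcons ltnS leq_eqVlt.
by case: ltngtP => //= lt _; apply: ul.
Qed.
End Rows.

(** * Tight sets present the cells *)

Section Tight.
Variables (R : realType) (E : finType) (d : nat) (BB : {set {set E}})
  (v : {set E} -> R).
Hypothesis hV : vmat d BB v.
Implicit Types (x y z : E -> R) (B C G H : {set E}) (e s t : R).
Implicit Types (Q : {set 'I_d}).
Local Notation ini := (ini BB v).
Local Notation Omega := (Omega BB v).
Variable A : 'I_d -> trow R E.
Hypothesis Aunb : forall i, unbounded BB v (A i).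
Local Notation T i x := (tight (A i) x).
Local Notation F i x := (corow BB v (A i) x).
Hypothesis Acard : forall x G, Omega x -> cyclic (ini x) G ->
  #|[set i | ~~ (G \subset F i x)]| = rk (ini x) G.
Hypothesis Apres : forall x, Omega x -> presents (ini x) (fun i => ~: F i x).

(** Interpolates between the closed rows, which present the cell, and the tight rows, so that a
    violation with fewest tight rows can be studied. *)
Definition hybrid Q x i := if i \in Q then T i x else ~: F i x.

Lemma tight_closed i x : T i x \subset ~: F i x.
Proof. by rewrite subsetC; apply: cyc_sub. Qed.

Lemma hybrid_closed Q x i : hybrid Q x i \subset ~: F i x.
Proof. by rewrite /hybrid; case: ifP => _ //; apply: tight_closed. Qed.

Definition viol Q x :=
  Omega x /\ exists2 B, B \in ini x & forall m, ~ is_match (hybrid Q x) m B.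

Lemma F_shift i x s : F i (fun j => x j + s) = F i x.
Proof. exact: corow_shift hV _ _ _. Qed.

Lemma viol_shift Q : shift_inv (viol Q).
Proof.
move=> x s [ox [B Bx nB]]; split; first by rewrite /Omega (ini_shift hV).
exists B; first by rewrite (ini_shift hV).
move=> m [mI mP mB]; apply: (nB m); split=> // i; have := mP i.
by rewrite /hybrid F_shift tight_shift.
Qed.

(* The rows avoiding the closed set F i form a presentation of the contraction
   by it, in which tight and closed rows are exchangeable. *)
Definition exchangeable Q x i := forall m,
  {in [set k | F i x \subset F k x] &, injective m} ->
  (forall k, F i x \subset F k x -> m k \notin F k x) ->
  exists m', [/\ {in [set k | F i x \subset F k x] &, injective m'},
    forall k, F i x \subset F k x -> m' k \in hybrid Q x k &
    m' @: [set k | F i x \subset F k x] = m @: [set k | F i x \subset F k x]].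

(** Rows become tight one at a time: rematching the rows above [F i x] on the same columns leaves
    the other rows as they were. *)
Lemma exchange_all Q x : Omega x ->
  (forall i, i \in Q -> T i x != ~: F i x -> exchangeable Q x i) ->
  forall B, B \in ini x -> exists m, is_match (hybrid Q x) m B.
Proof.
move=> ox ex B Bx.
suff h (s : seq 'I_d) : {subset s <= Q} ->
    exists m, is_match (hybrid [set k in s] x) m B.
  have [|m [mI mP mB]] := h (enum Q); first by move=> i; rewrite mem_enum.
  exists m; split=> // i; have := mP i.
  by rewrite /hybrid inE mem_enum.
elim: s => [_|i s IH sub].
  have [m [mI mP mB]] := (Apres ox B).1 Bx; exists m; split=> // i.
  by rewrite /hybrid inE in_nil.
have [|m [mI mP mB]] := IH; first by move=> k ks; apply: sub; rewrite inE ks orbT.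
have iQ : i \in Q by apply: sub; rewrite mem_head.
have [eq|ne] := eqVneq (T i x) (~: F i x).
  exists m; split=> // k; have := mP k; rewrite /hybrid !inE.
  by have [->|_] := eqVneq k i => //=; rewrite eq; case: ifP.
pose R2 := [set k | F i x \subset F k x].
have [||m' [m'I m'P m'E]] := ex i iQ ne m.
- by move=> k l _ _; apply: mI.
- by move=> k _; have := subsetP (hybrid_closed _ _ k) _ (mP k); rewrite inE.
rewrite -/R2 in m'I m'E.
have cross k l : k \in R2 -> l \notin R2 -> m' k <> m l.
  move=> kR lR e; have : m l \in m @: R2 by rewrite -m'E -e imset_f.
  by case/imsetP => k' k'R /mI ll; rewrite ll k'R in lR.
exists (fun k => if k \in R2 then m' k else m k); split.
- move=> k l; case: ifP => kR; case: ifP => lR.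
  + exact: m'I.
  + by move=> q; case: (cross k l kR (negbT lR)).
  + by move=> q; case: (cross l k lR (negbT kR)).
  + exact: mI.
- move=> k; case: ifP => kR.
    have kR' : F i x \subset F k x by move: kR; rewrite inE.
    have := m'P k kR'; rewrite /hybrid; case: ifP => [_ mT|kQ].
      by case: ifP => // _; apply: (subsetP (tight_closed k x)).
    by rewrite ifN // inE; apply: contraFN kQ; apply: sub.
  have ki : k != i by apply: contraFneq kR => ->; rewrite inE.
  by have := mP k; rewrite /hybrid !inE (negbTE ki).
- rewrite mB; apply/setP => j; apply/imsetP/imsetP => -[k _ ->].
    have [kR|kR] := boolP (k \in R2); last by exists k; rewrite ?(negbTE kR).
    have : m k \in m' @: R2 by rewrite m'E imset_f.
    by case/imsetP => l lR ->; exists l; rewrite ?lR.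
  have [kR|kR] := boolP (k \in R2); last by exists k.
  have : m' k \in m @: R2 by rewrite -m'E imset_f.
  by case/imsetP => l lR ->; exists l.
Qed.

(** An unexchangeable matching of the rows above [F i x], completed by a matching of the other rows
    into [F i x], gives a basis of the face; a hybrid matching of it would perform the exchange. *)
Lemma viol_up Q x i : Omega x -> ~ exchangeable Q x i ->
  small (fun e => viol (Q :&: [set k | F i x \subset F k x]) (up x e (F i x))).
Proof.
move=> ox nex; set G := F i x; set R2 := [set k | _].
have R2E k : (k \in R2) = (G \subset F k x) by rewrite inE.
have cG : cyclic (ini x) G by apply: (corow_cyclic hV).
have Mx := mat_ini hV x.
have LG k : (~: F k x :&: G != set0) = (k \notin R2).
  by rewrite R2E setI_eq0 disjoint_sym disjoints_subset setCK.
have [m mnex] : exists m, ~ (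
  {in R2 &, injective m} -> (forall k, G \subset F k x -> m k \notin F k x) ->
  exists m', [/\ {in R2 &, injective m'},
    forall k, G \subset F k x -> m' k \in hybrid Q x k & m' @: R2 = m @: R2]).
  by apply/boolp.existsNP.
case: (boolp.EM (
  {in R2 &, injective m} /\ (forall k, G \subset F k x -> m k \notin F k x))); last first.
  by move=> n; case: mnex => mI mN; case: n; split.
move=> [mI mN]; have {}mnex : ~ exists m', [/\ {in R2 &, injective m'},
    forall k, G \subset F k x -> m' k \in hybrid Q x k & m' @: R2 = m @: R2].
  by move=> h; apply: mnex.
clear nex; clearbody G.
have [B0 B0x eB0] := rk_attained Mx G.
have [m0 m0B] := (Apres ox B0).1 B0x.
have m0G k : (m0 k \in G) = (k \notin R2).
  by rewrite -LG (presents_meet Mx (Apres ox) cG B0x eB0 m0B).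
have [m0I m0P _] := m0B.
(* The rows outside [R2] are those whose closed row meets [G], and a basis of full rank on [G]
   matches exactly these into [G]. *)
pose mb k := if k \in R2 then m k else m0 k.
have mG k : k \in R2 -> m k \notin G.
  move=> kR; apply/negP => h; rewrite R2E in kR; have := mN k kR.
  by rewrite (subsetP kR _ h).
have mbG k : (mb k \in G) = (k \notin R2).
  by rewrite /mb; case: ifP => kR; [apply: negbTE; apply: mG | rewrite m0G kR].
have mbI : injective mb.
  move=> k l e; have := mbG k; rewrite e mbG => /negb_inj q.
  move: e; rewrite /mb q; case: ifP => kR; last exact: m0I.
  by apply: mI; rewrite // q.
have mbP k : mb k \in ~: F k x.
  rewrite /mb; case: ifP => kR; last exact: m0P.
  by rewrite inE; apply: mN; rewrite -R2E.
pose B := [set mb k | k : 'I_d].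
have mbB : is_match (fun k => ~: F k x) mb B by [].
have Bx : B \in ini x by apply/(Apres ox); exists mb.
have BG : #|B :&: G| = rk (ini x) G.
  rewrite -eB0 -(card_matchI G mbB) -(card_matchI G m0B).
  by apply: eq_card => k; rewrite !inE mbG m0G.
have hT := small_forall (fun k => tight_up (A k) x G).
have hF := small_forall (fun k => corow_up hV (A k) ox cG).
apply: small_imp (small_and (small_and hT hF)
  (small_and (ini_up hV x G) (cyclic_up_Omega hV ox cG))).
move=> e _ [[Te Fe] [ie oe]]; split=> //; exists B; first by rewrite ie inE Bx BG eqxx.
move=> m1 [m1I m1P m1B].
(* Over [R2] tight sets avoid [G] and members contain it, so the move changes neither. *)
have hin k : k \in R2 -> m1 k \in hybrid Q x k.
  move=> kR; have := m1P k; rewrite /hybrid in_setI kR andbT.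
  have GF : G \subset F k x by rewrite -R2E.
  case: ifP => _; last by rewrite Fe /to_face GF.
  rewrite Te /restr; case: ifP => // /negbT/set0Pn[j].
  rewrite inE => /andP[jT jG].
  by have := subsetP (tight_closed k x) _ jT; rewrite inE (subsetP GF _ jG).
have m1G k : (m1 k \in G) = (k \notin R2).
  have [kR|kR] := boolP (k \in R2).
    have := subsetP (hybrid_closed Q x k) _ (hin k kR); rewrite inE.
    by apply: contraNF; apply: subsetP; rewrite -R2E.
  have := subsetP (hybrid_closed _ _ k) _ (m1P k).
  rewrite Fe /to_face -R2E (negbTE kR) !in_setC in_setU negb_or in_setC negbK.
  by case/andP.
have im (f : 'I_d -> E) : (forall k, (f k \in G) = (k \notin R2)) ->
    B = [set f k | k : 'I_d] -> f @: R2 = B :\: G.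
  move=> fG ->; apply/setP => j; rewrite inE; apply/imsetP/andP.
    by case=> k kR ->; rewrite fG kR imset_f.
  case=> jG /imsetP[k _ jk]; exists k => //.
  by move: jG; rewrite jk fG negbK.
apply: mnex; exists m1; split.
- by move=> k l _ _; apply: m1I.
- by move=> k; rewrite -R2E; apply: hin.
- rewrite (im _ m1G m1B) -(im _ mbG erefl); apply: eq_in_imset => k kR.
  by rewrite /mb kR.
Qed.

(** * Violations with fewest tight rows *)

Section Minimal.
Variable Q : {set 'I_d}.
Hypothesis Qmin : forall Q' x, viol Q' x -> (#|Q| <= #|Q'|)%N.

Definition union_tight x := \bigcup_(i in Q) T i x.

(** At a violation this is the least [corow] among the rows of [Q]; the union makes it independent
    of a choice of row. *)
Definition corow_union x := cyc (ini x) (~: union_tight x).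

(** After a move along the closure of an unexchangeable row only the rows above it are left in the
    violation; by minimality these are all of [Q]. *)
Lemma viol_step x : viol Q x ->
  small (fun e => viol Q (up x e (corow_union x))) /\
  exists i, [/\ i \in Q, T i x != ~: F i x & F i x = corow_union x].
Proof.
move=> vx; have [ox [B Bx nB]] := vx; have Mx := mat_ini hV x.
have [i [iQ Ti nex]] : exists i, [/\ i \in Q, T i x != ~: F i x & ~ exchangeable Q x i].
  apply: boolp.contrapT => n; have [|m mB] := @exchange_all Q x ox _ B Bx.
    move=> i iQ Ti; apply: boolp.contrapT => nex; apply: n.
    by exists i.
  exact: nB mB.
have := viol_up ox nex; set R2 := [set k | _] => sv.
have QR : Q :&: R2 = Q.
  have [e _ ve] := small_ex sv; apply/eqP.
  by rewrite eqEcard subsetIl (Qmin ve).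
have sub k : k \in Q -> F i x \subset F k x.
  by rewrite -QR inE => /andP[_]; rewrite inE.
have FE : F i x = corow_union x.
  apply/eqP; rewrite eqEsubset; apply/andP; split.
    apply: (cyc_max Mx); first exact: (corow_cyclic hV).
    rewrite subsetC; apply/bigcupsP => k kQ; rewrite subsetC.
    exact: subset_trans (sub k kQ) (cyc_sub _ _).
  apply: (cyc_mono Mx); rewrite setCS; exact: (bigcup_sup i).
split; last by exists i.
by rewrite QR FE in sv.
Qed.

Lemma union_tight_shift x s : union_tight (fun j => x j + s) = union_tight x.
Proof. by apply: eq_bigr => i _; rewrite tight_shift. Qed.

Lemma corow_union_shift x s : corow_union (fun j => x j + s) = corow_union x.
Proof. by rewrite /corow_union union_tight_shift (ini_shift hV). Qed.

Lemma viol_neq0 x : viol Q x -> exists i, i \in Q.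
Proof.
move=> [ox [B Bx nB]]; apply/set0Pn; apply/eqP => Q0.
have [m [mI mP mB]] := (Apres ox B).1 Bx; apply: (nB m); split=> // i.
by rewrite /hybrid Q0 inE.
Qed.

Lemma union_tight_disjoint x : union_tight x :&: corow_union x = set0.
Proof.
apply/eqP; rewrite setI_eq0 disjoint_sym disjoints_subset.
exact: cyc_sub.
Qed.

Lemma tight_union i x : i \in Q -> T i x \subset union_tight x.
Proof. by move=> iQ; apply: (bigcup_sup i). Qed.

Lemma restr_union i x G : i \in Q -> union_tight x :&: G = set0 ->
  restr (T i x) G = T i x.
Proof.
move=> iQ TG; rewrite /restr; case: ifP => // /negbT; rewrite -subset0 -TG.
by rewrite setSI // tight_union.
Qed.

(** A hybrid matching at [x] of a basis of the face remains hybrid nearby: by counting, exactly the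
    rows with [K] not below [F k x] are matched into [K]. *)
Lemma viol_limit x K : Omega x -> cyclic (ini x) K ->
  small (fun e => viol Q (up x e K)) -> viol Q x.
Proof.
move=> ox cK sv; apply: boolp.contrapT => nv; have Mx := mat_ini hV x.
have hT := small_forall (fun k => tight_up (A k) x K).
have hF := small_forall (fun k => corow_up hV (A k) ox cK).
have [e _ [[Te Fe] [ie [oe [B Bx nB]]]]] :=
  small_ex (small_and (small_and hT hF) (small_and (ini_up hV x K) sv)).
move: Bx; rewrite ie inE => /andP[Bx /eqP BK].
case: (boolp.EM (exists m, is_match (hybrid Q x) m B)); last first.
  by move=> n; apply: nv; split=> //; exists B => // m mB; apply: n; exists m.
move=> [m mB]; have [mI mP BE] := mB.
have KE : [set k | m k \in K] = [set k | ~~ (K \subset F k x)].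
  apply/eqP; rewrite eqEcard Acard // (card_matchI K mB) BK leqnn andbT.
  apply/subsetP => k; rewrite !inE => mK; apply/negP => KF.
  have := subsetP (hybrid_closed Q x k) _ (mP k).
  by rewrite inE (subsetP KF _ mK).
have mK k : (m k \in K) = ~~ (K \subset F k x) by move/setP/(_ k): KE; rewrite !inE.
apply: (nB m); split=> // k; have := mP k; rewrite /hybrid; case: ifP => _ mk.
  rewrite Te /restr; case: ifP => // /negbT/set0Pn[j]; rewrite inE => /andP[jT jK].
  rewrite inE mk mK; apply/negP => KF.
  by have := subsetP (tight_closed k x) _ jT; rewrite inE (subsetP KF _ jK).
rewrite Fe /to_face; case: ifP => // KF.
move: mk; rewrite !in_setC in_setU negb_or in_setC negbK mK KF /= andbT.
by apply: contra => /(subsetP (cyc_sub _ _)); rewrite inE => /andP[].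
Qed.

Lemma viol_ray : (exists x, viol Q x) ->
  exists x G, forall t, 0 <= t ->
    viol Q (up x t G) /\ G = corow_union (up x t G).
Proof.
move=> [x0 v0]; pose Good x G := viol Q x /\ G = corow_union x.
apply: (flow_ray hV (Good := Good)); last by exists x0, (corow_union x0).
- move=> x G [vx ->]; have [ox _] := vx; have [i iQ] := viol_neq0 vx.
  split=> //; first exact: (cyc_cyclic (mat_ini hV x)).
  have [j jT] := tight_ex x (Aunb i).1; apply/eqP => GT.
  have := union_tight_disjoint x; rewrite GT setIT => /setP/(_ j).
  by rewrite inE (subsetP (tight_union x iQ)).
- move=> G x s [vx ->]; split; first exact: viol_shift.
  by rewrite corow_union_shift.
- move=> x G [vx ->]; have [ox _] := vx; set H := corow_union x.
  have cH : cyclic (ini x) H by apply: (cyc_cyclic (mat_ini hV x)).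
  have hT := small_forall (fun k => tight_up (A k) x H).
  apply: small_imp (small_and (small_and hT (ini_up hV x H)) (viol_step vx).1).
  move=> e _ [[Te ie] ve]; split=> //.
  have TH := union_tight_disjoint x.
  have -> : corow_union (up x e H) = cyc (face (ini x) H) (~: restr (union_tight x) H).
    rewrite /corow_union ie; congr (cyc _ (~: _)).
    rewrite /restr TH eqxx; apply: eq_bigr => i iQ.
    by rewrite Te restr_union.
  by rewrite (cyc_face (mat_ini hV x)) // /to_face subxx.
- move=> x G ox cK sg.
  have vx : viol Q x by apply: viol_limit ox cK _; apply: small_imp sg => e _ [].
  exists (corow_union x); first by [].
  have hT := small_forall (fun k => tight_up (A k) x (~: G)).
  have [e _ [[Te ie] [ve GE]]] := small_ex (small_and (small_and hT (ini_up hV x (~: G))) sg).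
  set K := ~: G in cK Te ie *.
  (* A tight set missing [K] would stay tight nearby and lie in [G], which tight sets of [Q] avoid
     there. *)
  have sK i : i \in Q -> restr (T i x) K = T i x :&: K.
    move=> iQ; rewrite /restr; case: ifP => // /eqP TK.
    have [j jT] := tight_ex x (Aunb i).1.
    have jK : j \in K.
      have : j \in union_tight (up x e K).
        by apply: (subsetP (tight_union _ iQ)); rewrite Te /restr TK eqxx.
      apply: contraLR => jG; have jGG : j \in G by move: jG; rewrite inE negbK.
      apply/negP => jU; have := union_tight_disjoint (up x e K); rewrite -GE.
      by move/setP/(_ j); rewrite !inE jU jGG.
    by have := in_set0 j; rewrite -TK inE jT jK.
  rewrite -(cyc_face (mat_ini hV x)) // -ie [RHS]GE /corow_union; congr (cyc _ (~: _)).
  have -> : union_tight (up x e K) = union_tight x :&: K.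
    rewrite /union_tight big_distrl /=; apply: eq_bigr => i iQ.
    by rewrite Te sK.
  rewrite /restr; case: ifP => // /eqP UK.
  have [i iQ] := viol_neq0 vx; have [j jT] := tight_ex (up x e K) (Aunb i).1.
  move: jT; rewrite Te sK // inE => /andP[jT jK].
  by have := in_set0 j; rewrite -UK inE jK (subsetP (tight_union x iQ)).
Qed.

(** Tight sets of [Q] are constant on the ray. Compare a far point of it with a far point on the ray
    of a row whose tight set is not closed: the argmax of the difference is cyclic and misses the
    tight set, hence lies in [G], which it also misses. *)
Lemma no_minimal_viol x : ~ viol Q x.
Proof.
move=> v0; have [|w [G ray]] := viol_ray; first by exists x.
have avoid i t j : i \in Q -> 0 <= t -> j \in T i (up w t G) -> j \notin G.
  move=> iQ t0 jT; have [_ GE] := ray t t0; apply/negP => jG.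
  have := union_tight_disjoint (up w t G); rewrite -GE => /setP/(_ j).
  by rewrite inE jG (subsetP (tight_union _ iQ)) // inE.
(* A support entry inside [G] would undercut all those outside after a long enough move. *)
have SG i j : i \in Q -> j \in (A i).1 -> j \notin G.
  move=> iQ ja; apply/negP => jG.
  have [b hb] := ub_ex (fun k => ((A i).2 j - w j) - ((A i).2 k - w k)).
  have t0 : 0 <= `|b| + 1 by rewrite addr_ge0.
  have [k kT] := tight_ex (up w (`|b| + 1) G) (Aunb i).1.
  have kG := avoid i _ k iQ t0 kT; have [_ /(_ j ja)] := tightP _ _ _ kT.
  rewrite /up jG (negbTE kG); have := hb k; have := ler_norm b; lra.
have tight_ray i t : i \in Q -> T i (up w t G) = T i w.
  move=> iQ; have upE k : k \in (A i).1 -> up w t G k = w k.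
    by move=> ka; rewrite /up (negbTE (SG i k iQ ka)) addr0.
  apply/setP => j; apply/tightP/tightP => -[ja jm]; split=> // k ka.
    by have := jm k ka; rewrite !upE.
  by rewrite !upE //; apply: jm.
have [b hb] : exists b : R, forall p : 'I_d * E, `|(A p.1).2 p.2 - w p.2| <= b.
  exists (\sum_(p : 'I_d * E) `|(A p.1).2 p.2 - w p.2|) => p.
  by rewrite (bigD1 p) //= lerDl sumr_ge0.
have {}hb i j : - b <= (A i).2 j - w j <= b by rewrite -ler_norml; apply: (hb (i, j)).
have [i0 _] := viol_neq0 v0; have [j0 _] := tight_ex x (Aunb i0).1.
have b0 : 0 <= b by have := hb i0 j0; lra.
(* [b] bounds the entries relative to [w]. A rise by 2b+1 off the support beats every entry on it,
   and a fall by t on [G] outweighs this rise. *)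
pose t : R := 4 * b + 2; have t0 : 0 <= t by rewrite /t; lra.
have [vt GE] := ray t t0; have [_ [i [iQ TF FE]]] := viol_step vt.
rewrite tight_ray // FE -GE in TF.
have [ot _] := vt; pose z := up (A i).2 (2 * b + 1) (~: (A i).1).
have oz : Omega z by apply: (Aunb i).2; lra.
have cz := argmax_cyclic hV ot oz; set Z := argmax _ in cz.
have TS : T i w \subset (A i).1 by apply/subsetP => j /tightP[].
have TG : T i w \subset ~: G.
  by apply/subsetP => j jT; rewrite inE (SG i) // (subsetP TS).
have [h hb1] : exists h, forall j, (j \in T i w) || (j \in G) ->
    z j - up w t G j < z h - up w t G h.
  have [/subsetP GS|/subsetPn[h]] := boolP (~: G \subset (A i).1).
    have /properP[_ [h hG hT]] : T i w \proper ~: G by rewrite properEneq TF.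
    have hS := GS h hG; exists h => j.
    have hG' : (h \in G) = false by move: hG; rewrite inE => /negbTE.
    rewrite /z /up !in_setC hS hG' /=; case: (boolP (j \in G)) => jG.
      have jS : j \notin (A i).1 by apply: contraTN jG; apply: SG.
      by rewrite jS; have := hb i j; have := hb i h; rewrite /t; lra.
    rewrite orbF => jT; have [ja jm] := tightP _ _ _ jT; rewrite ja /=.
    have : (A i).2 j - w j < (A i).2 h - w h; last by lra.
    rewrite ltNge; apply: contra hT => le; apply/tightP; split=> // k ka.
    by apply: le_trans le _; apply: jm.
  rewrite inE => hG hS; exists h => j.
  rewrite /z /up !in_setC hS (negbTE hG) /=; case: (boolP (j \in G)) => jG.
    have jS : j \notin (A i).1 by apply: contraTN jG; apply: SG.
    by rewrite jS; have := hb i j; have := hb i h; rewrite /t; lra.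
  rewrite orbF => jT; rewrite (subsetP TS) //=.
  by have := hb i j; have := hb i h; lra.
have ZN j : j \in Z -> ~~ ((j \in T i w) || (j \in G)).
  move=> jZ; apply/negP => /hb1; rewrite ltNge => /negP; apply.
  exact: (argmaxP _ _ jZ).
have [j jZ] := argmax_ex (fun j => z j - up w t G j) j0.
have ZT : Z \subset ~: T i (up w t G).
  by apply/subsetP => k /ZN; rewrite negb_or in_setC tight_ray // => /andP[].
have := subsetP (cyc_max (mat_ini hV _) cz ZT) _ jZ.
rewrite -[cyc _ _]/(F i (up w t G)) FE -GE => jG.
by have := ZN j jZ; rewrite jG orbT.
Qed.
End Minimal.

Lemma no_viol Q x : ~ viol Q x.
Proof.
move=> vx.
have exn : exists n, boolp.asbool (exists P y, viol P y /\ #|P| = n).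
  by exists #|Q|; apply/boolp.asboolP; exists Q, x.
case: (ex_minnP exn) => n /boolp.asboolP[P [y [vy Pn]]] minn.
apply: (@no_minimal_viol P) vy => P' y' v'; rewrite Pn; apply: minn.
by apply/boolp.asboolP; exists P', y'.
Qed.

Lemma tight_presents x : Omega x -> presents (ini x) (fun i => T i x).
Proof.
move=> ox B; split=> [Bx|[m mB]]; last first.
  by apply/(Apres ox); exists m; apply: match_mono mB => i; apply: tight_closed.
apply: boolp.contrapT => nB; apply: (@no_viol setT x); split=> //.
exists B => // m [mI mP mE]; apply: nB; exists m; split=> // i.
by have := mP i; rewrite /hybrid inE.
Qed.
End Tight.

(** * The values of the rows *)

Section Core.
Variables (R : realType) (E : finType) (d : nat) (BB : {set {set E}})
  (v : {set E} -> R).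
Hypothesis hV : vmat d BB v.
Implicit Types (x y z : E -> R) (B C G H : {set E}) (e s t : R).
Local Notation ini := (ini BB v).
Local Notation Omega := (Omega BB v).

(** The amount is the gap between the least reduced value of a basis avoiding [j] and that of all
    bases. *)
Lemma lower_coord x j : (exists2 B, B \in BB & j \notin B) ->
  exists t, [/\ 0 <= t, ini x \subset ini (up x (- t) [set j]),
    exists2 B, B \in ini (up x (- t) [set j]) & j \notin B &
    0 < t -> forall B, B \in ini x -> j \in B].
Proof.
case=> B0 B0B jB0.
have [/existsP[B /andP[Bx jB]]|/existsPn nB] :=
    boolP [exists B, (B \in ini x) && (j \notin B)].
  by exists 0; rewrite oppr0 up0 ltxx; split=> //; exists B.
have {}nB B : B \in ini x -> j \in B.
  by move=> Bx; have := nB B; rewrite Bx negbK.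
have P0 : (B0 \in BB) && (j \notin B0) by rewrite B0B.
case: (@arg_minP _ _ _ B0 (fun B => (B \in BB) && (j \notin B)) (red v x) P0).
move=> C /andP[CB jC] Cmin; have [D Dx] := mat_ex (mat_ini hV x).
have ge : 0 <= red v x C - red v x D by rewrite subr_ge0 (ini_le Dx).
have cj B : #|B :&: [set j]|%:R = (if j \in B then 1 else 0 : R).
  case: ifP => jB; last by rewrite (eqP (_ : B :&: [set j] == set0)) ?cards0 //
    setI_eq0 disjoint_sym disjoints1 jB.
  by rewrite (setIidPr _) ?sub1set // cards1.
have inC B : B \in BB ->
    red v (up x (- (red v x C - red v x D)) [set j]) C
      <= red v (up x (- (red v x C - red v x D)) [set j]) B.
  move=> BB_; rewrite !red_up !cj (negbTE jC); case: ifP => jB.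
    by have := ini_le Dx BB_; lra.
  have := Cmin B; rewrite BB_ jB => /(_ isT); lra.
have Ci : C \in ini (up x (- (red v x C - red v x D)) [set j]) by apply/iniP.
exists (red v x C - red v x D); split=> //; last by exists C.
apply/subsetP => B Bx; apply: (ini_of_red Ci (ini_sub Bx)).
by rewrite !red_up !cj (negbTE jC) (nB B Bx) (ini_red Bx Dx); lra.
Qed.

(* Lowering the coordinates of the coloops one after the other. *)
Lemma retraction x : (forall j, exists2 B, B \in BB & j \notin B) ->
  exists y, [/\ forall j, y j <= x j, Omega y, ini x \subset ini y &
    forall j, y j < x j -> forall B, B \in ini x -> j \in B].
Proof.
move=> hc; suff [y [h1 h2 h3 h4]] : exists y, [/\ forall j, y j <= x j,
    forall j, j \in enum E -> exists2 B, B \in ini y & j \notin B,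
    ini x \subset ini y &
    forall j, y j < x j -> forall B, B \in ini x -> j \in B].
  by exists y; split=> // j; apply: h2; rewrite mem_enum.
elim: (enum E) => [|j l [y [h1 h2 h3 h4]]].
  by exists x; split=> // j; rewrite ltxx.
have [t [t0 ti [B Bi jB] tc]] := lower_coord y (hc j).
exists (up y (- t) [set j]); split.
- by move=> k; have := h1 k; rewrite /up; case: ifP; lra.
- move=> k; rewrite inE => /orP[/eqP->|/h2[C Cy kC]]; first by exists B.
  by exists C => //; apply: (subsetP ti).
- exact: subset_trans h3 ti.
- move=> k; rewrite /up inE; case: eqP => [->|_]; last by rewrite addr0; apply: h4.
  move=> lt C Cx; have [t00|tpos] := eqVneq t 0.
    by apply: (h4 j) Cx; move: lt; rewrite t00 oppr0 addr0.
  by apply: tc; [rewrite lt_def tpos | apply: (subsetP h3)].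
Qed.

Definition indic B t : E -> R := up (fun=> 0) t B.

Lemma red_indic B t C : red v (indic B t) C = v C - t * #|C :&: B|%:R.
Proof. by rewrite red_up /red big1 // subr0. Qed.

Lemma ini_indic B : B \in BB -> exists x, B \in ini x.
Proof.
(* [t] exceeds no less than any difference of values, and another basis loses at least [t] against
   [B]. *)
move=> BB_; pose t := \sum_(C : {set E}) `|v B - v C|.
exists (indic B t); apply/iniP; split=> // C CB; rewrite !red_indic setIid.
have [->|CnB] := eqVneq C B; first by rewrite setIid.
have lt : (#|C :&: B| < #|B|)%N.
  rewrite (vmat_card hV BB_) -(vmat_card hV CB) proper_card //.
  rewrite properE subsetIl subsetI subxx /=; apply: contra CnB => s.
  by rewrite eqEcard s (vmat_card hV BB_) (vmat_card hV CB) leqnn.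
have vt : v B - v C <= t.
  by apply: le_trans (ler_norm _) _; rewrite /t (bigD1 C) //= lerDl sumr_ge0.
have t0 : 0 <= t by apply: sumr_ge0.
have : t * (#|C :&: B|.+1)%:R <= t * #|B|%:R by rewrite ler_wpM2l // ler_nat.
by rewrite -natr1; lra.
Qed.

Section WithRows.
Hypothesis hc : forall j, exists2 B, B \in BB & j \notin B.
Variable A : 'I_d -> trow R E.
Hypothesis Atight :
  forall x, Omega x -> presents (ini x) (fun i => tight (A i) x).

Definition cost (m : 'I_d -> E) := \sum_i (A i).2 (m i).

(** Linear programming duality: [x] is a dual solution certifying that tight matchings are
    cheapest. *)
Lemma tight_cost x m m' B : is_match (fun i => tight (A i) x) m B ->
  is_match (fun i => (A i).1) m' B -> cost m <= cost m'.
Proof.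
move=> [mI mT mB] [m'I m'S m'B].
have S (f : 'I_d -> E) : injective f -> B = [set f i | i : 'I_d] ->
    \sum_(j in B) x j = \sum_i x (f i).
  by move=> fI ->; rewrite big_imset //=; apply: in2W.
have : \sum_i ((A i).2 (m i) - x (m i)) <= \sum_i ((A i).2 (m' i) - x (m' i)).
  by apply: ler_sum => i _; case/tightP: (mT i) => _; apply.
by rewrite !sumrB -(S m) // -(S m') // lerD2r.
Qed.

Lemma tight_support x m B : is_match (fun i => tight (A i) x) m B ->
  is_match (fun i => (A i).1) m B.
Proof. by apply: match_mono => i; apply/subsetP => j /tightP[]. Qed.

Definition offset c x := forall B m, B \in ini x ->
  is_match (fun i => tight (A i) x) m B -> v B = c + cost m.

(** After subtracting the sum of [x] over [B], both [v] and the cost of a tight matching are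
    constant on the cell. *)
Lemma offset_ex x : Omega x -> exists c, offset c x.
Proof.
move=> ox; have [B0 B0x] := mat_ex (mat_ini hV x).
have [m0 [m0I m0T m0B]] := (Atight ox B0).1 B0x.
exists (v B0 - cost m0) => B m Bx [mI mT mB].
have S (f : 'I_d -> E) C : injective f -> C = [set f i | i : 'I_d] ->
    \sum_(j in C) x j = \sum_i x (f i).
  by move=> fI ->; rewrite big_imset //=; apply: in2W.
have := ini_red Bx B0x; rewrite /red (S m) // (S m0) //.
have : \sum_i ((A i).2 (m i) - x (m i)) = \sum_i ((A i).2 (m0 i) - x (m0 i)).
  apply: eq_bigr => i _; case/tightP: (mT i) => a1 b1.
  by case/tightP: (m0T i) => a2 b2; apply/eqP; rewrite eq_le b1 // b2.
rewrite !sumrB /cost; lra.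
Qed.

Lemma offset_link x y c : Omega x -> Omega y -> ini y \subset ini x ->
  offset c x <-> offset c y.
Proof.
move=> ox oy yx.
have eqc B m m' : is_match (fun i => tight (A i) x) m B ->
    is_match (fun i => tight (A i) y) m' B -> cost m = cost m'.
  move=> h h'; apply/eqP; rewrite eq_le.
  by rewrite (tight_cost h (tight_support h')) (tight_cost h' (tight_support h)).
split=> [cx B m By mB|cy].
  have [m' m'B] := (Atight ox B).1 (subsetP yx _ By).
  by rewrite (cx B m') ?(subsetP yx) // (eqc _ _ _ m'B mB).
have [c' cx'] := offset_ex ox; suff -> : c = c' by [].
have [B By] := mat_ex (mat_ini hV y).
have [m mB] := (Atight oy B).1 By; have Bx := subsetP yx _ By.
have [m' m'B] := (Atight ox B).1 Bx.
have := cx' _ _ Bx m'B; rewrite (cy _ _ By mB) (eqc _ _ _ m'B mB).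
exact: addIr.
Qed.

(** Neighbouring cells on a tropical segment are faces of one another, and a shared basis transports
    the constant. *)
Lemma offset_const : exists c, forall x, Omega x -> offset c x.
Proof.
have [z [_ oz _ _]] := retraction (fun=> 0) hc.
have [c cz] := offset_ex oz; exists c => x ox.
pose Q w := Omega w /\ offset c w.
have Qs : shift_inv Q.
  move=> w s [ow cw]; split; first by rewrite /Omega (ini_shift hV).
  move=> B m; rewrite (ini_shift hV) => Bw [mI mT mB]; apply: (cw B m) => //.
  by split=> // i; rewrite -(tight_shift _ _ s).
have [b0 hb0] := ub_ex (fun j => - (z j - x j)).
have [b1 hb1] := ub_ex (fun j => z j - x j).
have b01 : - b0 <= Num.max b1 (- b0) by rewrite le_max lexx orbT.
suff : Q x by case.
apply: (tseg_induction (x := x) (z := z) Qs b01) => [j||s s0 s1 [ow cw]|s s0 s1 q].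
- by have := hb1 j; rewrite le_max => ->.
- have -> : tseg x z (- b0) = fun j => z j + b0.
    apply: boolp.funext => j; rewrite /tseg opprK max_r //.
    by have := hb0 j; lra.
  exact: Qs.
- set w := tseg x z s in ow cw *; set K := [set j | z j - x j <= s].
  have KE : ~: [set j | s < z j - x j] = K.
    by apply/setP => j; rewrite !inE leNgt.
  apply: small_imp (small_and (tseg_add x z s) (ini_up hV w K)) => e _ [pe ie].
  have oe : Omega (up w e K).
    by have := Omega_tseg hV (s + e) ox oz; rewrite /Omega pe (ini_upN hV) KE.
  by split=> //; apply/(offset_link c ow oe) => //; rewrite ie; apply/subsetP => B /setIdP[].
- set w := tseg x z s in q *; set K := [set j | _] in q.
  have ow : Omega w by apply: (Omega_tseg hV).
  have [e _ [[oe ce] ie]] := small_ex (small_and q (ini_up hV w K)).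
  split=> //; apply/(offset_link c ow oe) => //.
  by rewrite ie; apply/subsetP => B /setIdP[].
Qed.

(** Every basis lies in the cell of some point of Omega. A matchable [B] outside [BB] would, at a
    large multiple of 1_B, force a basis with value below all values of [v]. *)
Lemma rows_value : exists c,
  (forall B, B \in BB ->
    exists2 m, is_match (fun i => (A i).1) m B & v B = c + cost m) /\
  (forall m B, is_match (fun i => (A i).1) m B ->
    B \in BB /\ v B <= c + cost m).
Proof.
have [c hoff] := offset_const; exists c.
have key B : B \in BB -> exists m, [/\ is_match (fun i => (A i).1) m B,
    v B = c + cost m & forall m', is_match (fun i => (A i).1) m' B -> cost m <= cost m'].
  move=> BB_; have [x Bx] := ini_indic BB_.
  have [y [_ oy xy _]] := retraction x hc; have By := subsetP xy _ Bx.
  have [m mB] := (Atight oy B).1 By; exists m; split.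
  - exact: tight_support mB.
  - exact: hoff mB.
  - by move=> m'; apply: tight_cost mB.
split=> [B /key[m [mB vB _]]|m B mB]; first by exists m.
suff BB_ : B \in BB.
  split=> //; have [m' [m'B -> h]] := key B BB_.
  by rewrite lerD2l h.
apply: contraT => nB; have [mI mS BE] := mB.
have cB : #|B| = d by rewrite BE card_imset // card_ord.
have [b hb] : exists b : R, forall C : {set E}, - b <= v C.
  exists (\sum_(C : {set E}) `|v C|) => C; rewrite lerNl.
  have := ler_norm (- v C); rewrite normrN => /le_trans -> //.
  by rewrite (bigD1 C) //= lerDl sumr_ge0.
have [t tE] : exists t : R, t = `|b| + `|c| + `|cost m| + 1 by eexists.
have t0 : 0 <= t by rewrite tE !addr_ge0.
pose x := indic B t.
have [y [yx oy xy cl]] := retraction x hc.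
have [B1 B1x] := mat_ex (mat_ini hV x); have B1y := subsetP xy _ B1x.
have [m1 m1B] := (Atight oy B1).1 B1y; have v1 := hoff _ oy _ _ B1y m1B.
have [m1I m1T m1E] := m1B.
have S w (f : 'I_d -> E) C : injective f -> C = [set f i | i : 'I_d] ->
    \sum_(j in C) w j = \sum_i w (f i) :> R.
  by move=> fI ->; rewrite big_imset //=; apply: in2W.
have le1 : \sum_i ((A i).2 (m1 i) - y (m1 i)) <= \sum_i ((A i).2 (m i) - y (m i)).
  by apply: ler_sum => i _; case/tightP: (m1T i) => _; apply.
rewrite !sumrB -(S y m1 B1) // -(S y m B) // -/(cost m) -/(cost m1) in le1.
(* Lowered coordinates belong to coloops of the cell, all contained in [B1], so [B] loses no more
   than [B1]. *)
have le2 : \sum_(j in B) (x j - y j) <= \sum_(j in B1) (x j - y j).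
  rewrite (bigID (mem B1)) /= [X in _ + X]big1 ?addr0; last first.
    move=> j /andP[_ jB1]; have := yx j; rewrite le_eqVlt => /orP[/eqP->|/cl h].
      by rewrite subrr.
    by rewrite h in jB1.
  rewrite [leRHS](bigID (mem B)) /= -[leLHS]addr0 lerD //.
    by rewrite le_eqVlt; apply/orP; left; apply/eqP; apply: eq_bigl => j; rewrite andbC.
  by apply: sumr_ge0 => j _; rewrite subr_ge0.
have xS C : \sum_(j in C) x j = t * #|C :&: B|%:R by rewrite sum_up big1 ?add0r.
rewrite !sumrB !xS setIid cB in le2.
have B1B := ini_sub B1x.
have lt : (#|B1 :&: B|.+1 <= d)%N.
  rewrite -(vmat_card hV B1B) proper_card // properE subsetIl subsetI subxx /=.
  apply: contra nB => s; suff -> : B = B1 by [].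
  by apply/esym/eqP; rewrite eqEcard s cB (vmat_card hV B1B) leqnn.
have : t * (#|B1 :&: B|.+1)%:R <= t * d%:R by rewrite ler_wpM2l // ler_nat.
rewrite -natr1 mulrDr mulr1 => le3.
have := hb B1; have := ler_norm b; have := ler_norm c; have := ler_norm (cost m).
by have := ler_norm (- c); rewrite normrN; move: v1 le1 le2 le3; clear -tE; lra.
Qed.
End WithRows.

Theorem core : (forall j, exists2 B, B \in BB & j \notin B) ->
  (forall x, Omega x -> exists P : 'I_d -> {set E}, presents (ini x) P) ->
  exists (A : 'I_d -> trow R E) c,
  (forall B, B \in BB ->
    exists2 m, is_match (fun i => (A i).1) m B & v B = c + cost A m) /\
  (forall m B, is_match (fun i => (A i).1) m B ->
    B \in BB /\ v B <= c + cost A m).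
Proof.
move=> hc LT.
have [Fm hFm] : exists Fm : {set {set E}} -> 'I_d -> {set E}, forall x, Omega x ->
    [/\ forall i, cyclic (ini x) (Fm (ini x) i),
      forall G, cyclic (ini x) G -> #|[set i | ~~ (G \subset Fm (ini x) i)]| = rk (ini x) G &
      presents (ini x) (fun i => ~: Fm (ini x) i)].
  pose P (M : {set {set E}}) (F : 'I_d -> {set E}) := coloopfree M -> (exists x, M = ini x) ->
    [/\ forall i, cyclic M (F i),
      forall G, cyclic M G -> #|[set i | ~~ (G \subset F i)]| = rk M G &
      presents M (fun i => ~: F i)].
  have [|Fm h] := @boolp.choice _ _ P.
    move=> M; case: (boolp.EM (coloopfree M /\ exists x, M = ini x)) => [[cM [x Mx]]|n].
      have [|Q hQ] := LT x; first by rewrite /Omega -Mx.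
      exists (fun i => cyc M (~: Q i)) => _ _; rewrite Mx.
      by apply: (closed_rows (mat_ini hV x)); rewrite ?card_ord.
    by exists (fun=> set0) => c e; case: n.
  by exists Fm => x ox; apply: h => //; exists x.
have countE (F : 'I_d -> {set E}) G : count (fun X : {set E} => ~~ (G \subset X)) [seq F i | i <- enum 'I_d]
    = #|[set i | ~~ (G \subset F i)]|.
  rewrite -sum1_count big_map big_enum_cond -sum1dep_card.
  by apply: eq_bigl => i.
have hg x : Omega x -> good (ini x) (fam Fm (ini x)).
  move=> ox; have [h1 h2 _] := hFm x ox; split.
    by apply/allP => _ /mapP[i _ ->].
  by move=> G cG; rewrite countE h2.
have [|l [sl pl ul]] := packing_full hV hg.
  by have [y [_ oy _ _]] := retraction (fun=> 0) hc; exists y.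
pose a0 : trow R E := (set0, fun=> 0); pose A (i : 'I_d) := nth a0 l i.
have unb i : unbounded BB v (A i) by apply: ul; rewrite sl.
have lA : l = [seq A i | i <- enum 'I_d].
  apply: (@eq_from_nth _ a0); first by rewrite size_map -cardE card_ord.
  move=> i; rewrite sl => id; rewrite (nth_map (Ordinal id)) -?cardE ?card_ord //.
  by rewrite /A nth_enum_ord.
have perm x : Omega x -> exists p : 'S_d, forall i, Fm (ini x) i = corow BB v (A (p i)) x.
  move=> ox; have [r rp] := pl x ox.
  (* [d] rows fill a family of size [d], so rows and members agree up to a permutation, which may
     depend on [x]. *)
  have r0 : r = [::].
    apply/nilP; have /perm_size := rp; rewrite size_fam size_cat size_map sl.
    by move=> q; rewrite /nilp -(eqn_add2l d) -q addn0.
  rewrite r0 cats0 lA -map_comp in rp.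
  have sz : size [seq (fun a => corow BB v a x) (A i) | i <- enum 'I_d] == d.
    by rewrite size_map -cardE card_ord.
  have /tuple_permP[p /= e] : perm_eq (fam Fm (ini x)) (Tuple sz) := rp.
  exists p => i; have id : (i < size (enum 'I_d))%N by rewrite -cardE card_ord.
  have := congr1 (nth set0 ^~ i) e; rewrite /fam (nth_map i) // nth_ord_enum => ->.
  rewrite (nth_map i) // nth_ord_enum (tnth_nth set0) /= (nth_map i) ?nth_ord_enum //.
  by rewrite -cardE card_ord.
have Acard x G : Omega x -> cyclic (ini x) G ->
    #|[set i | ~~ (G \subset corow BB v (A i) x)]| = rk (ini x) G.
  move=> ox cG; have [p hp] := perm x ox; have [_ <- // _] := hFm x ox.
  rewrite -[RHS](card_imset _ (@perm_inj _ p)); apply: eq_card => i.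
  apply/idP/imsetP => [|[k + ->]]; last by rewrite !inE hp.
  by rewrite inE => h; exists ((p^-1)%g i); rewrite ?permKV // inE hp permKV.
have Apres x : Omega x -> presents (ini x) (fun i => ~: corow BB v (A i) x).
  move=> ox B; have [p hp] := perm x ox; have [_ _ hP] := hFm x ox.
  split=> [/hP|] [m [mI mP mB]].
    exists (m \o (p^-1)%g); split; first exact: inj_comp mI perm_inj.
      by move=> i; have := mP ((p^-1)%g i); rewrite hp permKV.
    rewrite mB; apply/setP => j; apply/imsetP/imsetP => -[i _ ->].
      by exists (p i); rewrite //= permK.
    by exists ((p^-1)%g i).
  apply/hP; exists (m \o p); split; first exact: inj_comp mI perm_inj.
    by move=> i; rewrite hp; apply: mP.
  rewrite mB; apply/setP => j; apply/imsetP/imsetP => -[i _ ->].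
    by exists ((p^-1)%g i); rewrite //= permKV.
  by exists (p i).
have At := tight_presents hV unb Acard Apres.
have [c hA] := rows_value hc At.
by exists A, c.
Qed.
End Core.

(** * Maximal cells and coloops *)

Section Valued.
Variables (R : realType) (E : finType) (d : nat).
Implicit Types (x w : E -> R) (B C : {set E}).

(** [v] is [c] plus the least cost of a matching, stated as attainment and upper bound; the
    matchable sets are exactly [BB]. *)
Definition valued_by (A : 'I_d -> trow R E) (c : R) (BB : {set {set E}})
    (v : {set E} -> R) :=
  (forall B, B \in BB ->
    exists2 m, is_match (fun i => (A i).1) m B & v B = c + cost A m) /\
  (forall m B, is_match (fun i => (A i).1) m B ->
    B \in BB /\ v B <= c + cost A m).

Lemma match_sum (f : E -> R) P (m : 'I_d -> E) B : is_match P m B ->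
  \sum_(j in B) f j = \sum_i f (m i).
Proof. by case=> mI _ ->; rewrite big_imset //=; apply: in2W. Qed.

Variables (A : 'I_d -> trow R E) (c : R) (BB : {set {set E}}) (v : {set E} -> R).
Hypothesis hA : valued_by A c BB v.
Hypothesis hV : vmat d BB v.
Local Notation ini := (ini BB v).
Local Notation Supp := (fun i => (A i).1).
Variables (x : E -> R) (S : {set E}).
Hypothesis S_sub : forall B, B \in BB -> S \subset B.
Hypothesis S_avoid : forall j, j \notin S -> exists2 B, B \in ini x & j \notin B.

(** Reroute row [i] to [j] against an optimal matching of a basis avoiding [j]. Both results match
    bases and totals are preserved, so optimality leaves the inequality at row [i]. *)
Lemma optimal_row m B i j : B \in ini x -> is_match Supp m B ->
  v B = c + cost A m -> j \in (A i).1 -> j \notin S ->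
  m i \notin S /\ (A i).2 (m i) - x (m i) <= (A i).2 j - x j.
Proof.
move=> Bx mB vB jS jnS; have [B' B'x jB'] := S_avoid jnS.
have [m' m'B vB'] := hA.1 _ (ini_sub B'x).
have [mI mS mE] := mB; have [m'I m'S m'E] := m'B.
have [k|m1 [m2 [m1I m2I mm]]] := @reroute _ _ m m' i j mI m'I.
  by apply: contraNneq jB' => <-; rewrite m'E imset_f.
pose p k := if k == i then j else m k.
have {}mm k : m1 k = p k /\ m2 k = m' k \/ m1 k = m' k /\ m2 k = p k := mm k.
have pS k : p k \in (A k).1 by rewrite /p; case: eqP => [->|].
have M1 : is_match Supp m1 [set m1 k | k : 'I_d].
  by split=> // k; case: (mm k) => -[-> _].
have M2 : is_match Supp m2 [set m2 k | k : 'I_d].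
  by split=> // k; case: (mm k) => -[_ ->].
have [b1 v1] := hA.2 _ _ M1; have [b2 v2] := hA.2 _ _ M2.
have tot (f : 'I_d -> E -> R) :
    \sum_k f k (m1 k) + \sum_k f k (m2 k) = \sum_k f k (p k) + \sum_k f k (m' k).
  rewrite -!big_split; apply: eq_bigr => k _ /=.
  by case: (mm k) => -[-> ->] //; rewrite addrC.
have swap (f : 'I_d -> E -> R) : \sum_k f k (p k) = \sum_k f k (m k) - f i (m i) + f i j.
  rewrite (bigD1 i) //= [in RHS](bigD1 i) //= /p eqxx.
  rewrite (eq_bigr (fun k => f k (m k))) => [|k /negbTE -> //]; lra.
split; last first.
  have := tot (fun k => (A k).2); have := tot (fun=> x).
  rewrite (swap (fun k => (A k).2)) (swap (fun=> x)).
  rewrite -!/(cost A _) -(match_sum x M1) -(match_sum x M2).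
  rewrite -(match_sum x mB) -(match_sum x m'B).
  have := ini_le Bx b1; have := ini_le B'x b2; rewrite /red.
  by move: v1 v2 vB vB'; clear; lra.
apply/negP => iS.
(* After the rerouting [m i] occurs at most once in both matchings together, whereas two bases
   containing [S] need it twice. *)
have totn : (\sum_k (m1 k == m i) + \sum_k (m2 k == m i) =
    \sum_k (p k == m i) + \sum_k (m' k == m i))%N.
  rewrite -!big_split; apply: eq_bigr => k _ /=.
  by case: (mm k) => -[-> ->] //; rewrite addnC.
have p0 : (\sum_k (p k == m i) = 0)%N.
  rewrite big1 // => k _.
  rewrite /p; case: (eqVneq k i) => [_|ki]; last by rewrite (inj_eq mI) (negbTE ki).
  by case: eqP => // e; rewrite e iS in jnS.
have pos m0 (m0I : injective m0) : [set m0 k | k : 'I_d] \in BB ->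
    (0 < \sum_k (m0 k == m i))%N.
  move=> /S_sub/subsetP/(_ _ iS)/imsetP[k _ e].
  by rewrite (bigD1 k) //= e eqxx.
have := pos m1 m1I b1; have := pos m2 m2I b2; have := sum_inj_le1 (m i) m'I.
move: totn; rewrite p0; clear; lia.
Qed.

(** Rows matched into [S] shrink to singletons, the others to tight sets outside [S]. Serves the
    converse as well as the faces of maximal cells. *)
Lemma tight_cell : exists (P : 'I_d -> {set E}) (Q : {set 'I_d}),
  [/\ presents (ini x) P, forall i, i \in Q -> P i \subset ~: S &
    forall i, i \notin Q -> exists2 s, s \in S & P i = [set s]].
Proof.
have [B0 B0x] := mat_ex (mat_ini hV x).
have [m0 m0B v0] := hA.1 _ (ini_sub B0x).
have [m0I m0S m0E] := m0B.
pose Q := [set i | m0 i \notin S].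
pose A' i : trow R E := ((A i).1 :\: S, (A i).2).
pose P i := if i \in Q then tight (A' i) x else [set m0 i].
have PS i : i \in Q -> P i \subset ~: S.
  move=> iQ; rewrite /P iQ; apply/subsetP => j /tightP[].
  by rewrite /= !inE => /andP[].
have tightQ m B i : B \in ini x -> is_match Supp m B -> v B = c + cost A m ->
    i \in Q -> m i \in tight (A' i) x.
  move=> Bx mB vB iQ; have iS : m0 i \notin S by move: iQ; rewrite inE.
  have [mi _] := optimal_row Bx mB vB (m0S i) iS.
  apply/tightP; split=> /=; first by rewrite inE mi; case: mB => _ + _; apply.
  by move=> k; rewrite inE => /andP[kS ka]; case: (optimal_row Bx mB vB ka kS).
have S0 : [set m0 i | i in ~: Q] = S.
  apply/setP => j; apply/imsetP/idP => [[i]|jS].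
    by rewrite !inE negbK => iS ->.
  have := subsetP (S_sub (ini_sub B0x)) _ jS; rewrite m0E => /imsetP[i _ e].
  by exists i => //; rewrite !inE negbK -e.
exists P, Q; split=> //; last first.
  move=> i iQ; exists (m0 i); last by rewrite /P (negbTE iQ).
  by move: iQ; rewrite inE negbK.
move=> B; split=> [Bx|[m mB]].
  have [m mB vB] := hA.1 _ (ini_sub Bx); have [mI mS mE] := mB.
  (* Which rows are matched into [S] is the same for all optimal matchings: [optimal_row] applies
     both ways. *)
  have mQ i : (m i \notin S) = (i \in Q).
    rewrite inE; apply/idP/idP => iS.
      by case: (optimal_row B0x m0B v0 (mS i) iS).
    by case: (optimal_row Bx mB vB (m0S i) iS).
  exists (fun i => if i \in Q then m i else m0 i); split.
  - move=> i k; case: ifP => iQ; case: ifP => kQ; [exact: mI| | |exact: m0I].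
      have := mQ i; rewrite iQ => + e; rewrite e.
      by move: kQ; rewrite inE => /negbFE->.
    have := mQ k; rewrite kQ => + e; rewrite -e.
    by move: iQ; rewrite inE => /negbFE->.
  - move=> i; rewrite /P; case: ifP => iQ; last by rewrite inE.
    exact: tightQ Bx mB vB iQ.
  - apply/setP => j; apply/idP/imsetP => [jB|[i _ ->]].
      have [jS|jS] := boolP (j \in S).
        move: (jS); rewrite -S0 => /imsetP[i iQ ->]; exists i => //.
        by move: iQ; rewrite inE => /negbTE->.
      move: (jB); rewrite mE => /imsetP[i _ e]; exists i => //.
      by rewrite -mQ -e jS.
    case: ifP => iQ; first by rewrite mE imset_f.
    apply: (subsetP (S_sub (ini_sub Bx))).
    by move: iQ; rewrite inE => /negbFE.
have [mI mP mE] := mB.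
have mB' : is_match Supp m B.
  apply: match_mono mB => i; rewrite /P; case: ifP => iQ.
    by apply/subsetP => j /tightP[]; rewrite inE => /andP[].
  by rewrite sub1set.
have [BB_ vB] := hA.2 _ _ mB'; apply: (ini_of_red B0x BB_).
have : \sum_i ((A i).2 (m i) - x (m i)) <= \sum_i ((A i).2 (m0 i) - x (m0 i)).
  apply: ler_sum => i _; have := mP i; rewrite /P; case: ifP => iQ.
    case/tightP => _ /(_ (m0 i)); apply.
    by rewrite inE m0S andbT; move: iQ; rewrite inE.
  by rewrite inE => /eqP->.
rewrite !sumrB -(match_sum x m0B) -(match_sum x mB') /red.
by move: vB; rewrite v0 /cost; lra.
Qed.
End Valued.

(** * Cells of full dimension *)

Section Full.
Variables (R : realType) (E : finType) (d : nat) (BB : {set {set E}})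
  (v : {set E} -> R).
Hypothesis hV : vmat d BB v.
Implicit Types (x w : E -> R) (B C : {set E}).
Local Notation ini := (ini BB v).

Definition const_on (M : {set {set E}}) w := forall B C, B \in M -> C \in M ->
  \sum_(j in B) w j = \sum_(j in C) w j.

(* The maximal cells, described by linear functionals instead of dimensions. *)
Definition full x := forall w, const_on (ini x) w -> const_on BB w.

(** In a largest cell containing the given one, a functional constant on the cell but not on [BB]
    could be followed until a further basis becomes minimal. *)
Lemma full_cell x : exists2 y, ini x \subset ini y & full y.
Proof.
pose P k := boolp.asbool (exists2 y, ini x \subset ini y & #|ini y| = k).
have exk : exists k, P k by exists #|ini x|; apply/boolp.asboolP; exists x.
have ubk k : P k -> (k <= #|{: {set E}}|)%N.
  by move=> /boolp.asboolP[y _ <-]; apply: max_card.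
case: (ex_maxnP exk ubk) => k /boolp.asboolP[y xy yk] kmax.
exists y => // w wy; have [B0 B0y] := mat_ex (mat_ini hV y).
suff h w' : const_on (ini y) w' ->
    forall C, C \in BB -> \sum_(j in C) w' j <= \sum_(j in B0) w' j.
  suff e C : C \in BB -> \sum_(j in C) w j = \sum_(j in B0) w j.
    by move=> B C BB_ CB; rewrite !e.
  move=> CB; apply/eqP; rewrite eq_le h //=.
  have := h (fun j => - w j) _ C CB; rewrite !sumrN lerN2; apply.
  by move=> B D By Dy; rewrite !sumrN (wy B D).
move: w' => {w wy} w wy C CB; rewrite leNgt; apply/negP => gt.
pose W (D : {set E}) := \sum_(j in D) w j.
have P0 : (C \in BB) && (W B0 < W C) by rewrite CB.
(* The step length at which [D] ties with [B0] along [w]; the least one gives the first tie. *)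
pose r D := (red v y D - red v y B0) / (W D - W B0).
case: (@arg_minP _ _ _ C (fun D => (D \in BB) && (W B0 < W D)) r P0).
move=> D /andP[DB gD] Dmin.
have DN : D \notin ini y.
  by apply/negP => Dy; move: gD; rewrite /W (wy D B0) // ltxx.
pose y1 j := y j + r D * w j.
have red1 F : red v y1 F = red v y F - r D * W F.
  by rewrite /red big_split /= -mulr_sumr /W; lra.
have rD0 : 0 <= r D.
  apply: divr_ge0; rewrite subr_ge0; [exact: ini_le B0y DB | exact: ltW].
have rDE : r D * (W D - W B0) = red v y D - red v y B0.
  by rewrite /r divfK // gt_eqF // subr_gt0.
have B01 : B0 \in ini y1.
  apply/iniP; split; first exact: ini_sub B0y.
  move=> F FB; rewrite !red1; have le := ini_le B0y FB.
  have [gF|lF] := ltP (W B0) (W F); last by nra.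
  have := Dmin F; rewrite FB gF => /(_ isT).
  by rewrite /r -/(r D) ler_pdivlMr ?subr_gt0 //; lra.
have sub : ini y \subset ini y1.
  apply/subsetP => F Fy; apply: (ini_of_red B01 (ini_sub Fy)).
  by rewrite !red1 (ini_red Fy B0y) /W (wy F B0).
have D1 : D \in ini y1.
  by apply: (ini_of_red B01 DB); rewrite !red1; lra.
have : (#|ini y| < #|ini y1|)%N.
  by apply/proper_card/properP; split=> //; exists D.
rewrite yk ltnNge kmax //; apply/boolp.asboolP; exists y1 => //.
exact: subset_trans xy sub.
Qed.

End Full.

(** * Contracting and restoring common coloops *)

Section Coloops.
Variables (R : realType) (E : finType) (d : nat) (BB : {set {set E}})
  (v : {set E} -> R) (S : {set E}).
Hypothesis hV : vmat (d + #|S|) BB v.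
Hypothesis S_sub : forall B, B \in BB -> S \subset B.
Implicit Types (x w : E -> R) (B C : {set E}).

(* Contraction of the set S of coloops; its elements become loops. *)
Definition contr := [set B :\: S | B in BB].
Definition contr_val B := v (B :|: S).

Lemma contrP B : reflect ([disjoint B & S] /\ B :|: S \in BB) (B \in contr).
Proof.
apply: (iffP imsetP) => [[C CB ->]|[dB BS]].
  have CS : C :\: S :|: S = C.
    by rewrite setUC setDE setUIr setUCr setIT; apply/setUidPr/S_sub.
  by rewrite CS; split=> //; rewrite disjoints_subset setDE subsetIr.
exists (B :|: S) => //; rewrite setDUl setDv setU0.
by apply/esym/setDidPl.
Qed.

Lemma contr_vmat : vmat d contr contr_val.
Proof.
split=> [B /contrP[dB BS]||B1 B2 i /contrP[d1 b1] /contrP[d2 b2]].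
- have := vmat_card hV BS; rewrite cardsU.
  have -> : B :&: S = set0 by apply/eqP; rewrite setI_eq0.
  by rewrite cards0 subn0 => /addIn.
- by have [B BB_] := vmat_ex hV; exists (B :\: S); apply: imset_f.
rewrite inE => /andP[iB2 iB1].
have nS B : [disjoint B & S] -> forall k, k \in B -> k \notin S.
  by move=> dB k kB; rewrite (disjointFr dB kB).
have iS := nS _ d1 i iB1.
have [|j [jB m1 m2 le]] := vmat_exch hV (i := i) b1 b2.
  by rewrite !inE iB1 (negbTE iB2) (negbTE iS).
move: jB; rewrite !inE !negb_or => /andP[/andP[jB1 jS]].
rewrite (negbTE jS) orbF => jB2.
have E1 B k l : k \notin S -> (l |: B :\ k) :|: S = l |: (B :|: S) :\ k.
  move=> kS; apply/setP => h; rewrite !inE; case: (eqVneq h k) => [->|] //=.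
  by rewrite (negbTE kS) !orbF.
  by rewrite orbA.
have dj B k l : [disjoint B & S] -> l \notin S -> [disjoint l |: B :\ k & S].
  move=> dB lS; rewrite disjoints_subset; apply/subsetP => h; rewrite !inE.
  by case/orP => [/eqP->//|/andP[_ hB]]; rewrite (nS _ dB).
exists j; split.
- by rewrite inE jB1.
- by apply/contrP; rewrite E1 //; split=> //; apply: dj.
- by apply/contrP; rewrite E1 //; split=> //; apply: dj.
- by rewrite /contr_val !E1.
Qed.

Lemma contr_ini x B : reflect ([disjoint B & S] /\ B :|: S \in ini BB v x)
  (B \in ini contr contr_val x).
Proof.
have redE C : [disjoint C & S] ->
    red contr_val x C = red v x (C :|: S) + \sum_(j in S) x j.
  move=> dC; rewrite /red [in RHS](eq_bigl [predU C & S]) => [|j]; last by rewrite !inE.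
  by rewrite bigU //= /contr_val; lra.
apply: (iffP idP) => [/iniP[/contrP[dB BS] h]|[dB BS]]; last apply/iniP.
  split=> //; apply/iniP; split=> // C CB.
  have CC : C :\: S \in contr by apply: imset_f.
  have [dC _] := contrP _ CC; have := h _ CC.
  rewrite !redE // lerD2r; congr (_ <= red v x _).
  by rewrite setUC setDE setUIr setUCr setIT; apply/setUidPr/S_sub.
split=> [|C /contrP[dC CS]]; first by apply/contrP; split=> //; apply: ini_sub BS.
by rewrite !redE // lerD2r; apply: ini_le BS CS.
Qed.

(** Each basis contains [S], so the singleton rows number |S| and the rows in [Q] number [d]; the
    latter present the contraction. *)
Lemma contr_presents x (P : 'I_(d + #|S|) -> {set E}) (Q : {set 'I_(d + #|S|)}) :
  presents (ini BB v x) P -> (forall i, i \in Q -> P i \subset ~: S) ->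
  (forall i, i \notin Q -> exists2 s, s \in S & P i = [set s]) ->
  exists P' : 'I_d -> {set E}, presents (ini contr contr_val x) P'.
Proof.
move=> hP hQ hN.
have inQ B m i : is_match P m B -> (m i \in S) = (i \notin Q).
  move=> [_ mP _]; have [iQ|iQ] := boolP (i \in Q).
    by apply/negbTE; have := subsetP (hQ i iQ) _ (mP i); rewrite inE.
  by have [s sS e] := hN i iQ; have := mP i; rewrite e inE => /eqP->.
have [B0 B0x] := mat_ex (mat_ini hV x); have [m0 m0B] := (hP B0).1 B0x.
have cQ : #|Q| = d.
  have cB : #|B0 :&: S| = #|S| by rewrite (setIidPr _) // S_sub // (ini_sub B0x).
  have := card_matchI S m0B; rewrite cB => e.
  have e' : (#|Q| + #|~: Q| = d + #|S|)%N by rewrite cardsC card_ord.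
  have cN : #|~: Q| = #|S|.
    by apply: etrans _ e; apply: eq_card => i; rewrite !inE (inQ _ _ _ m0B).
  by move: e'; rewrite cN => /addIn.
pose f (k : 'I_d) : 'I_(d + #|S|) := enum_val (cast_ord (esym cQ) k).
have fI : injective f by move=> k l /enum_val_inj/cast_ord_inj.
have fQ k : f k \in Q by apply: enum_valP.
have fsurj i : i \in Q -> exists k, i = f k.
  move=> iQ; exists (cast_ord cQ (enum_rank_in iQ i)).
  by rewrite /f cast_ordK enum_rankK_in.
exists (P \o f) => B; split=> [/contr_ini[dB BS]|[m [mI mP mE]]].
  have [m mB] := (hP _).1 BS; have [mI mP mE] := mB.
  exists (m \o f); split; [exact: inj_comp | by move=> k; apply: mP |].
  apply/setP => j; apply/idP/imsetP => [jB|[k _ -> /=]].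
    have : j \in B :|: S by rewrite inE jB.
    rewrite mE => /imsetP[i _ e].
    have iQ : i \in Q.
      by have := inQ _ _ i mB; rewrite -e (disjointFr dB jB) => /esym/negbFE.
    by have [k ek] := fsurj i iQ; exists k => //=; rewrite -ek.
  have : m (f k) \in B :|: S by rewrite mE imset_f.
  by rewrite inE (inQ _ _ _ mB) fQ orbF.
have nS k : m k \notin S by have := subsetP (hQ _ (fQ k)) _ (mP k); rewrite inE.
have dB : [disjoint B & S].
  rewrite disjoints_subset; apply/subsetP => j; rewrite mE => /imsetP[k _ ->].
  by rewrite inE.
apply/contr_ini; split=> //; apply/hP.
have [m0I m0P m0E] := m0B.
pose g i := if [pick k | f k == i] is Some k then m k else m0 i.
have gf k : g (f k) = m k.
  rewrite /g; case: pickP => [l /eqP/fI-> //|/(_ k)]; by rewrite eqxx.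
have gN i : i \notin Q -> g i = m0 i.
  by move=> iQ; rewrite /g; case: pickP => // k /eqP e; rewrite -e fQ in iQ.
have gP i : g i \in P i.
  have [iQ|iQ] := boolP (i \in Q); last by rewrite gN.
  by have [k ->] := fsurj i iQ; rewrite gf; apply: mP.
exists g; split=> //.
  move=> i k; have [iQ|iQ] := boolP (i \in Q); have [kQ|kQ] := boolP (k \in Q).
  - have [i' ->] := fsurj i iQ; have [k' ->] := fsurj k kQ.
    by rewrite !gf => /mI ->.
  - have [i' ->] := fsurj i iQ; rewrite gf gN // => e.
    by have := inQ _ _ k m0B; rewrite -e (negbTE (nS _)) kQ.
  - have [k' ->] := fsurj k kQ; rewrite gf gN // => e.
    by have := inQ _ _ i m0B; rewrite e (negbTE (nS _)) iQ.
  - by rewrite !gN // => /m0I.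
apply/setP => j; rewrite inE; apply/orP/imsetP => [[|jS]|[i _ ->]].
- by rewrite mE => /imsetP[k _ ->]; exists (f k); rewrite ?gf.
- have := subsetP (S_sub (ini_sub B0x)) _ jS; rewrite m0E => /imsetP[i _ e].
  have iQ : i \notin Q by rewrite -(inQ _ _ _ m0B) -e.
  by exists i => //; rewrite gN.
- have [iQ|iQ] := boolP (i \in Q); last by right; rewrite gN // (inQ _ _ _ m0B).
  by left; have [k ->] := fsurj i iQ; rewrite gf mE imset_f.
Qed.

Lemma contr_valued (A : 'I_d -> trow R E) c : valued_by A c contr contr_val ->
  exists A' : 'I_(d + #|S|) -> trow R E, valued_by A' c BB v.
Proof.
move=> [hA1 hA2].
pose A' (i : 'I_(d + #|S|)) : trow R E := match split i with
  | inl k => ((A k).1 :\: S, (A k).2)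
  | inr l => ([set enum_val l], fun=> 0) end.
have Al k : A' (lshift #|S| k) = ((A k).1 :\: S, (A k).2).
  by rewrite /A' (unsplitK (inl k)).
have Ar l : A' (rshift d l) = ([set enum_val l], fun=> 0).
  by rewrite /A' (unsplitK (inr l)).
have costE m : cost A' m = cost A (fun k => m (lshift #|S| k)).
  rewrite /cost big_split_ord /= [X in _ + X]big1 ?addr0 => [|l _].
    by apply: eq_bigr => k _; rewrite Al.
  by rewrite Ar.
have US B : B \in BB -> B :\: S :|: S = B.
  by move=> BB_; rewrite setUC setDE setUIr setUCr setIT; apply/setUidPr/S_sub.
exists A'; split=> [B BB_|m B [mI mP mE]].
  have BC : B :\: S \in contr by apply: imset_f.
  have [m0 [m0I m0P m0E] vB] := hA1 _ BC.
  have m0S k : m0 k \in B :\: S by rewrite m0E imset_f.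
  pose m (i : 'I_(d + #|S|)) : E := match split i with inl k => m0 k | inr l => enum_val l end.
  have ml k : m (lshift #|S| k) = m0 k by rewrite /m (unsplitK (inl k)).
  have mr l : m (rshift d l) = enum_val l by rewrite /m (unsplitK (inr l)).
  exists m; last first.
    rewrite costE -[v B]/(v B) -{1}(US B BB_) -[v _]/(contr_val _) vB.
    by congr (_ + _); apply: eq_bigr => k _; rewrite ml.
  split.
  - move=> i k; rewrite -(splitK i) -(splitK k).
    case: (split i) => i'; case: (split k) => k'; rewrite /= ?ml ?mr.
    + by move=> /m0I ->.
    + by move=> e; have := m0S i'; rewrite e inE enum_valP.
    + by move=> e; have := m0S k'; rewrite -e inE enum_valP.
    + by move=> /enum_val_inj ->.
  - move=> i; rewrite -(splitK i); case: (split i) => i' /=.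
      by rewrite Al ml inE m0P andbT; have := m0S i'; rewrite inE => /andP[].
    by rewrite Ar mr inE.
  - apply/setP => j; apply/idP/imsetP => [jB|[i _ ->]].
      have [jS|jS] := boolP (j \in S).
        by exists (rshift d (enum_rank_in jS j)); rewrite // mr enum_rankK_in.
      have : j \in B :\: S by rewrite inE jS.
      by rewrite m0E => /imsetP[k _ ->]; exists (lshift #|S| k); rewrite ?ml.
    rewrite -(splitK i); case: (split i) => i' /=.
      by rewrite ml; have := m0S i'; rewrite inE => /andP[].
    by rewrite mr (subsetP (S_sub BB_)) // enum_valP.
pose m0 k := m (lshift #|S| k).
have m0M : is_match (fun k => (A k).1) m0 [set m0 k | k : 'I_d].
  split=> // [k l /mI/lshift_inj //|k].
  by have := mP (lshift #|S| k); rewrite Al inE => /andP[].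
have [BC le] := hA2 _ _ m0M; have [dB BS] := contrP _ BC.
have mr l : m (rshift d l) = enum_val l by have := mP (rshift d l); rewrite Ar inE => /eqP.
have -> : B = [set m0 k | k : 'I_d] :|: S.
  rewrite mE; apply/setP => j; rewrite inE; apply/imsetP/orP => [[i _ ->]|[|jS]].
  - rewrite -(splitK i); case: (split i) => i' /=; first by left; rewrite imset_f.
    by right; rewrite mr enum_valP.
  - by case/imsetP => k _ ->; exists (lshift #|S| k).
  - by exists (rshift d (enum_rank_in jS j)); rewrite // mr enum_rankK_in.
by split=> //; rewrite costE.
Qed.
End Coloops.

Theorem valued_full (R : realType) (E : finType) (d : nat) (BB : {set {set E}})
    (v : {set E} -> R) : vmat d BB v ->
  (forall x, full BB v x -> exists P : 'I_d -> {set E}, presents (ini BB v x) P) ->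
  exists A c, @valued_by R E d A c BB v.
Proof.
move=> hV hfull; pose S := [set j | [forall B in BB, j \in B]].
have S_sub B : B \in BB -> S \subset B.
  by move=> BB_; apply/subsetP => j; rewrite inE => /forall_inP; apply.
have S_av j : j \notin S -> exists2 B, B \in BB & j \notin B.
  by rewrite inE negb_forall_in => /exists_inP[B BB_ jB]; exists B.
have [d0 dE] : exists d0, d = (d0 + #|S|)%N.
  have [B BB_] := vmat_ex hV; exists (d - #|S|)%N.
  by rewrite subnK // -(vmat_card hV BB_) subset_leq_card // S_sub.
move: S S_sub S_av dE => S S_sub S_av dE; subst d.
have [||A [c hA]] := core (contr_vmat hV S_sub).
- move=> j; have [jS|jS] := boolP (j \in S).
    have [B BB_] := vmat_ex hV; exists (B :\: S); first exact: imset_f.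
    by rewrite inE jS.
  have [B BB_ jB] := S_av j jS; exists (B :\: S); first exact: imset_f.
  by rewrite inE (negbTE jB) andbF.
- move=> x ox; have [y xy fy] := full_cell hV x.
  (* With value 0 on the bases of the full cell at [y], the cell of [x] reappears as its initial
     matroid at [x - y]. *)
  have [P hP] := hfull y fy; pose w j := x j - y j.
  pose A (i : 'I_(d0 + #|S|)) : trow R E := (P i, fun=> 0).
  have cost0 m : cost A m = 0 by apply: big1.
  have hA : valued_by A 0 (ini BB v y) (fun=> 0).
    split=> [B /hP[m mB]|m B mB]; first by exists m; rewrite ?cost0 ?addr0.
    by rewrite cost0 addr0; split=> //; apply/hP; exists m.
  have hM : vmat (d0 + #|S|) (ini BB v y) (fun=> 0 : R).
    split; [exact: mat_card (mat_ini hV y)|exact: mat_ex (mat_ini hV y)|].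
    move=> B1 B2 i b1 b2 /(mat_exch (mat_ini hV y) b1 b2)[j [h1 h2 h3]].
    by exists j; split=> //; rewrite addr0.
  have iniE : ini (ini BB v y) (fun=> 0) w = ini BB v x.
    have [B0 B0x] := mat_ex (mat_ini hV x); have B0y := subsetP xy _ B0x.
    have redE B : B \in ini BB v y ->
        red (fun=> 0) w B = red v x B - red v y B0.
      move=> By; rewrite (ini_red B0y By) /red sumrB; lra.
    apply/setP => B; apply/iniP/iniP => -[b h].
      split=> [|C CB]; first exact: ini_sub b.
      have := h _ B0y; rewrite !redE // lerD2r => le.
      exact: le_trans le (ini_le B0x CB).
    have Bx : B \in ini BB v x by apply/iniP.
    split=> [|C Cy]; first exact: (subsetP xy).
    rewrite (redE B (subsetP xy _ Bx)) (redE C Cy) lerD2r.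
    exact: ini_le Bx (ini_sub Cy).
  have [||P' [Q [h1 h2 h3]]] := tight_cell hA hM (x := w) (S := S).
  + by move=> B By; apply: S_sub; apply: ini_sub By.
  + move=> j jS; have [B] := ox j.
    case/(contr_ini _ S_sub) => dB BS jB; exists (B :|: S); first by rewrite iniE.
    by rewrite inE negb_or jB.
  by rewrite iniE in h1; apply: contr_presents h1 h2 h3.
have [A' hA'] := contr_valued S_sub hA.
by exists A', c.
Qed.

(** * Polytopes and dimension *)

Section Polytope.
Variables (R : realType) (n : nat).
Implicit Types (M N : {set {set 'I_n}}) (B C : {set 'I_n}) (w : 'I_n -> R)
  (q : 'rV[R]_n).

Lemma polytope_gen M B : B \in M -> matroid_polytope R M (indicator_vec R B).
Proof. by move=> BM; apply: classical_sets.sub_gen_smallest; exists B. Qed.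

Lemma sum_indicator w B :
  \sum_j w j * indicator_vec R B ord0 j = \sum_(j in B) w j.
Proof.
rewrite [RHS]big_mkcond; apply: eq_bigr => j _; rewrite mxE.
by case: ifP => _; rewrite ?mulr1 ?mulr0.
Qed.

Lemma polytope_le M w k : (forall B, B \in M -> \sum_(j in B) w j <= k) ->
  forall q, matroid_polytope R M q -> \sum_j w j * q ord0 j <= k.
Proof.
move=> h q Mq; pose H : classical_sets.set 'rV[R]_n :=
  fun p => \sum_j w j * p ord0 j <= k.
suff : H q by [].
move: q Mq; apply: classical_sets.smallest_sub; last first.
  by move=> _ [B BM <-]; rewrite /H sum_indicator; apply: h.
move=> x y l; rewrite !classical_sets.in_setE /H => hx hy.
set t := l%:num.
have t01 : 0 <= t <= 1 by rewrite /t ge0 le1.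
change (\sum_j w j *
  (t *: (x : 'rV[R]_n) + (1 - t) *: (y : 'rV[R]_n)) ord0 j <= k).
have -> : \sum_j w j * (t *: (x : 'rV[R]_n) + (1 - t) *: (y : 'rV[R]_n)) ord0 j =
    t * (\sum_j w j * x ord0 j) + (1 - t) * (\sum_j w j * y ord0 j).
  rewrite !mulr_sumr -big_split; apply: eq_bigr => j _ /=.
  by rewrite !mxE; ring.
by case/andP: t01 => t0 t1; nra.
Qed.

(** The sum of the coordinates in [B] reaches [d] at the vertex of [B] and is at most [d - 1] at any
    other. *)
Lemma polytope_inj M N d : (forall B, B \in M -> #|B| = d) ->
  (forall B, B \in N -> #|B| = d) ->
  matroid_polytope R M = matroid_polytope R N -> M = N.
Proof.
suff sub M' N' : (forall B, B \in M' -> #|B| = d) ->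
    (forall B, B \in N' -> #|B| = d) ->
    matroid_polytope R M' = matroid_polytope R N' -> M' \subset N'.
  by move=> cM cN e; apply/eqP; rewrite eqEsubset !sub.
move=> cM cN e; apply/subsetP => B BM; apply: contraT => BN.
pose w (j : 'I_n) : R := (j \in B)%:R.
have wE C : \sum_(j in C) w j = #|C :&: B|%:R.
  rewrite -sumr_const big_mkcond [RHS]big_mkcond /=; apply: eq_bigr => j _.
  by rewrite /w inE; case: (j \in C); case: (j \in B).
have := polytope_gen BM; rewrite e => /(@polytope_le _ w (d%:R - 1)) h.
have /h : forall C, C \in N' -> \sum_(j in C) w j <= d%:R - 1.
  move=> C CN; rewrite wE lerBrDr natr1 ler_nat -(cN C CN) proper_card //.
  rewrite properE subsetIl subsetI subxx /=; apply: contra BN => s.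
  suff -> : B = C by [].
  by apply/esym/eqP; rewrite eqEcard s (cM B BM) (cN C CN) leqnn.
by rewrite sum_indicator wE setIid (cM B BM); lra.
Qed.

(** Zero rows for the non-members give the matrices of different matroids the same shape and row
    index. *)
Definition dir_mx M B0 : 'M[R]_(#|{: {set 'I_n}}|, n) :=
  \matrix_i (if enum_val i \in M then
               indicator_vec R (enum_val i) - indicator_vec R B0 else 0).

Lemma dir_mxE M B0 m (W : 'M[R]_(n, m)) : dir_mx M B0 *m W = 0 <->
  (forall B k, B \in M -> \sum_(j in B) W j k = \sum_(j in B0) W j k).
Proof.
have rowE i k : (dir_mx M B0 *m W) i k = if enum_val i \in M then
    \sum_(j in enum_val i) W j k - \sum_(j in B0) W j k else 0.
  rewrite mxE; case: ifP => iM; last first.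
    by apply: big1 => j _; rewrite mxE iM mxE mul0r.
  rewrite -!(sum_indicator (fun j => W j k)) -sumrB; apply: eq_bigr => j _.
  by rewrite mxE iM !mxE; lra.
split=> [/matrixP e B k BM|h].
  have := e (enum_rank B) k; rewrite rowE enum_rankK BM mxE => /eqP.
  by rewrite subr_eq0 => /eqP.
apply/matrixP => i k; rewrite rowE mxE; case: ifP => // iM.
by apply/eqP; rewrite subr_eq0; apply/eqP/h.
Qed.

Lemma affine_dim_polytope M B0 : B0 \in M ->
  affine_dim (matroid_polytope R M) = \rank (dir_mx M B0).
Proof.
move=> BM; apply/eqP; rewrite eqn_leq; apply/andP; split.
  apply/bigmax_leqP => k /boolp.asboolP[p [D [Mp MD fD]]].
  (* Differences of points are tested against the cokernel, whose columns are functionals constant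
     on the members, hence on the polytope. *)
  rewrite -(eqP fD); apply: mxrankS; rewrite submxE; apply/eqP.
  set W := cokermx _.
  have /dir_mxE hW : dir_mx M B0 *m W = 0 by apply: mulmx_coker.
  have val q l : matroid_polytope R M q ->
      \sum_j W j l * q ord0 j = \sum_(j in B0) W j l.
    move=> Mq; apply/eqP; rewrite eq_le; apply/andP; split.
      by apply: (polytope_le (w := fun j => W j l) _ Mq) => B BB; rewrite hW.
    have : \sum_j - W j l * q ord0 j <= - \sum_(j in B0) W j l.
      apply: (polytope_le (w := fun j => - W j l) _ Mq) => B BB.
      by rewrite sumrN hW.
    by under eq_bigr do rewrite mulNr; rewrite sumrN lerN2.
  apply/matrixP => i l; rewrite [RHS]mxE mxE.
  have := val _ l (MD i); rewrite -(val p l Mp) => /eqP.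
  rewrite -subr_eq0 -sumrB => /eqP e; rewrite -[RHS]e; apply: eq_bigr => j _.
  by rewrite !mxE; lra.
have lt : (\rank (dir_mx M B0) < n.+1)%N by rewrite ltnS rank_leq_col.
rewrite -[leqLHS]/(nat_of_ord (Ordinal lt)).
apply: leq_bigmax_cond => /=; apply/boolp.asboolP.
exists (indicator_vec R B0), (rowsub (maxrankfun (dir_mx M B0)) (dir_mx M B0)).
split; [exact: polytope_gen| |exact: maxrowsub_free].
move=> i; rewrite row_rowsub rowK; case: ifP => iM; last first.
  by rewrite addr0; apply: polytope_gen.
by rewrite addrC subrK; apply: polytope_gen.
Qed.

Lemma affine_dim_full M N : M \subset N -> M != finset.set0 ->
  affine_dim (matroid_polytope R M) = affine_dim (matroid_polytope R N) <->
  (forall w, const_on M w -> const_on N w).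
Proof.
move=> MN /set0Pn[B0 BM]; have BN := subsetP MN _ BM.
rewrite (affine_dim_polytope BM) (affine_dim_polytope BN).
have le : (dir_mx M B0 <= dir_mx N B0)%MS.
  apply/row_subP => i; rewrite rowK; case: ifP => iM; last exact: sub0mx.
  rewrite -[X in (X <= _)%MS](_ : row i (dir_mx N B0) = _) ?row_sub //.
  by rewrite rowK (subsetP MN).
have constE (K : {set {set 'I_n}}) w : B0 \in K ->
    const_on K w <-> dir_mx K B0 *m (\col_j w j) = 0.
  move=> BK; rewrite dir_mxE; split=> [h B k BB|h B C BB CB].
    by under eq_bigr do rewrite mxE; under [RHS]eq_bigr do rewrite mxE; apply: h.
  have e (D : {set 'I_n}) : D \in K -> \sum_(j in D) w j = \sum_(j in B0) w j.
    by move=> DK; have := h D ord0 DK; under eq_bigr do rewrite mxE;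
       under [RHS]eq_bigr do rewrite mxE.
  by rewrite !e.
have [_ rk_eq] := mxrank_leqif_sup le; split=> [/eqP|h].
  rewrite rk_eq => /submxP[D e] w /(constE _ _ BM) z.
  by apply/(constE _ _ BN); rewrite e -mulmxA z mulmx0.
apply/eqP; rewrite rk_eq submxE; apply/eqP; apply/dir_mxE => B k BB.
have : const_on M (fun j => cokermx (dir_mx M B0) j k).
  have /dir_mxE hW : dir_mx M B0 *m cokermx (dir_mx M B0) = 0 by apply: mulmx_coker.
  by move=> C D CM DM; rewrite !hW.
by move/h; apply.
Qed.
End Polytope.

(** * The tropical Stiefel map *)

Section Stiefel.
Variables (R : realType) (n d : nat).
Implicit Types (A : 'M[\bar R]_(d, n)) (B : {set 'I_n}) (M : {set {set 'I_n}})
  (V : {set 'I_n} -> \bar R).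

Lemma image_match (P : 'I_d -> {set 'I_n}) m B :
  is_match P m B <-> [/\ #|B| = d, forall i, m i \in P i &
    [set m i | i : 'I_d] = B].
Proof.
split=> [[mI mP ->]|[cB mP mE]]; first by rewrite card_imset // card_ord.
split=> //; have : #|[set m i | i : 'I_d]| == #|'I_d| by rewrite mE cB card_ord.
by move/imset_injP => mI i k; apply: mI.
Qed.

Definition rows_of A (i : 'I_d) : trow R 'I_n :=
  ([set j | A i j != +oo%E], fun j => fine (A i j)).

Lemma sum_rows_of A m : (forall i j, A i j != -oo%E) ->
  (forall i, m i \in (rows_of A i).1) ->
  (\sum_i A i (m i))%E = (cost (rows_of A) m)%:E.
Proof.
move=> Afin h; rewrite /cost -sumEFin; apply: eq_bigr => i _ /=.
by rewrite fineK // fin_numE Afin; have := h i; rewrite inE.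
Qed.

Lemma stiefel_valued A (c : R) V : (forall i j, A i j != -oo%E) ->
  (forall B, #|B| = d -> V B = (c%:E + stiefel A B)%E) ->
  valued_by (rows_of A) c (underlying d V) (fun B => fine (V B)).
Proof.
move=> Afin VE; split=> [B|m B mB].
  rewrite inE => /andP[/eqP cB]; rewrite VE // => lt.
  have slt : (stiefel A B < +oo)%E.
    by move: lt; case: (stiefel A B) => [r _|/=|_]; rewrite ?ltry ?ltNye ?ltxx.
  have [/existsP[j0 j0B]|/existsPn none] :=
      boolP [exists j : {ffun 'I_d -> 'I_n}, (j @: 'I_d) == B]; last first.
    by move: slt; rewrite /stiefel big_pred0 ?ltxx // => j; apply/negbTE/none.
  move: slt; rewrite /stiefel (@bigmin_eq_arg _ _ _ _ j0 _ _ j0B) => [|j _]; last exact: leey.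
  case: arg_minP => // j /eqP jB _ slt.
  (* A finite minimum is attained by a map through finite entries only, i.e. inside the supports. *)
  have jS i : j i \in (rows_of A i).1.
    rewrite inE; apply/eqP => e; move: slt; rewrite ltey => /eqP; apply.
    apply/eqP; rewrite esum_eqy; first by apply/exists_inP; exists i => //; apply/eqP.
    by move=> k _; apply: Afin.
  exists j; first by apply/image_match; split=> //; rewrite -jB.
  by rewrite sum_rows_of.
have [cB mS mE] := (image_match _ _ _).1 mB.
have le : (stiefel A B <= (cost (rows_of A) m)%:E)%E.
  rewrite -sum_rows_of //.
  have -> : (\sum_i A i (m i))%E = (\sum_i A i ([ffun i => m i] i))%E.
    by apply: eq_bigr => i _; rewrite ffunE.
  apply: bigmin_le_cond; apply/eqP; rewrite -mE; apply: eq_imset => i.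
  by rewrite ffunE.
have sfin : stiefel A B != -oo%E.
  rewrite /stiefel -ltNye; apply: (lt_bigmin) => [|j _]; first by rewrite ltNye.
  rewrite ltNye esum_eqNy; apply/negP => /exists_inP[i _ /eqP e].
  by have := Afin i (j i); rewrite e.
have [r sE] : exists r, stiefel A B = r%:E.
  by move: le sfin; case: (stiefel A B) => [r _ _||//]; [exists r | rewrite leye_eq].
rewrite inE cB eqxx VE // sE ltry; split=> //=.
by move: le; rewrite sE lee_fin lerD2l.
Qed.

Lemma valued_stiefel (A : 'I_d -> trow R 'I_n) (c : R) V v :
  (forall B, #|B| = d -> V B != -oo%E) ->
  (forall B, B \in underlying d V -> V B = (v B)%:E) ->
  valued_by A c (underlying d V) v -> transversal_valuated d V.
Proof.
move=> Vfin Vv [h1 h2].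
pose A' : 'M[\bar R]_(d, n) :=
  \matrix_(i, j) (if j \in (A i).1 then ((A i).2 j)%:E else +oo%E).
have A'fin i j : A' i j != -oo%E by rewrite mxE; case: ifP.
have sumS (m : 'I_d -> 'I_n) : (forall i, m i \in (A i).1) ->
    (\sum_i A' i (m i))%E = (cost A m)%:E.
  by move=> mS; rewrite /cost -sumEFin; apply: eq_bigr => i _; rewrite mxE mS.
have sumN (m : 'I_d -> 'I_n) i : m i \notin (A i).1 -> (\sum_i A' i (m i))%E = +oo%E.
  move=> mi; apply/eqP; rewrite esum_eqy; last by move=> k _.
  by apply/exists_inP; exists i => //; rewrite mxE (negbTE mi).
have supp (m : 'I_d -> 'I_n) :
    (forall i, m i \in (A i).1) \/ exists i, m i \notin (A i).1.
  have [/forallP|/forallPn] := boolP [forall i, m i \in (A i).1]; first by left.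
  by right.
exists A', c; split=> // B cB.
have [BU|BU] := boolP (B \in underlying d V).
  have [m mB vB] := h1 _ BU; rewrite Vv // vB EFinD; congr (_ + _)%E.
  have [_ mS mE] := (image_match _ _ _).1 mB.
  apply/eqP; rewrite eq_le; apply/andP; split.
    apply/bigmin_geP; split=> [|j /eqP jB]; first exact: leey.
    have [jS|[i ji]] := supp j; last by rewrite (sumN _ i ji) leey.
    rewrite sumS // lee_fin.
    have jM : is_match (fun i => (A i).1) j B by apply/image_match.
    by have [_] := h2 _ _ jM; rewrite vB lerD2l.
  rewrite -sumS //.
  have -> : (\sum_i A' i (m i))%E = (\sum_i A' i ([ffun i => m i] i))%E.
    by apply: eq_bigr => i _; rewrite ffunE.
  apply: bigmin_le_cond; apply/eqP; rewrite -mE; apply: eq_imset => i.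
  by rewrite ffunE.
have -> : V B = +oo%E.
  by move: BU; rewrite inE cB eqxx /= -leNgt leye_eq => /eqP.
suff -> : stiefel A' B = +oo%E by [].
apply/eqP; rewrite -leye_eq; apply/bigmin_geP; split=> // j /eqP jB.
have [jS|[i ji]] := supp j; last by rewrite (sumN _ i ji).
have jM : is_match (fun i => (A i).1) j B by apply/image_match.
by have [] := h2 _ _ jM; rewrite (negbTE BU).
Qed.

Lemma underlying_matroid_val M : (forall B, B \in M -> #|B| = d) ->
  underlying d (matroid_val R M) = M.
Proof.
move=> cM; apply/setP => B; rewrite inE /matroid_val.
have [BM|BM] := boolP (B \in M); first by rewrite cM // eqxx ltey.
by rewrite ltxx andbF.
Qed.

Lemma transversal_presents M : (forall B, B \in M -> #|B| = d) ->
  transversal_matroid R d M <-> exists P : 'I_d -> {set 'I_n}, presents M P.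
Proof.
move=> cM; split=> [[A [c [Afin hA]]]|[P hP]].
  have := stiefel_valued Afin hA; rewrite underlying_matroid_val // => -[h1 h2].
  exists (fun i => (rows_of A i).1) => B; split=> [/h1[m mB _]|[m /h2[]//]].
  by exists m.
apply: (@valued_stiefel (fun i => (P i, fun=> 0)) 0 _ (fun=> 0)).
- by move=> B _; rewrite /matroid_val; case: ifP.
- by rewrite underlying_matroid_val // /matroid_val => B ->.
have c0 m : cost (fun i : 'I_d => ((P i, fun=> 0) : trow R 'I_n)) m = 0 by apply: big1.
rewrite underlying_matroid_val //; split=> [B /hP[m mB]|m B mB].
  by exists m; rewrite ?c0 ?addr0.
by rewrite c0 addr0; split=> //; apply/hP; exists m.
Qed.

(** In the Pluecker relation for [B1] minus [i] and [B2] plus [i], the term at [i] is V B1 + V B2.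
    The minimum being attained twice, another index does at least as well, which makes its values
    finite. *)
Lemma underlying_vmat V : valuated_matroid d V ->
  vmat d (underlying d V) (fun B => fine (V B)).
Proof.
move=> hV; split=> [B||B1 B2 i].
- by rewrite inE => /andP[/eqP].
- have [B cB nB] := vm_point hV; exists B.
  by rewrite inE cB eqxx ltey nB.
rewrite !inE => /andP[/eqP c1 f1] /andP[/eqP c2 f2] /andP[iB2 iB1].
have cA : #|B1 :\ i|.+1 = d by rewrite -c1 (cardsD1 i B1) iB1.
have cC : #|i |: B2| = d.+1 by rewrite cardsU1 iB2 c2.
have [j [k [jD kD jk jmin kmin]]] := vm_plucker hV cA cC.
have iD : i \in (i |: B2) :\: (B1 :\ i) by rewrite !inE eqxx.
have [l [lD li lmin]] : exists l, [/\ l \in (i |: B2) :\: (B1 :\ i), l != i &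
    (V (l |: B1 :\ i) + V ((i |: B2) :\ l) <=
     V (i |: B1 :\ i) + V ((i |: B2) :\ i))%E].
  have [ji|ji] := eqVneq j i; last by exists j; split=> //; apply: jmin.
  exists k; split=> //; first by rewrite -ji eq_sym.
  exact: kmin i iD.
have [lB1 lB2] : l \notin B1 /\ l \in B2.
  by move: lD; rewrite !inE (negbTE li) /= => /andP[-> ->].
have e1 : i |: B1 :\ i = B1 by rewrite setD1K.
have e2 : (i |: B2) :\ i = B2.
  by rewrite setDUl setDv set0U; apply/setDidPl; rewrite disjoint_sym disjoints1.
have e3 : (i |: B2) :\ l = i |: B2 :\ l.
  by apply/setP => h; rewrite !inE; case: (eqVneq h i) => [->|] //=; rewrite eq_sym li.
rewrite e1 e2 e3 in lmin.
have cl1 : #|l |: B1 :\ i| = d by rewrite cardsU1 !inE (negbTE lB1) andbF -cA.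
have cl2 : #|i |: B2 :\ l| = d.
  by rewrite cardsU1 !inE (negbTE iB2) andbF /= -c2 (cardsD1 l B2) lB2.
have n1 := vm_tropical hV c1; have n2 := vm_tropical hV c2.
have n3 := vm_tropical hV cl1; have n4 := vm_tropical hV cl2.
have [r1 E1] : exists r, V B1 = r%:E.
  by move: f1 n1; case: (V B1) => [r _ _||] //; exists r.
have [r2 E2] : exists r, V B2 = r%:E.
  by move: f2 n2; case: (V B2) => [r _ _||] //; exists r.
rewrite E1 E2 in lmin *.
have [r3 [r4 [E3 E4]]] : exists r3 r4,
    V (l |: B1 :\ i) = r3%:E /\ V (i |: B2 :\ l) = r4%:E.
  move: n3 n4 lmin; case: (V (l |: _)) => [r3||] // _; case: (V (i |: _)) => [r4||] // _.
  by exists r3, r4.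
rewrite E3 E4 -!EFinD lee_fin in lmin.
by exists l; rewrite !inE lB1 lB2 cl1 cl2 eqxx E3 E4 !ltry.
Qed.

Lemma initial_ini V (x : 'rV[R]_n) : valuated_matroid d V ->
  initial_matroid d V x =
  ini (underlying d V) (fun B => fine (V B)) (fun j => x ord0 j).
Proof.
move=> hV; set v := fun B => _.
have VE B : B \in underlying d V -> V B = (v B)%:E.
  rewrite inE => /andP[/eqP cB lt]; rewrite /v fineK // fin_numE.
  by rewrite (vm_tropical hV) // -ltey lt.
have VN B : #|B| = d -> B \notin underlying d V -> V B = +oo%E.
  by move=> cB; rewrite inE cB eqxx -leNgt leye_eq => /eqP.
have [B0 cB0 nB0] := vm_point hV.
have B0U : B0 \in underlying d V by rewrite inE cB0 eqxx ltey nB0.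
apply/setP => B; rewrite inE; apply/andP/iniP => [[/eqP cB /forallP h]|[BU h]].
  have BU : B \in underlying d V.
    apply: contraT => BU; have := h B0.
    by rewrite cB0 eqxx (VN B cB BU) (VE B0 B0U) /= leye_eq.
  split=> // C CU; have := h C; have := CU; rewrite {1}inE => /andP[-> _] /=.
  by rewrite (VE _ BU) (VE _ CU) -!EFinB lee_fin.
split; first by move: BU; rewrite inE => /andP[].
apply/forallP => C; apply/implyP => /eqP cC.
have [CU|CU] := boolP (C \in underlying d V); last by rewrite (VN C cC CU) leey.
by rewrite (VE _ BU) (VE _ CU) -!EFinB lee_fin; apply: h.
Qed.

End Stiefel.

Theorem theorem6p20 (R : realType) (n d : nat) (V : {set 'I_n} -> \bar R)
    (hV : valuated_matroid d V) :
  transversal_valuated d V <->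
  (forall M : {set {set 'I_n}}, matroid d M ->
     maximal_cell d V (matroid_polytope R M) -> transversal_matroid R d M).
Proof.
have hv := underlying_vmat hV.
have cellP (x : 'I_n -> R) : ini (underlying d V) (fun B => fine (V B)) x =
    initial_matroid d V (\row_j x j).
  rewrite initial_ini //; congr (ini _ _ _).
  by apply: boolp.funext => j; rewrite mxE.
have fullP (x : 'I_n -> R) :
    affine_dim (matroid_polytope R (ini (underlying d V) (fun B => fine (V B)) x)) =
    affine_dim (matroid_polytope R (underlying d V)) <->
    full (underlying d V) (fun B => fine (V B)) x.
  apply: affine_dim_full; first by apply/subsetP => B /ini_sub.
  by have [B Bx] := mat_ex (mat_ini hv x); apply/set0Pn; exists B.
split=> [[A [c [Afin hA]]] M mM [[x PM] dimM]|h].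
  have hv' := stiefel_valued Afin hA.
  rewrite initial_ini // in PM; pose y j := x ord0 j; rewrite -/y in PM.
  have ME : M = ini (underlying d V) (fun B => fine (V B)) y.
    apply: polytope_inj PM; first exact: matroid_rank mM.
    exact: mat_card (mat_ini hv y).
  rewrite ME in dimM; have fy := (fullP y).1 dimM.
  apply/transversal_presents; first exact: matroid_rank mM.
  rewrite ME; pose S := [set j | [forall B in ini (underlying d V) (fun B => fine (V B)) y, j \in B]].
  have [||P [Q [hP _ _]]] := tight_cell hv' hv (x := y) (S := S); last by exists P.
    (* A coordinate constant on a full cell is constant on all bases, so coloops of the cell are
       coloops of V. *)
    move=> B BU; apply/subsetP => j; rewrite inE => /forall_inP jy.
    have [B0 B0y] := mat_ex (mat_ini hv y).
    have wE (C : {set 'I_n}) : \sum_(k in C) ((k == j)%:R : R) = (j \in C)%:R.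
      have [jC|jC] := boolP (j \in C).
        by rewrite (bigD1 j) //= eqxx big1 ?addr0 // => k /andP[_ /negbTE ->].
      by rewrite big1 // => k kC; case: eqP => // e; rewrite -e kC in jC.
    have jc : const_on (ini (underlying d V) (fun B => fine (V B)) y)
        (fun k => (k == j)%:R : R).
      by move=> C D Cy Dy; rewrite !wE !jy.
    have := fy _ jc B B0 BU (ini_sub B0y); rewrite !wE (jy _ B0y).
    by case: (j \in B) => // /eqP; rewrite eq_sym oner_eq0.
  by move=> j; rewrite inE negb_forall_in => /exists_inP[B By jB]; exists B.
have [x fx|A [c hA]] := @valued_full _ _ _ _ _ hv.
  have Mx := mat_ini hv x; set M := ini _ _ x in Mx *.
  apply/transversal_presents; first exact: mat_card Mx.
  apply: h; last first.
    by split; [exists (\row_j x j); rewrite -cellP | apply/fullP].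
  split; first exact: mat_card Mx.
    by have [B Bx] := mat_ex Mx; apply/set0Pn; exists B.
  move=> B1 B2 b1 b2 i iB; have [j [jB m1 _]] := mat_exch Mx b1 b2 iB.
  by exists j.
apply: (valued_stiefel _ _ hA) => B; first exact: (vm_tropical hV).
rewrite inE => /andP[/eqP cB lt]; rewrite fineK // fin_numE.
by rewrite (vm_tropical hV) // -ltey lt.
Qed.
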